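(* Let $x$ and $Q$ be sufficiently large real numbers with $\sqrt{2x} < Q \leq x$, and let $\mathcal{A} = (a_n)_{n \leq x}$ be a complex sequence. Suppose that: (Progressions Condition) for some $K_{\text{prog}} > 0$, $$ \sum_{1 \leq r \leq 2x/Q} \sum_{1 \leq a \leq r} \Biggl( \sum_{n \leq x, n \equiv a \bmod r} |a_{n}| \Biggr) \max_{z \leq x} \left| \mathcal{A}(z;r,a) - \mathrm{Aver}(\mathcal{A},z;r,(a,r)) \right| \leq \frac{(\sum_{n \leq x} |a_n|)^2}{K_{\text{prog}}} ;$$ (Non-concentration on Multiples) for every $H \leq Q$ there is some $K_{\text{conc}}[H] > 0$ with $$ \sum_{H \leq h \leq Q} \Biggl( \sum_{n \leq x,\, h \mid n} |a_{n}| \Biggr)^2 \leq \frac{(\sum_{n \leq x} |a_n|)^2}{K_{\text{conc}}[H]} .$$ Suppose furthermore that for some parameters $3 \leq P \leq R \leq x^{1/10}$ and some $K_{\text{int}}^{(1)}, K_{\text{int}}^{(2)} > 0$ and $K_{\text{int}}^{(3)} \geq 1$ the following hold: (Resembles the Integers I) for any $h \in \mathbb{N}$ and any interval $I \subseteq [1,x/h]$, $$ \Biggl| \sum_{\substack{n \in I, \\ p|n \Rightarrow p > P}} a_{nh} - \frac{\sum_{n \leq x} a_n}{x} \sum_{\substack{n \in I, \\ p|n \Rightarrow p > P}} 1 \Biggr| \leq \frac{|I|}{K_{\text{int}}^{(1)}} \frac{\sum_{n \leq x} |a_n|}{x} + \frac{\sum_{n \leq x} |a_n|}{K_{\text{int}}^{(2)}}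 ,$$ where $|I|$ is the length of $I$ and $p$ denotes primes; (Resembles the Integers II) for any $h \in \mathbb{N}$ and any interval $I \subseteq [1,x/h]$, $$ \sum_{n \in I} |a_{nh}| \tau(n) \leq K_{\text{int}}^{(3)} |I| \frac{\sum_{n \leq x} |a_n|}{x} + \frac{\sum_{n \leq x} |a_n|}{K_{\text{int}}^{(2)}} .$$ Then $V(\mathcal{A},x,Q)$ equals $$ \frac{Q}{2} \sum_{n \leq x} |a_n|^2 - \frac{Q}{2} \frac{|\sum_{n \leq x} a_n |^2}{x} + \Bigl|\sum_{n \leq x} a_n \Bigr|^2 \int_{x/Q}^{2x/Q} \{v\} (1 - \{v\}) \frac{dv}{v^3} + O\left(\sum_{n \leq x} |a_n|^2 \tau(n) \right) $$ $$ + O\left( \Bigl(\sum_{n \leq x} |a_n|\Bigr)^2 \left( \frac{1}{K_{\text{prog}}} + \frac{\log x}{P(\log P) K_{\text{conc}}[1]} + \frac{\log P}{K_{\text{int}}^{(1)}} \sqrt{\frac{Q}{x K_{\text{conc}}[2x/Q]}} \right) \right) $$ $$ + O\left( \Bigl(\sum_{n \leq x} |a_n|\Bigr) \log^{6}\!\Bigl(\frac{Px}{Q}\Bigr) \left( \frac{Q}{x K_{\text{int}}^{(1)}} \sum_{n \leq x} |a_n| \tau_{3}^{Px/Q}(n) + (\log^{3}x) \Bigl(\frac{RP}{K_{\text{int}}^{(2)}} + \frac{Q K_{\text{int}}^{(3)}}{x R^{1/\log P}}\Bigr)\sum_{n \leq x} |a_{n}| \tau_{3}(n) \right) \right),$$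 where the implied constants are absolute.
   Context: For a complex sequence $\mathcal{A}=(a_n)_{n\le x}$ (with $a_m$ interpreted as $0$ for $m > x$), $z \le x$, $q \in \mathbb{N}$ and $a \in \mathbb{Z}$, define $\mathcal{A}(z;q,a) := \sum_{n \leq z,\, n \equiv a \bmod q} a_n$, and for $h \mid q$ define $\mathrm{Aver}(\mathcal{A},z;q,h) := \frac{1}{\phi(q/h)} \sum_{1 \leq a \leq q,\, (a,q)=h} \mathcal{A}(z;q,a)$, where $\phi$ is Euler's totient function. Define $$V(\mathcal{A},x,Q) := \sum_{Q/2 < q \leq Q} \sum_{1 \leq a \leq q} \left|\mathcal{A}(x;q,a) - \mathrm{Aver}(\mathcal{A},x;q,(a,q)) \right|^{2}.$$ Here $\tau(n)$ is the number of divisors of $n$, $\tau_3(n) := \#\{(u,v,w)\in\mathbb{N}^3 : uvw = n\}$, $\{v\}$ denotes the fractional part of $v$, and $\tau_3^{Px/Q}$ is the multiplicative function that agrees with $\tau_3$ on powers of primes $p \leq Px/Q$ and equals $1$ on powers of primes $p > Px/Q$. *)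

(* Defs.v *)
From mathcomp Require Export all_boot all_order all_algebra.
From mathcomp Require Export all_classical all_reals all_analysis.
From mathcomp Require Export complex.

Set Implicit Arguments.
Unset Strict Implicit.
Unset Printing Implicit Defensive.

Import Order.TTheory GRing.Theory Num.Theory.
Import ComplexField.

Local Open Scope ring_scope.
Local Open Scope classical_set_scope.

(* The modulus of a complex number as an element of R; the norm `|z| of the
   library lives in R[i] itself. *)
Notation cabs := ComplexField.Normc.normc.

(* A sequence (a_n)_{n <= x} is a function [a : nat -> R[i]] whose value at 0 is
   never used; sums over n <= z start at n = 1. *)

Definition asum (R : realType) (a : nat -> R[i]) (z : R) : R[i] :=
  \sum_(1 <= n < (Num.truncn z).+1) a n.

Definition absum (R : realType) (a : nat -> R[i]) (z : R) : R :=
  \sum_(1 <= n < (Num.truncn z).+1) cabs (a n).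

Definition progsum (R : realType) (a : nat -> R[i]) (z : R) (q b : nat) :
    R[i] :=
  \sum_(1 <= n < (Num.truncn z).+1 | n == b %[mod q]) a n.

Definition aver (R : realType) (a : nat -> R[i]) (z : R) (q h : nat) : R[i] :=
  (totient (q %/ h))%:R^-1 *
    \sum_(1 <= b < q.+1 | gcdn b q == h) progsum a z q b.

Definition progdev (R : realType) (a : nat -> R[i]) (z : R) (q b : nat) : R :=
  cabs (progsum a z q b - aver a z q (gcdn b q)).

Definition Vvar (R : realType) (a : nat -> R[i]) (x Q : R) : R :=
  \sum_(1 <= q < (Num.truncn Q).+1 | Q / 2 < q%:R)
    \sum_(1 <= b < q.+1) progdev a x q b ^+ 2.

Definition tau (n : nat) : nat := size (divisors n).

(* For n >= 1 any (u, v, w) with u v w = n has entries in {1, ..., n}. *)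
Definition tau3 (n : nat) : nat :=
  #|[pred t : 'I_n.+1 * 'I_n.+1 * 'I_n.+1 | (t.1.1 * t.1.2 * t.2)%N == n]|.

Definition tau3_trunc (R : realType) (y : R) (n : nat) : nat :=
  (\prod_(p <- primes n) if (p%:R <= y)%R then tau3 (p ^ logn p n) else 1)%N.

Definition rough (R : realType) (P : R) (n : nat) : bool :=
  all (fun p : nat => P < p%:R) (primes n).

Definition fracpart (R : realType) (v : R) : R := v - (Num.floor v)%:~R.

Definition itv_length (R : realType) (I : interval R) : R :=
  fine (lebesgue_measure [set` I]).

(* The maximum over real z <= x is written as a supremum; it is attained, since
   [progdev a z r b] depends on z only through its integer part. *)
Definition progressions_condition (R : realType) (a : nat -> R[i]) (x Q : R)
    (Kprog : R) : Prop :=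
  \sum_(1 <= r < (Num.truncn (2 * x / Q)).+1) \sum_(1 <= b < r.+1)
    (\sum_(1 <= n < (Num.truncn x).+1 | n == b %[mod r]) cabs (a n)) *
    sup [set progdev a z r b | z in [set z : R | z <= x]]
  <= absum a x ^+ 2 / Kprog.

Definition nonconcentration (R : realType) (a : nat -> R[i]) (x Q : R)
    (Kconc : R -> R) : Prop :=
  forall H : R, H <= Q ->
    0 < Kconc H /\
    \sum_(1 <= h < (Num.truncn Q).+1 | H <= h%:R)
      (\sum_(1 <= n < (Num.truncn x).+1 | (h %| n)%N) cabs (a n)) ^+ 2
    <= absum a x ^+ 2 / Kconc H.

Definition resembles_integers_I (R : realType) (a : nat -> R[i]) (x P : R)
    (K1 K2 : R) : Prop :=
  forall (h : nat) (I : interval R), (0 < h)%N ->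
    [set` I] `<=` [set` `[1, x / h%:R]%R] ->
    cabs (\sum_(1 <= n < (Num.truncn (x / h%:R)).+1
                  | (n%:R \in I) && rough P n) a (n * h)%N
          - asum a x / (real_complex R x) *
            \sum_(1 <= n < (Num.truncn (x / h%:R)).+1
                  | (n%:R \in I) && rough P n) 1)
    <= itv_length I / K1 * (absum a x / x) + absum a x / K2.

Definition resembles_integers_II (R : realType) (a : nat -> R[i]) (x : R)
    (K2 K3 : R) : Prop :=
  forall (h : nat) (I : interval R), (0 < h)%N ->
    [set` I] `<=` [set` `[1, x / h%:R]%R] ->
    \sum_(1 <= n < (Num.truncn (x / h%:R)).+1 | n%:R \in I)
      cabs (a (n * h)%N) * (tau n)%:R
    <= K3 * itv_length I * (absum a x / x) + absum a x / K2.

(* Main.v *)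
(** Real and imaginary parts are treated separately, for a real sequence b with
    |b n| <= s n = |a n|. Subtracting averages is an orthogonal projection on
    functions modulo q, so the variance is a quadratic form in b. Its diagonal
    gives Q/2 * sum b^2; off the diagonal, m = n mod q with |m - n| = q r is
    rewritten as a congruence modulo the complementary divisor r <= 2x/Q, and the
    Progressions Condition replaces this congruence by its average. Dropping the
    coprimality conditions at primes p > P costs the K_conc[1] term and leaves a
    bilinear form B(b, b), a sum over h of kernels in (m, n) that depend only on
    the P-smooth parts of m, n and on the dyadic size of |m - n|.

    Writing B(b, b) - B(g, g) = B(b + g, b - g), where g is the mean value of b on
    integers whose P-smooth part is at most R', the two "resembles the integers"
    hypotheses bound each inner sum over windows of length about Q; Rankin's trick
    controls smooth parts beyond R'. So B(b, b) is close to the square of the mean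
    times B(1, 1), and B(1, 1) is read off from the same formula applied to the
    constant sequence 1, whose variance is sum_q q {x/q} (1 - {x/q}) up to small
    errors; that is a Riemann sum for x^2 times the integral of {v} (1 - {v}) / v^3. *)
Require Import Defs.
From mathcomp Require Import ring lra zify.
Set Implicit Arguments.
Unset Strict Implicit.
Unset Printing Implicit Defensive.
Import Order.TTheory GRing.Theory Num.Theory.
Import numFieldNormedType.Exports.
Local Open Scope ring_scope.

(** The kernel [kap] is a difference of two dyadic sums [dphi], at the scales 2|m - n|/Q and (M +
    1)/h. Both tend to the same limit [dphi_main], which depends on the avoided primes but not on
    the scale; only errors survive, so [kap] decays like 1/j where 2|m - n|/Q has ceiling j, and
    summing over j costs one logarithm.

    For fixed h, m and j the kernel is a function of the P-smooth part u of n, so each u leads to a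
    sum over P-rough cofactors, which the first resemblance hypothesis controls. Every u pays the
    K_int^(2) error once, so u must be bounded; this forces the cutoff R' in g, called [X] below.

    For h > 2x/Q the kernel no longer sees |m - n|: it is bounded by 8, and Cauchy-Schwarz over h
    yields the K_conc[2x/Q] term.

    The sixth power of log(Px/Q) is a product of three squares: two factors [Lb] from the kernel
    bound and the sum over j, two factors [F] from sums over smooth numbers, and two from summing
    the other variable over m and h. *)

(** * Reindexing finite sums by multiples and divisor pairs *)

Lemma sum_indic (V : pzRingType) (r : seq nat) (c : pred nat) (F : nat -> V) :
  \sum_(i <- r | c i) F i = \sum_(i <- r) (c i)%:R * F i.
Proof.
by rewrite big_mkcond /=; apply: eq_bigr => i _; case: (c i); rewrite (mul1r, mul0r).
Qed.

Lemma sum_pick (V : pzRingType) (N k : nat) (F : nat -> V) :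
  \sum_(1 <= i < N.+1) (i == k)%:R * F i = (1 <= k <= N)%N%:R * F k.
Proof.
rewrite -sum_indic; case: (boolP (1 <= k <= N)%N) => hk.
  rewrite mul1r (big_rem k) ?mem_index_iota //= eqxx big1_seq ?addr0 // => i.
  move=> /andP[/eqP-> ]; rewrite mem_rem_uniq ?iota_uniq // inE eqxx //.
rewrite mul0r big1_seq // => i /andP[/eqP->]; rewrite mem_index_iota => h.
by move: hk; rewrite -ltnS h.
Qed.

Lemma sum_multiples (V : pzRingType) (N d : nat) (F : nat -> V) : (0 < d)%N ->
  \sum_(1 <= n < N.+1) (d %| n)%N%:R * F n =
  \sum_(1 <= i < N.+1) (d * i <= N)%N%:R * F (d * i)%N.
Proof.
move=> d0.
transitivity (\sum_(1 <= n < N.+1) \sum_(1 <= i < N.+1)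
    (i == (n %/ d)%N)%:R * ((d %| n)%N%:R * F n)).
  apply: eq_big_nat => n /andP[n1 nN]; rewrite sum_pick.
  case: (boolP (d %| n)%N) => dn; rewrite ?mul1r ?mul0r ?mulr0 //.
  rewrite divn_gt0 // (dvdn_leq _ dn) // (leq_trans (leq_div _ _)) ?mul1r //.
rewrite exchange_big_nat /=; apply: eq_big_nat => i /andP[i1 iN].
transitivity (\sum_(1 <= n < N.+1) (n == (d * i)%N)%:R * F n).
  apply: eq_big_nat => n /andP[n1 nN]; rewrite mulrA -natrM mulnb; congr (_%:R * _).
  congr nat_of_bool; apply/idP/idP => [/andP[/eqP-> dn]|/eqP->].
    by rewrite mulnC divnK.
  by rewrite mulKn // eqxx dvdn_mulr.
by rewrite sum_pick muln_gt0 d0 i1.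
Qed.

Lemma sum_divisor_pairs (V : pzRingType) (N : nat) (G : nat -> nat -> V) :
  \sum_(1 <= q < N.+1) \sum_(1 <= h < N.+1) (h %| q)%N%:R * G h (q %/ h)%N =
  \sum_(1 <= h < N.+1) \sum_(1 <= k < N.+1) (h * k <= N)%N%:R * G h k.
Proof.
rewrite exchange_big_nat; apply: eq_big_nat => h /andP[h0 _].
rewrite (sum_multiples N (fun n => G h (n %/ h)%N)) //.
by apply: eq_bigr => k _; rewrite mulKn.
Qed.

(** * Harmonic and inverse-square sums *)

Section RealSums.
Variable R : realType.
Implicit Types (x y e : R).

Lemma indicM (a b : bool) : (a && b)%:R = a%:R * b%:R :> R.
Proof. by rewrite -mulnb natrM. Qed.

Lemma indic_ge0 (a : bool) : 0 <= a%:R :> R. Proof. exact: ler0n. Qed.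

Lemma indic_le1 (a : bool) : a%:R <= 1 :> R. Proof. by case: a => //=; rewrite ler01. Qed.

Lemma sumr_nat_ge0 (m n : nat) (F : nat -> R) :
  (forall i, (m <= i < n)%N -> 0 <= F i) -> 0 <= \sum_(m <= i < n) F i.
Proof. by move=> h; rewrite big_nat_cond sumr_ge0 // => i; rewrite andbT; apply: h. Qed.

Lemma norm_sum_le_nat (m n : nat) (F G : nat -> R) :
  (forall i, (m <= i < n)%N -> `|F i| <= G i) ->
  `|\sum_(m <= i < n) F i| <= \sum_(m <= i < n) G i.
Proof. by move=> h; apply: le_trans (ler_norm_sum _ _ _) _; apply: ler_sum_nat. Qed.

(** For e >= 0 a natural number is below e exactly when it is below [nceil e], so dyadic conditions
    with a real endpoint become conditions between integers. *)
Definition nceil (e : R) : nat := `|Num.ceil e|%N.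

Lemma nceilP (e : R) (k : nat) : 0 <= e -> (k < nceil e)%N = (k%:R < e).
Proof.
move=> e0; rewrite /nceil.
have c0 : (0 <= Num.ceil e) by rewrite ceil_ge0; lra.
have := ceil_gt_int e k%:Z; rewrite -pmulrn => <-.
by rewrite -ltz_nat gez0_abs.
Qed.

Lemma nceil_le (e : R) (k : nat) : 0 <= e -> (nceil e <= k)%N = (e <= k%:R).
Proof. by move=> e0; rewrite leqNgt nceilP // -leNgt. Qed.

Lemma lnS_sub_ge (i : nat) : (0 < i)%N -> (i.+1%:R : R)^-1 <= ln i.+1%:R - ln i%:R.
Proof.
move=> i0; have i0' : 0 < (i%:R : R) by rewrite ltr0n.
have i1' : 0 < (i.+1%:R : R) by rewrite ltr0n.
rewrite -opprB lerNr -ln_div ?posrE //.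
have -> : i%:R / i.+1%:R = 1 + - i.+1%:R^-1 :> R.
  by rewrite -natr1 in i1' *; field; lra.
by apply: le_ln1Dx; rewrite ltrN2 invf_lt1 // ltr1n ltnS.
Qed.

Lemma lnS_sub_le (i : nat) : (0 < i)%N -> ln i.+1%:R - ln i%:R <= (i%:R : R)^-1.
Proof.
move=> i0; have i0' : 0 < (i%:R : R) by rewrite ltr0n.
rewrite -ln_div ?posrE ?ltr0n //.
have -> : i.+1%:R / i%:R = 1 + i%:R^-1 :> R.
  by rewrite -natr1; field; lra.
by apply: le_ln1Dx; apply: lt_le_trans (_ : 0 <= _); rewrite ?ltrN10 // invr_ge0 ltW.
Qed.

Lemma harmonic_le (n : nat) : \sum_(1 <= i < n.+1) (i%:R : R)^-1 <= 1 + ln n%:R.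
Proof.
case: n => [|n]; first by rewrite big_geq // ln0 //; lra.
elim: n => [|n IH]; first by rewrite big_nat1 ln1 invr1; lra.
rewrite big_nat_recr //=; apply: le_trans (lerD IH (lexx _)) _.
by have := @lnS_sub_ge n.+1 isT; rewrite -addrA lerD2l -lerBrDl; apply: le_trans; rewrite lexx.
Qed.

(* Each term 1/i^2 with i >= y is at most g i - g (i+1) for
   g i = min (2/y) (1/(i-1/2)). *)
Lemma sum_invsq_tail (n : nat) (y : R) : 0 < y ->
  \sum_(1 <= i < n.+1) (y <= i%:R)%R%:R / (i%:R ^+ 2 : R) <= 2 / y.
Proof.
move=> y0; pose g (i : nat) : R := Num.min (2 / y) (i%:R - 1/2)^-1.
have g0 i : (0 < i)%N -> 0 <= g i.
  move=> i0; rewrite /g le_min divr_ge0 ?invr_ge0 //=; try lra.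
  have : 1 <= (i%:R : R) by rewrite ler1n.
  by lra.
have step i : (1 <= i < n.+1)%N ->
   (y <= i%:R)%R%:R / (i%:R ^+ 2 : R) <= - (g i.+1 - g i).
  move=> /andP[i1 _]; have i1' : 1 <= (i%:R : R) by rewrite ler1n.
  have e1 : (i.+1%:R : R) = i%:R + 1 by rewrite -natr1.
  rewrite opprB; case: (leP y i%:R) => yi /=; last first.
    rewrite mul0r subr_ge0 /g le_min !ge_min lexx /=; apply/orP; right.
    by rewrite e1 lef_pV2 ?posrE; lra.
  have -> : g i = (i%:R - 1/2)^-1.
    rewrite /g; apply/min_idPr; rewrite ler_pdivlMr // mulrC ler_pdivrMr; nra.
  apply: (@le_trans _ _ ((i%:R - 1/2)^-1 - (i.+1%:R - 1/2)^-1)); last first.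
    by rewrite lerD2l lerN2 /g ge_min lexx orbT.
  have -> : (i%:R - 1/2)^-1 - (i.+1%:R - 1/2)^-1 = (i%:R ^+ 2 - 1/4 : R)^-1.
    rewrite e1; field.
    by do ![apply/andP; split]; rewrite gt_eqF //; nra.
  by rewrite [X in X <= _]mul1r lef_pV2 ?posrE; nra.
apply: le_trans (ler_sum_nat step) _.
rewrite sumrN telescope_sumr // opprB.
have : g 1 <= 2 / y by rewrite /g ge_min lexx.
by have := g0 n.+1 isT; lra.
Qed.

Lemma sum_invsq_le (n : nat) : \sum_(1 <= i < n.+1) (i%:R ^+ 2 : R)^-1 <= 2.
Proof.
have := @sum_invsq_tail n 1 ltr01; rewrite divr1; apply: le_trans.
by apply: ler_sum_nat => i /andP[i1 _]; rewrite ler1n i1 div1r.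
Qed.

Lemma ln2_le1 : ln (2 : R) <= 1.
Proof. have := @le_ln1Dx R 1 ltac:(lra); by have -> : (1 + 1 : R) = 2 by lra. Qed.

Lemma ln2_ge0 : 0 <= ln (2 : R).
Proof. by rewrite ln_ge0 //; lra. Qed.

(* Both Q/2 < q <= Q and the range of the complementary divisor of q in |m - n|
   have this shape. *)
Definition dyad (e : R) (i : nat) : bool := (i%:R < e) && (e <= 2 * i%:R).

(** With c the ceiling of e and a = [uphalf c] the range is a <= i < c. Comparing 1/i with the
    increments of ln on both sides gives ln (c/a) up to 1/a - 1/c, and c <= 2a <= c + 1 puts ln
    (c/a) within 1/c of ln 2. The bound e <= N + 1 only ensures that the whole range is summed. *)
Lemma harmonic_dyad (N : nat) (e : R) : 0 < e -> e <= N.+1%:R ->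
  `|\sum_(1 <= i < N.+1) (dyad e i)%:R / i%:R - ln 2| <= e^-1.
Proof.
move=> e0 eN; set c := nceil e.
have cP k : (k < c)%N = (k%:R < e) by rewrite nceilP // ltW.
have c'P k : (c <= k)%N = (e <= k%:R) by rewrite nceil_le // ltW.
have c0 : (0 < c)%N by rewrite cP.
have cN : (c <= N.+1)%N by rewrite c'P.
have dE i : dyad e i = (c <= i.*2)%N && (i < c)%N.
  by rewrite /dyad cP c'P -mul2n natrM andbC.
have ec : e <= c%:R by rewrite -c'P.
case: (ltnP 1 c) => c1; last first.
  have cE : c = 1%N by apply/eqP; rewrite eqn_leq c1.
  rewrite big_nat big1 => [|i /andP[i1 _]]; last first.
    by rewrite dE cE [(i < 1)%N]ltnNge i1 andbF mul0r.
  rewrite sub0r normrN ger0_norm ?ln2_ge0 //; apply: le_trans ln2_le1 _.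
  by rewrite invf_ge1 //; apply: le_trans ec _; rewrite cE.
set a := uphalf c.
have a0 : (0 < a)%N by rewrite /a; lia.
have ac : (a <= c)%N by rewrite /a; lia.
have a2 : (c <= a.*2)%N by rewrite /a; lia.
have a3 : (a.*2 <= c.+1)%N by rewrite /a; lia.
have -> : \sum_(1 <= i < N.+1) (dyad e i)%:R / i%:R = \sum_(a <= i < c) (i%:R : R)^-1.
  rewrite (@big_cat_nat _ _ _ a 1) //=; last by lia.
  rewrite (@big_cat_nat _ _ _ c a) //=.
  rewrite big_nat big1 ?add0r => [|i hi]; last first.
    by rewrite dE (_ : (c <= i.*2)%N = false) ?mul0r // ; rewrite /a in hi; lia.
  rewrite [X in _ + X]big_nat [X in _ + X]big1 ?addr0 => [|i hi]; last first.
    by rewrite dE (_ : (i < c)%N = false) ?andbF ?mul0r //; lia.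
  apply: eq_big_nat => i hi; rewrite dE (_ : (_ && _) = true) ?div1r //.
  by rewrite /a in hi; lia.
have a0' : 0 < (a%:R : R) by rewrite ltr0n.
have c0' : 0 < (c%:R : R) by rewrite ltr0n.
have low : ln c%:R - ln a%:R <= \sum_(a <= i < c) (i%:R : R)^-1.
  rewrite -(telescope_sumr (fun i => ln (i%:R : R)) ac).
  by apply: ler_sum_nat => i /andP[ai _]; apply: lnS_sub_le; lia.
have upp : \sum_(a <= i < c) (i%:R : R)^-1 <= (ln c%:R - c%:R^-1) - (ln a%:R - a%:R^-1).
  rewrite -(telescope_sumr (fun i => ln (i%:R : R) - i%:R^-1) ac).
  apply: ler_sum_nat => i /andP[ai _]; move: (@lnS_sub_ge i (leq_trans a0 ai)).
  by set u := i.+1%:R^-1; set v := ln i.+1%:R; lra.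
have a2' : (c%:R : R) <= 2 * a%:R by rewrite -natrM ler_nat mul2n.
have a3' : (2 * a%:R : R) <= c%:R + 1 by rewrite -natrM natr1 ler_nat mul2n.
have l2 : ln c%:R - ln a%:R <= ln (2 : R).
  by rewrite -ln_div ?posrE // ler_ln ?posrE ?divr_gt0 //; rewrite ler_pdivrMr.
have l3 : ln (2 : R) - c%:R^-1 <= ln c%:R - ln a%:R.
  have : ln (1 + c%:R^-1) <= (c%:R^-1 : R).
    by apply: le_ln1Dx; have := invr_gt0 (c%:R : R); lra.
  suff : ln (2 : R) <= ln (c%:R / a%:R) + ln (1 + c%:R^-1).
    by rewrite ln_div ?posrE //; lra.
  have ci : 0 < (c%:R^-1 : R) by rewrite invr_gt0.
  rewrite -lnM ?posrE ?divr_gt0 //; try lra.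
  rewrite ler_ln ?posrE ?mulr_gt0 ?invr_gt0 //; try lra.
  have -> : c%:R / a%:R * (1 + c%:R^-1) = (c%:R + 1) / a%:R :> R by field; lra.
  by rewrite ler_pdivlMr.
have ia : (a%:R^-1 : R) <= 2 * c%:R^-1.
  by rewrite -ler_pdivrMl // -invfM lef_pV2 ?posrE ?mulr_gt0.
have ie : (c%:R^-1 : R) <= e^-1 by rewrite lef_pV2 ?posrE.
by rewrite ler_norml; apply/andP; split; lra.
Qed.

Lemma harmonic_dyad_le2 (N : nat) (e : R) : 0 < e -> e <= N.+1%:R ->
  \sum_(1 <= i < N.+1) (dyad e i)%:R / i%:R <= 2 :> R.
Proof.
move=> e0 eN; case: (leP e 1) => e1.
  rewrite big_nat big1 => [|i /andP[i1 _]]; first by lra.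
  rewrite /dyad (_ : (_ < e) = false) ?mul0r //.
  by apply/negbTE; rewrite -leNgt; apply: le_trans e1 _; rewrite ler1n.
have := harmonic_dyad e0 eN; rewrite ler_norml => /andP[_ h].
have : e^-1 <= 1 by rewrite invf_le1 // ltW.
by have := ln2_le1; lra.
Qed.
End RealSums.

(** * Dyadic sums of 1/k and 1/phi(k) over k free of given primes *)

Definition avoids (ps : seq nat) (i : nat) : bool := all (fun p => ~~ (p %| i)%N) ps.

Lemma avoids_mulp (ps : seq nat) (p i : nat) : prime p -> all prime ps ->
  p \notin ps -> avoids ps (p * i) = avoids ps i.
Proof.
move=> pp; elim: ps => //= q ps IH /andP[qp qps]; rewrite inE negb_or => /andP[pq pps].
rewrite IH // Euclid_dvdM // dvdn_prime2 // [q == p]eq_sym (negbTE pq) //.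
Qed.

Lemma avoidsM (ps : seq nat) (d i : nat) : all prime ps ->
  avoids ps (d * i) = avoids ps d && avoids ps i.
Proof.
elim: ps => //= q ps IH /andP[qp qps].
by rewrite IH // Euclid_dvdM // negb_or; case: (_ %| _)%N; case: (_ %| _)%N; rewrite ?andbF.
Qed.

Lemma totient_mulp (p j : nat) : prime p -> (0 < j)%N ->
  totient (p * j) = if (p %| j)%N then (p * totient j)%N else (p.-1 * totient j)%N.
Proof.
move=> pp j0; case: ifP => [pj|/negbT pj]; last first.
  by rewrite totient_coprime ?prime_coprime // totient_prime.
have [m pm jE] := pfactor_coprime pp j0; set e := logn p j in jE.
have e0 : (0 < e)%N by rewrite /e logn_gt0 mem_primes pp j0.
have cop k : coprime m (p ^ k) by rewrite coprime_sym coprimeXl.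
rewrite jE mulnCA -expnS !totient_coprime // !totient_pfactor //=.
by rewrite -[in LHS](prednK e0) expnS; ring.
Qed.

Definition sqfree (d : nat) : bool := all (fun p => ~~ (p ^ 2 %| d)%N) (primes d).

Lemma sqfreeP (d : nat) : (0 < d)%N ->
  reflect (forall p, prime p -> ~~ (p ^ 2 %| d)%N) (sqfree d).
Proof.
move=> d0; apply: (iffP allP) => h p; last by rewrite mem_primes => /andP[pp _]; apply: h.
move=> pp; case: (boolP (p %| d)%N) => pd; first by apply: h; rewrite mem_primes pp d0.
by apply: contra pd; apply: dvdn_trans; rewrite dvdn_mulr.
Qed.

Lemma sqfree_mulp (p d : nat) : prime p -> (0 < d)%N -> ~~ (p %| d)%N ->
  sqfree (p * d) = sqfree d.
Proof.
move=> pp d0 pd; have p0 := prime_gt0 pp.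
have pd0 : (0 < p * d)%N by rewrite muln_gt0 p0.
apply/(sqfreeP pd0)/(sqfreeP d0) => h q qp.
  by apply: contra (h q qp) => /dvdn_mull; apply.
apply/negP; have [->|qnp] := eqVneq q p.
  by rewrite expnS expn1 dvdn_pmul2l // (negbTE pd).
rewrite Gauss_dvdr ?(negbTE (h _ qp)) //.
by rewrite coprimeXl // prime_coprime // dvdn_prime2.
Qed.

Section Dyadic.
Variable R : realType.

Definition invphi (k : nat) : R := (totient k)%:R^-1.

Lemma invphi_ge0 k : 0 <= invphi k. Proof. by rewrite invr_ge0. Qed.

Lemma invphi_le1 k : invphi k <= 1.
Proof.
rewrite /invphi; case: (posnP (totient k)) => [->|h]; first by rewrite invr0.
by rewrite invf_le1 ?ltr0n // ler1n.
Qed.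

(** The weight mu(d)^2 / phi(d), whose sum over the divisors of k is k / phi(k). *)
Definition sqw (d : nat) : R := (sqfree d)%:R * invphi d.

Lemma sqw_ge0 d : 0 <= sqw d. Proof. by rewrite mulr_ge0 ?invphi_ge0. Qed.

Lemma sqw_le d : sqw d <= invphi d.
Proof. by rewrite ler_piMl ?invphi_ge0 // indic_le1. Qed.

Lemma sqw_le1 d : sqw d <= 1. Proof. exact: le_trans (sqw_le d) (invphi_le1 d). Qed.

(** Induction through the least prime p of k = p j. If p divides j, then j has the same squarefree
    divisors and the same ratio j / phi(j). Otherwise each divisor d of j is joined by p d, which
    multiplies both sides by 1 + 1/(p - 1). *)
Lemma sum_sqw_divisors (N k : nat) : (0 < k <= N)%N ->
  \sum_(1 <= d < N.+1) (d %| k)%N%:R * sqw d = k%:R * invphi k.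
Proof.
elim/ltn_ind: k => k IH /andP[k0 kN].
case: (ltnP 1 k) => k1; last first.
  have -> : k = 1%N by apply/eqP; rewrite eqn_leq k1.
  under eq_bigr do rewrite dvdn1.
  rewrite sum_pick (_ : (_ && _) = true); last by rewrite (leq_trans k0 kN).
  by rewrite /sqw /sqfree /= /invphi /totient /= !mul1r.
have pp := pdiv_prime k1; set p := pdiv k in pp.
have p0 := prime_gt0 pp; have p1 := prime_gt1 pp.
have kE : k = (p * (k %/ p))%N by rewrite mulnC divnK // pdiv_dvd.
set j := (k %/ p)%N in kE.
have j0 : (0 < j)%N by move: k0; rewrite kE muln_gt0 => /andP[].
have jk : (j < k)%N by rewrite kE ltn_Pmull.
have jN : (0 < j <= N)%N by rewrite j0 (leq_trans _ kN) // ltnW.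
have {}IH := IH _ jk jN.
have phi0 : (0 < totient j)%N by rewrite totient_gt0.
case: (boolP (p %| j)%N) => pj.
  transitivity (\sum_(1 <= d < N.+1) (d %| j)%N%:R * sqw d).
    apply: eq_big_nat => d /andP[d0 _]; rewrite /sqw.
    case: (boolP (sqfree d)) => /= [/(sqfreeP d0) sd|_]; last by rewrite !mul0r !mulr0.
    congr (_%:R * _); congr nat_of_bool; apply/idP/idP => [dk|dj]; last first.
      by rewrite kE dvdn_mull.
    case: (boolP (p %| d)%N) => pd; last first.
      by rewrite kE Gauss_dvdr // in dk; rewrite coprime_sym prime_coprime.
    have dE : d = (p * (d %/ p))%N by rewrite mulnC divnK.
    have pd' : ~~ (p %| d %/ p)%N.
      apply: contra (sd _ pp) => h; rewrite dE expnS expn1 dvdn_pmul2l //.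
    have : (d %/ p %| j)%N by rewrite kE {1}dE dvdn_pmul2l // in dk.
    move=> h; rewrite dE Gauss_dvd ?pj // prime_coprime //.
  rewrite IH kE /invphi totient_mulp // pj !natrM; field.
  by rewrite !pnatr_eq0 -!lt0n phi0.
transitivity (\sum_(1 <= d < N.+1) (d %| j)%N%:R * sqw d +
   \sum_(1 <= d < N.+1) (p %| d)%N%:R * ((d %| k)%N%:R * sqw d)).
  rewrite -big_split /=; apply: eq_big_nat => d /andP[d0 _].
  rewrite mulrA -mulrDl; congr (_ * _); rewrite -natrM -natrD; congr (_%:R).
  case: (boolP (p %| d)%N) => pd.
    rewrite (_ : (d %| j)%N = false) ?add0n ?mul1n //.
    by apply/negbTE; apply: contra pj; apply: dvdn_trans.
  rewrite mul0n addn0 kE Gauss_dvdr // coprime_sym prime_coprime //.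
rewrite sum_multiples //.
have -> : \sum_(1 <= i < N.+1) (p * i <= N)%N%:R * ((p * i %| k)%N%:R * sqw (p * i)) =
   (p.-1%:R)^-1 * (j%:R * invphi j).
  rewrite -IH mulr_sumr; apply: eq_big_nat => i /andP[i0 _].
  rewrite {1}kE dvdn_pmul2l //; case: (boolP (i %| j)%N) => ij; last by rewrite !mul0r !mulr0.
  have pi : ~~ (p %| i)%N by apply: contra pj => h; apply: dvdn_trans h ij.
  rewrite (_ : (p * i <= N)%N = true); last first.
    by apply: leq_trans kN; rewrite [leqRHS]kE leq_pmul2l // dvdn_leq.
  rewrite !mul1r /sqw sqfree_mulp // /invphi totient_mulp // (negbTE pi) natrM invfM.
  by rewrite mulrCA.
rewrite IH kE /invphi totient_mulp // (negbTE pj) !natrM.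
have -> : (p%:R : R) = p.-1%:R + 1 by rewrite natr1 prednK.
field; rewrite !pnatr_eq0 -!lt0n phi0 /=; lia.
Qed.

(** Trades 1/phi(k) for 1/k: a sum weighted by 1/phi becomes an average over squarefree d, with
    convergent weights, of sums over the multiples of d in which only powers of the index remain. *)
Lemma sum_sqfree_pairs (N : nat) (G : nat -> R) :
  \sum_(1 <= k < N.+1) G k * (k%:R * invphi k) =
  \sum_(1 <= d < N.+1) sqw d * \sum_(1 <= i < N.+1) (d * i <= N)%N%:R * G (d * i)%N.
Proof.
transitivity (\sum_(1 <= k < N.+1) \sum_(1 <= d < N.+1) (d %| k)%N%:R * (sqw d * G k)).
  apply: eq_big_nat => k hk; rewrite -(@sum_sqw_divisors N) ; last by lia.
  by rewrite mulr_sumr; apply: eq_bigr => d _; ring.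
rewrite exchange_big_nat; apply: eq_big_nat => d /andP[d0 _].
rewrite (sum_multiples N (fun k => sqw d * G k)) // mulr_sumr.
by apply: eq_bigr => i _; rewrite mulrCA.
Qed.

Lemma sum_invphi_div_le (N : nat) :
  \sum_(1 <= d < N.+1) invphi d / d%:R <= 4.
Proof.
pose G (k : nat) : R := (k%:R ^+ 2)^-1.
have -> : \sum_(1 <= d < N.+1) invphi d / d%:R =
          \sum_(1 <= k < N.+1) G k * (k%:R * invphi k).
  apply: eq_big_nat => k /andP[k0 _]; rewrite /G; field.
  by rewrite pnatr_eq0 -lt0n.
rewrite sum_sqfree_pairs.
apply: (@le_trans _ _ (\sum_(1 <= d < N.+1) (d%:R ^+ 2)^-1 * 2)).
  apply: ler_sum_nat => d /andP[d0 _]; rewrite -[leRHS]mul1r.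
  apply: ler_pM; rewrite ?sqw_ge0 ?sqw_le1 //.
    by apply: sumr_nat_ge0 => i _; rewrite mulr_ge0 // invr_ge0 sqr_ge0.
  apply: (@le_trans _ _ (\sum_(1 <= i < N.+1) (d%:R ^+ 2)^-1 * (i%:R ^+ 2)^-1)).
    apply: ler_sum_nat => i _; rewrite /G natrM exprMn invfM ler_piMl ?indic_le1 //.

  by rewrite -mulr_sumr ler_wpM2l ?invr_ge0 ?sqr_ge0 // sum_invsq_le.
by rewrite -mulr_suml; have := @sum_invsq_le R N; lra.
Qed.

Lemma sum_sqw_div_le (N : nat) : \sum_(1 <= d < N.+1) sqw d / d%:R <= 4.
Proof.
apply: le_trans (sum_invphi_div_le N); apply: ler_sum_nat => d _.
by rewrite ler_wpM2r ?sqw_le.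
Qed.

Lemma sum_invphi_le (N : nat) :
  \sum_(1 <= d < N.+1) invphi d <= 4 * (1 + ln N%:R).
Proof.
case: N => [|N]; first by rewrite big_geq // ln0 //; lra.
have -> : \sum_(1 <= d < N.+2) invphi d =
          \sum_(1 <= k < N.+2) k%:R^-1 * (k%:R * invphi k).
  by apply: eq_big_nat => k /andP[k0 _]; rewrite mulKf // pnatr_eq0 -lt0n.
rewrite sum_sqfree_pairs.
have l0 : 0 <= 1 + ln (N.+1%:R : R) by rewrite addr_ge0 // ln_ge0 // ler1n.
apply: (@le_trans _ _ (\sum_(1 <= d < N.+2) sqw d / d%:R * (1 + ln N.+1%:R))).
  apply: ler_sum_nat => d /andP[d0 _]; rewrite -mulrA ler_wpM2l ?sqw_ge0 //.
  apply: le_trans (_ : \sum_(1 <= i < N.+2) d%:R^-1 * i%:R^-1 <= _).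
    by apply: ler_sum_nat => i _; rewrite natrM invfM ler_piMl ?indic_le1 // mulr_ge0.
  by rewrite -mulr_sumr ler_wpM2l // harmonic_le.
by rewrite -mulr_suml ler_wpM2r // sum_sqw_div_le.
Qed.

Lemma sum_invphi_tail (N : nat) (T : R) : 0 < T ->
  \sum_(1 <= d < N.+1) (T <= d%:R)%R%:R * (invphi d / d%:R) <= 8 / T.
Proof.
move=> T0; pose G (k : nat) : R := (T <= k%:R)%R%:R / k%:R ^+ 2.
have -> : \sum_(1 <= d < N.+1) (T <= d%:R)%R%:R * (invphi d / d%:R) =
          \sum_(1 <= k < N.+1) G k * (k%:R * invphi k).
  apply: eq_big_nat => k /andP[k0 _]; rewrite /G; field.
  by rewrite pnatr_eq0 -lt0n.
rewrite sum_sqfree_pairs.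
apply: (@le_trans _ _ (\sum_(1 <= d < N.+1) sqw d / d%:R * (2 / T))).
  apply: ler_sum_nat => d /andP[d0 _]; rewrite -mulrA ler_wpM2l ?sqw_ge0 //.
  have d0' : 0 < (d%:R : R) by rewrite ltr0n.
  apply: le_trans (_ : (d%:R^+2)^-1 * \sum_(1 <= i < N.+1) (T / d%:R <= i%:R)%R%:R / i%:R ^+ 2 <= _).
    rewrite mulr_sumr; apply: ler_sum_nat => i _; rewrite /G natrM exprMn invfM.
    rewrite ler_pdivrMr // [i%:R * _]mulrC [leRHS]mulrCA.
    by apply: ler_piMl; rewrite ?indic_le1 // !mulr_ge0 // invr_ge0 sqr_ge0.
  have Td : 0 < T / d%:R by rewrite divr_gt0.
  apply: le_trans (ler_wpM2l _ (sum_invsq_tail N Td)) _; first by rewrite invr_ge0 sqr_ge0.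
  by rewrite le_eqVlt; apply/orP; left; apply/eqP; field; lra.
have -> : 8 / T = 4 * (2 / T) by lra.
by rewrite -mulr_suml ler_wpM2r ?sum_sqw_div_le // divr_ge0 // ltW.
Qed.

Definition hdyad (N : nat) (ps : seq nat) (e : R) : R :=
  \sum_(1 <= i < N.+1) (dyad e i && avoids ps i)%:R / i%:R.

Lemma dyad_mul (p i : nat) (e : R) : (0 < p)%N -> dyad e (p * i) = dyad (e / p%:R) i.
Proof.
move=> p0; have p0' : 0 < (p%:R : R) by rewrite ltr0n.
by rewrite /dyad natrM ltr_pdivlMr // ler_pdivrMr // [i%:R * _]mulrC -mulrA [i%:R * _]mulrC.
Qed.

Lemma dyad_le (N i : nat) (e : R) : e <= N.+1%:R -> dyad e i -> (i <= N)%N.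
Proof. by move=> eN /andP[ie _]; rewrite -ltnS -(ltr_nat R); apply: lt_le_trans eN. Qed.

(** Induction on the primes: discarding the multiples of p subtracts 1/p times the same sum at scale
    e/p. The two errors, 2^k / e and (1/p) 2^k / (e/p), are equal, so each prime doubles the
    error. *)
Lemma hdyad_approx (N : nat) (ps : seq nat) (e : R) : uniq ps -> all prime ps ->
  0 < e -> e <= N.+1%:R ->
  `|hdyad N ps e - ln 2 * \prod_(p <- ps) (1 - p%:R^-1)| <= 2 ^+ size ps / e.
Proof.
elim: ps e => [|p ps IH] e.
  move=> _ _ e0 eN; rewrite big_nil mulr1 expr0 div1r /hdyad.
  under eq_bigr do rewrite /avoids /= andbT.
  exact: harmonic_dyad.
move=> /= /andP[pps ups] /andP[pp aps] e0 eN.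
have p0 := prime_gt0 pp; have p0' : 0 < (p%:R : R) by rewrite ltr0n.
have p1' : 1 <= (p%:R : R) by rewrite ler1n.
have -> : hdyad N (p :: ps) e = hdyad N ps e - p%:R^-1 * hdyad N ps (e / p%:R).
  apply/eqP; rewrite eq_sym subr_eq; apply/eqP.
  transitivity (hdyad N (p :: ps) e +
    \sum_(1 <= i < N.+1) (p %| i)%N%:R * ((dyad e i && avoids ps i)%:R / i%:R)).
    rewrite /hdyad -big_split /=; apply: eq_bigr => i _.
    by rewrite /avoids /=; case: (p %| i)%N; case: (dyad e i);
       case: (all _ _); rewrite /= ?mul0r ?mul1r ?addr0 ?add0r.
  congr (_ + _); rewrite sum_multiples // /hdyad mulr_sumr.
  apply: eq_bigr => i _; rewrite dyad_mul // avoids_mulp // natrM invfM.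
  case: (boolP (dyad _ i)) => /= di; last by rewrite !mul0r !mulr0.
  rewrite (_ : (p * i <= N)%N = true); last by apply: (dyad_le eN); rewrite dyad_mul.
  by rewrite mul1r mulrCA.
have ep : e / p%:R <= N.+1%:R by apply: le_trans eN; rewrite ler_pdivrMr // ler_peMr // ltW.
have h1 := IH e ups aps e0 eN.
have h2 := IH (e / p%:R) ups aps (divr_gt0 e0 p0') ep.
rewrite big_cons; set c := ln 2 * _ in h1 h2; set c' := ln 2 * _.
have -> : c' = c - p%:R^-1 * c by rewrite /c' /c; ring.
have -> : forall a b : R, a - p%:R^-1 * b - (c - p%:R^-1 * c) = (a - c) - p%:R^-1 * (b - c).
  by move=> a b; ring.
apply: le_trans (ler_normB _ _) _; rewrite normrM (@ger0_norm _ p%:R^-1) //.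
apply: le_trans (lerD h1 (ler_wpM2l _ h2)) _; first by [].
rewrite exprS le_eqVlt; apply/orP; left; apply/eqP; field; lra.
Qed.

Lemma hdyad_ge0 N ps e : 0 <= hdyad N ps e.
Proof. by apply: sumr_nat_ge0 => i _; rewrite divr_ge0. Qed.

Lemma hdyad_le2 N ps e : 0 < e -> e <= N.+1%:R -> hdyad N ps e <= 2.
Proof.
move=> e0 eN; apply: le_trans (harmonic_dyad_le2 e0 eN).
by apply: ler_sum_nat => i _; rewrite ler_wpM2r // indicM ler_piMr // indic_le1.
Qed.

Definition dphi (N : nat) (ps : seq nat) (e : R) : R :=
  \sum_(1 <= k < N.+1) (dyad e k && avoids ps k)%:R * invphi k.

Lemma dphi_ge0 N ps e : 0 <= dphi N ps e.
Proof. by apply: sumr_nat_ge0 => i _; rewrite mulr_ge0 ?invphi_ge0. Qed.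

Lemma dphi_expand (N : nat) (ps : seq nat) (e : R) : all prime ps -> e <= N.+1%:R ->
  dphi N ps e =
  \sum_(1 <= d < N.+1) (avoids ps d)%:R * (sqw d / d%:R) * hdyad N ps (e / d%:R).
Proof.
move=> aps eN.
have -> : dphi N ps e = \sum_(1 <= k < N.+1)
   ((dyad e k && avoids ps k)%:R / k%:R) * (k%:R * invphi k).
  apply: eq_big_nat => k /andP[k0 _]; rewrite mulrA divfK // pnatr_eq0 -lt0n //.
rewrite sum_sqfree_pairs; apply: eq_big_nat => d /andP[d0 _].
rewrite /hdyad !mulr_sumr; apply: eq_bigr => i _.
rewrite dyad_mul // avoidsM // natrM invfM.
case: (boolP (dyad _ i)) => di /=; last by rewrite !mul0r !mulr0.
rewrite (_ : (d * i <= N)%N = true); last by apply: (dyad_le eN); rewrite dyad_mul.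
by rewrite indicM mul1r; ring.
Qed.

Lemma dphi_le8 (N : nat) (ps : seq nat) (e : R) : all prime ps -> 0 < e -> e <= N.+1%:R ->
  dphi N ps e <= 8.
Proof.
move=> aps e0 eN; rewrite dphi_expand //.
apply: (@le_trans _ _ (\sum_(1 <= d < N.+1) (sqw d / d%:R) * 2)).
  apply: ler_sum_nat => d /andP[d0 _].
  have d1 : 1 <= (d%:R : R) by rewrite ler1n.
  apply: ler_pM; rewrite ?hdyad_ge0 ?mulr_ge0 ?invphi_ge0 //.
    by rewrite ler_piMl ?indic_le1 // ?mulr_ge0 ?invphi_ge0.
  apply: hdyad_le2; first by apply: divr_gt0 => //; lra.
  by apply: le_trans eN; rewrite ler_pdivrMr; nra.
by rewrite -mulr_suml; have := sum_sqw_div_le N; lra.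
Qed.

(* The limiting value of [dphi N ps e] for large [e]. *)
Definition dphi_main (N : nat) (ps : seq nat) : R :=
  \sum_(1 <= d < N.+1) (avoids ps d)%:R * (sqw d / d%:R) *
     (ln 2 * \prod_(p <- ps) (1 - p%:R^-1)).

(** The sum over d is cut at T. Below T the error of [hdyad_approx] at scale e/d costs invphi d / T
    per term, in total 4 (1 + ln T) / T; above T the trivial bound 2 meets the tail 8 / T, whence
    the 20. Since T may be any positive integer up to e, one T can serve two different scales, which
    is how the kernel is bounded later. *)
Lemma dphi_approx (N T : nat) (ps : seq nat) (e : R) : uniq ps -> all prime ps ->
  (0 < T)%N -> T%:R <= e -> e <= N.+1%:R ->
  `|dphi N ps e - dphi_main N ps| <= 2 ^+ size ps * (20 * (1 + ln T%:R) / T%:R).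
Proof.
move=> ups aps T0 Te eN; have T0' : 0 < (T%:R : R) by rewrite ltr0n.
have e0 : 0 < e by lra.
pose c : R := ln 2 * \prod_(p <- ps) (1 - p%:R^-1).
have pr01 : 0 <= \prod_(p <- ps) (1 - p%:R^-1 : R) <= 1.
  rewrite big_seq; elim/big_ind: _ => [|a b /andP[a0 a1] /andP[b0 b1]|p pps].
  - by rewrite ler01 lexx.
  - by rewrite mulr_ge0 // mulr_ile1.
  have p1 : 1 <= (p%:R : R) by rewrite ler1n prime_gt0 // (allP aps).
  have : (p%:R^-1 : R) <= 1 by rewrite invf_le1; lra.
  have : 0 <= (p%:R^-1 : R) by [].
  by lra.
have c01 : 0 <= c <= 2.
  by have := @ln2_ge0 R; have := @ln2_le1 R; rewrite /c; nra.
have T2 : 1 <= (2 : R) ^+ size ps by apply: exprn_ege1; lra.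
have T20 : 0 <= (2 : R) ^+ size ps by lra.
rewrite dphi_expand // /dphi_main -/c -sumrB.
pose G (d : nat) := 2 ^+ size ps / T%:R * ((d <= T)%N%:R * invphi d) +
   2 * ((T%:R <= d%:R :> R)%R%:R * (invphi d / d%:R)).
apply: (@le_trans _ _ (\sum_(1 <= d < N.+1) G d)).
  apply: norm_sum_le_nat => d /andP[d0 _]; rewrite -mulrBr normrM.
  have d1 : 1 <= (d%:R : R) by rewrite ler1n.
  have d0' : 0 < (d%:R : R) by lra.
  have ed : 0 < e / d%:R by rewrite divr_gt0.
  have edN : e / d%:R <= N.+1%:R by apply: le_trans eN; rewrite ler_pdivrMr; nra.
  have phi0 := invphi_ge0 d.
  have w0 : `|(avoids ps d)%:R * (sqw d / d%:R)| <= invphi d / d%:R.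
    rewrite ger0_norm ?mulr_ge0 ?sqw_ge0 //; apply: le_trans (_ : sqw d / d%:R <= _).
      by rewrite ler_piMl ?indic_le1 // mulr_ge0 ?sqw_ge0.
    by rewrite ler_wpM2r ?sqw_le.
  case: (leqP d T) => dT.
    apply: (@le_trans _ _ (2 ^+ size ps / T%:R * (1%:R * invphi d))); last first.
      by rewrite /G dT lerDl !mulr_ge0.
    apply: le_trans (ler_pM _ _ w0 (hdyad_approx ups aps ed edN)) _; rewrite ?normr_ge0 //.
    rewrite mul1r invf_div.
    have -> : invphi d / d%:R * (2 ^+ size ps * (d%:R / e)) = 2 ^+ size ps * invphi d / e.
      by field; rewrite !gt_eqF.
    by rewrite -[leRHS]mulrA [T%:R^-1 * _]mulrC mulrA ler_wpM2l ?mulr_ge0 // lef_pV2 ?posrE.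
  rewrite /G leqNgt dT mul0r mulr0 add0r ler_nat (ltnW dT) mul1r mulrC.
  rewrite ler_pM ?normr_ge0 //.
  have := hdyad_ge0 N ps (e / d%:R); have := hdyad_le2 ps ed edN.
  by rewrite ler_norml => ? ?; apply/andP; split; lra.
rewrite big_split /= -!mulr_sumr.
have h1 : \sum_(1 <= d < N.+1) (d <= T)%N%:R * invphi d <= 4 * (1 + ln T%:R).
  apply: le_trans (sum_invphi_le T).
  rewrite -sum_indic.
  case: (leqP N T) => NT.
    rewrite [X in _ <= X](@big_cat_nat _ _ _ N.+1) //=.
    rewrite ler_wpDr ?sumr_nat_ge0 // => [i _|]; first exact: invphi_ge0.
    rewrite big_mkcond /=; apply: ler_sum_nat => i _; case: ifP => // _; exact: invphi_ge0.
  rewrite (@big_cat_nat _ _ _ T.+1) //= 1?ltnW // [X in _ + X]big_nat_cond.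
  rewrite [X in _ + X]big1 ?addr0; last first.
    by move=> i /andP[/andP[/ltn_geF->]].
  by rewrite big_mkcond /=; apply: ler_sum_nat => i _; case: ifP => // _; exact: invphi_ge0.
have h2 := sum_invphi_tail N T0'.
have l0 : 0 <= ln (T%:R : R) by rewrite ln_ge0 // ler1n.
apply: le_trans (lerD (ler_wpM2l _ h1) (ler_wpM2l _ h2)) _ => //.
have i0 : 0 <= (T%:R^-1 : R) by [].
set t := T%:R^-1 in i0 *; set l := ln _ in l0 *; set k := 2 ^+ _ in T2 T20 *.
have : 0 <= k * t by rewrite mulr_ge0.
have : t <= k * t by rewrite ler_peMl.
move=> ? ?; have : 0 <= k * t * l by rewrite mulr_ge0.
by lra.
Qed.

Lemma invphi_mulp (p i : nat) : prime p -> (0 < i)%N -> invphi (p * i) <= 2 / p%:R * invphi i.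
Proof.
move=> pp i0; have p2 : 2 <= (p%:R : R) by rewrite ler_nat prime_gt1.
have f0 : 0 < ((totient i)%:R : R) by rewrite ltr0n totient_gt0.
rewrite /invphi totient_mulp //.
have h : (p.-1%:R * (totient i)%:R : R)^-1 <= 2 / p%:R / (totient i)%:R.
  have -> : (p.-1%:R : R) = p%:R - 1.
    by rewrite -subn1 natrB // prime_gt0.
  rewrite invfM ler_wpM2r ?invr_ge0 1?(ltW f0) //.
  rewrite ler_pdivlMr ; last by lra.
  by rewrite mulrC ler_pdivrMr; lra.
case: ifP => _; rewrite natrM //; apply: le_trans h.
rewrite lef_pV2 ?posrE ?mulr_gt0 //; try lra.
  by apply: ler_wpM2r; rewrite ?(ltW f0) // ler_nat leq_pred.
by rewrite ltr0n -ltnS prednK ?prime_gt1 // prime_gt0.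
Qed.

Lemma sum_dyad_multiples (N p : nat) (e : R) : prime p -> 0 < e -> e <= N.+1%:R ->
  \sum_(1 <= k < N.+1) (dyad e k && (p %| k)%N)%:R * invphi k <= 16 / p%:R.
Proof.
move=> pp e0 eN; have p0 := prime_gt0 pp; have p0' : 0 < (p%:R : R) by rewrite ltr0n.
have p1' : 1 <= (p%:R : R) by rewrite ler1n.
have -> : \sum_(1 <= k < N.+1) (dyad e k && (p %| k)%N)%:R * invphi k =
   \sum_(1 <= k < N.+1) (p %| k)%N%:R * ((dyad e k)%:R * invphi k).
  by apply: eq_bigr => k _; rewrite andbC indicM mulrA.
rewrite sum_multiples //.
apply: (@le_trans _ _ (2 / p%:R * dphi N [::] (e / p%:R))).
  rewrite /dphi mulr_sumr; apply: ler_sum_nat => i /andP[i0 _].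
  rewrite /avoids /= andbT dyad_mul // [leRHS]mulrCA.
  apply: le_trans (_ : (dyad (e / p%:R) i)%:R * invphi (p * i) <= _).
    by rewrite ler_piMl ?indic_le1 // mulr_ge0 ?invphi_ge0.
  by rewrite ler_wpM2l ?invphi_mulp.
have := @dphi_le8 N [::] (e / p%:R) isT (divr_gt0 e0 p0').
have -> : 16 / p%:R = 2 / p%:R * 8 :> R by lra.
move=> h; rewrite ler_wpM2l ?divr_ge0 ?h //.
by apply: le_trans eN; rewrite ler_pdivrMr; nra.
Qed.
End Dyadic.

(** * Sums over divisors and their complementary divisors *)

Lemma sum_cut (V : pzRingType) (m N : nat) (F : nat -> V) : (m <= N)%N ->
  \sum_(1 <= i < N.+1) (i <= m)%N%:R * F i = \sum_(1 <= i < m.+1) F i.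
Proof.
move=> mN; rewrite (@big_cat_nat _ _ _ m.+1) //=.
rewrite [X in _ + X]big_nat [X in _ + X]big1 ?addr0; last first.
  by move=> i /andP[mi _]; rewrite leqNgt mi mul0r.
by apply: eq_big_nat => i /andP[_ im]; rewrite -ltnS im mul1r.
Qed.

Lemma count_multiples (V : pzRingType) (N d : nat) : (0 < d)%N ->
  \sum_(1 <= n < N.+1) (d %| n)%N%:R = (N %/ d)%:R :> V.
Proof.
move=> d0; under eq_bigr => n _ do rewrite -[_%:R]mulr1.
rewrite (sum_multiples N (fun=> 1)) //.
under eq_bigr => n _ do rewrite mulnC -leq_divRL //.
by rewrite sum_cut ?leq_div // big_const_nat iter_addr_0 subn1.
Qed.

Lemma sum_cofactor (V : pzRingType) (N m : nat) (F : nat -> V) : (0 < m <= N)%N ->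
  \sum_(1 <= e < N.+1) (e %| m)%N%:R * F e =
  \sum_(1 <= e < N.+1) (e %| m)%N%:R * F (m %/ e)%N.
Proof.
move=> /andP[m0 mN].
transitivity (\sum_(1 <= e < N.+1) \sum_(1 <= i < N.+1) (i == m %/ e)%N%:R * ((e %| m)%N%:R * F e)).
  apply: eq_big_nat => e /andP[e0 eN]; rewrite sum_pick.
  case: (boolP (e %| m)%N) => em; rewrite ?mul0r ?mulr0 //.
  rewrite divn_gt0 // (dvdn_leq _ em) // (leq_trans (leq_div _ _)) ?mul1r //.
rewrite exchange_big_nat /=; apply: eq_big_nat => i /andP[i0 iN].
transitivity (\sum_(1 <= e < N.+1) (e == m %/ i)%N%:R * ((i %| m)%N%:R * F e)).
  apply: eq_big_nat => e /andP[e0 eN]; rewrite !mulrA -!natrM !mulnb; congr (_%:R * _).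
  congr nat_of_bool; apply/idP/idP => /andP[/eqP-> dm].
    by rewrite divnA // mulKn // eqxx dvdn_div.
  by rewrite divnA // mulKn // eqxx dvdn_div.
rewrite sum_pick; case: (boolP (i %| m)%N) => im; rewrite ?mul0r ?mulr0 //.
by rewrite divn_gt0 // (dvdn_leq _ im) // (leq_trans (leq_div _ _)) ?mul1r.
Qed.

Lemma perm_divisors_iota (N m : nat) : (0 < m <= N)%N ->
  perm_eq (divisors m) [seq e <- index_iota 1 N.+1 | (e %| m)%N].
Proof.
move=> /andP[m0 mN]; apply: uniq_perm; rewrite ?divisors_uniq ?filter_uniq ?iota_uniq //.
move=> e; rewrite mem_filter mem_index_iota -dvdn_divisors //.
case: (boolP (e %| m)%N) => //= em; rewrite ltnS (leq_trans (dvdn_leq m0 em) mN) andbT.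
by rewrite (dvdn_gt0 m0 em).
Qed.

Lemma sum_divisors (V : pzRingType) (N m : nat) (F : nat -> V) : (0 < m <= N)%N ->
  \sum_(e <- divisors m) F e = \sum_(1 <= e < N.+1) (e %| m)%N%:R * F e.
Proof. by move=> h; rewrite (perm_big _ (perm_divisors_iota h)) big_filter sum_indic. Qed.

Lemma tau_sum (V : pzRingType) (N m : nat) : (0 < m <= N)%N ->
  (tau m)%:R = \sum_(1 <= e < N.+1) (e %| m)%N%:R :> V.
Proof.
move=> h; transitivity (\sum_(e <- divisors m) (1 : V)).
  by rewrite big_const_seq count_predT iter_addr_0.
by rewrite (sum_divisors (fun=> 1) h); apply: eq_bigr => e _; rewrite mulr1.
Qed.

(** * Smooth numbers, divisor-function sums and Rankin weights *)

Definition smooth (z n : nat) : bool := all (fun p => p <= z)%N (primes n).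
Definition small_primes (z n : nat) : seq nat := [seq p <- primes n | (p <= z)%N].
(** The number of terms of an inclusion-exclusion over the small primes of n, which is the error
    size in [hdyad_approx]. *)
Definition wt (z n : nat) : nat := 2 ^ size (small_primes z n).

Lemma small_primes_uniq z n : uniq (small_primes z n).
Proof. by rewrite filter_uniq ?primes_uniq. Qed.

Lemma small_primes_prime z n : all prime (small_primes z n).
Proof. by apply/allP => p; rewrite mem_filter mem_primes => /and3P[_ ->]. Qed.

Lemma smoothM z a b : (0 < a)%N -> (0 < b)%N -> smooth z (a * b) = smooth z a && smooth z b.
Proof.
move=> a0 b0; apply/idP/andP => [/allP h|[/allP ha /allP hb]].
  by split; apply/allP => p pp; apply: h; rewrite primesM // pp ?orbT.
by apply/allP => p; rewrite primesM // => /orP[/ha|/hb].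
Qed.

Lemma smooth_dvd z d n : (0 < n)%N -> (d %| n)%N -> smooth z n -> smooth z d.
Proof.
move=> n0 /dvdnP[k nE]; rewrite nE smoothM; [by case/andP| |]; move: n0;
  by rewrite nE muln_gt0 => /andP[].
Qed.

Lemma wtM_le z a b : (0 < a)%N -> (0 < b)%N -> (wt z (a * b) <= wt z a * wt z b)%N.
Proof.
move=> a0 b0; rewrite /wt -expnD leq_exp2l // -size_cat.
apply: uniq_leq_size; rewrite ?small_primes_uniq // => p.
by rewrite mem_cat !mem_filter primesM // -andb_orr.
Qed.

Lemma wt_gt0 z n : (0 < wt z n)%N. Proof. by rewrite /wt expn_gt0. Qed.

(** Products of subsets of ps are distinct divisors of n. A new prime p doubles the count: e and p e
    are both counted for every e composed of the older primes. *)
Lemma pow2_le_divisors (N n : nat) (ps : seq nat) : (0 < n <= N)%N -> uniq ps ->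
  {subset ps <= primes n} ->
  (2 ^ size ps <= \sum_(1 <= e < N.+1) (e %| n) && all (mem ps) (primes e))%N.
Proof.
move=> /andP[n0 nN]; elim: ps => [|p ps IH] /=.
  move=> _ _; rewrite (@big_cat_nat _ _ _ 2) //= ; last by lia.
  by rewrite big_nat1 /= dvd1n expn0 leq_addr.
move=> /andP[pps ups] sub.
have pn : p \in primes n by apply: sub; rewrite inE eqxx.
have pp : prime p by move: pn; rewrite mem_primes => /andP[].
have p0 := prime_gt0 pp.
have pdn : (p %| n)%N by move: pn; rewrite mem_primes => /and3P[].
have {}IH : (2 ^ size ps <= \sum_(1 <= e < N.+1) (e %| n) && all (mem ps) (primes e))%N.
  by apply: IH => // q qps; apply: sub; rewrite inE qps orbT.
have notp e : (0 < e)%N -> all (mem ps) (primes e) -> ~~ (p %| e)%N.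
  move=> e0 /allP h; apply: contra pps => pe; apply: h; rewrite mem_primes pp e0 //.
pose G (e : nat) : bool := (e %| n)%N && all (mem (p :: ps)) (primes e).
apply: (@leq_trans (\sum_(1 <= e < N.+1) ((e %| n) && all (mem ps) (primes e))%N +
   \sum_(1 <= e < N.+1) (p %| e) * G e)%N); last first.
  rewrite -big_split /= big_nat [X in (_ <= X)%N]big_nat; apply: leq_sum => e /andP[e0 _].
  have sub' : all (mem ps) (primes e) -> all (mem (p :: ps)) (primes e).
    by apply: sub_all => q /= qps; rewrite inE qps orbT.
  have := @notp e e0; rewrite /G; move: sub'.
  case: (all (mem ps) _) => [->|_] //; last first.
    by rewrite andbF add0n; case: (p %| e)%N; rewrite ?mul1n ?mul0n.
  by move=> // /(_ isT) /negbTE->; rewrite mul0n addn0.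
rewrite expnS mul2n -addnn leq_add //; apply: leq_trans IH _.
have E : (\sum_(1 <= e < N.+1) (p %| e) * G e = \sum_(1 <= i < N.+1) (p * i <= N) * G (p * i))%N.
  apply/eqP; rewrite -(eqr_nat int) !natr_sum; apply/eqP.
  under eq_bigr do rewrite natrM; under [RHS]eq_bigr do rewrite natrM.
  exact: (@sum_multiples int N p (fun e => (G e)%:R) p0).
rewrite E big_nat [X in (_ <= X)%N]big_nat; apply: leq_sum => e /andP[e0 _].
case: (boolP (e %| n)%N) => en //=; case: (boolP (all _ _)) => //= ae.
have pe := notp e e0 ae.
have pen : (p * e %| n)%N by rewrite Gauss_dvd ?pdn // prime_coprime.
rewrite /G pen (leq_trans (dvdn_leq n0 pen) nN) /= mul1n lt0b.
by apply/allP => q; rewrite primesM // primes_prime // inE /= inE => /orP[->//|/(allP ae) /= ->];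
  rewrite orbT.
Qed.

Section SmoothSums.
Variable R : realType.

Lemma wt_le_smooth_divisors (N z n : nat) : (0 < n <= N)%N ->
  (wt z n)%:R <= \sum_(1 <= e < N.+1) ((e %| n) && smooth z e)%N%:R :> R.
Proof.
move=> h; rewrite -natr_sum ler_nat.
have sub : {subset small_primes z n <= primes n} by move=> p; rewrite mem_filter => /andP[].
apply: leq_trans (pow2_le_divisors h (small_primes_uniq z n) sub) _.
rewrite big_nat [X in (_ <= X)%N]big_nat; apply: leq_sum => e _.
case: (e %| n)%N => //=; case: (boolP (all _ _)) => // /allP a.
by rewrite lt0b; apply/allP => p /a; rewrite /= mem_filter => /andP[].
Qed.

Lemma wt_le_tau (z n : nat) : (0 < n)%N -> (wt z n <= tau n)%N.
Proof.
move=> n0; have h : (0 < n <= n)%N by rewrite n0 leqnn.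
rewrite -(ler_nat R); apply: le_trans (wt_le_smooth_divisors z h) _.
rewrite (tau_sum R h); apply: ler_sum_nat => e _.
by rewrite indicM ler_piMr // indic_le1.
Qed.

Lemma sum_tau_le (N : nat) : \sum_(1 <= n < N.+1) (tau n)%:R <= N%:R * (1 + ln N%:R) :> R.
Proof.
rewrite (eq_big_nat _ _ (F2 := fun n => \sum_(1 <= e < N.+1) (e %| n)%N%:R)); last first.
  by move=> n hn; apply: tau_sum; lia.
rewrite exchange_big_nat /=; apply: le_trans (_ : \sum_(1 <= e < N.+1) N%:R * e%:R^-1 <= _).
  apply: ler_sum_nat => e /andP[e0 _]; rewrite count_multiples //.
  by rewrite ler_pdivlMr ?ltr0n // -natrM ler_nat leq_divM.
by rewrite -mulr_sumr ler_wpM2l // harmonic_le.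
Qed.

(** One of e and m/e has square at most N. The threshold depends on N rather than on m, so that it
    is uniform when m runs through a window. *)
Lemma tau_le_sqrt (N m : nat) : (0 < m <= N)%N ->
  (tau m)%:R <= 2 * \sum_(1 <= e < N.+1) ((e * e <= N) && (e %| m))%N%:R :> R.
Proof.
move=> h; have /andP[m0 mN] := h.
rewrite (tau_sum R h) mulr_natl mulr2n.
have E := sum_cofactor (fun e => ((e * e <= N)%N%:R : R)) h.
apply: le_trans (_ : \sum_(1 <= e < N.+1) (e %| m)%N%:R * (e * e <= N)%N%:R +
  \sum_(1 <= e < N.+1) (e %| m)%N%:R * ((m %/ e) * (m %/ e) <= N)%N%:R <= _); last first.
  rewrite -E lerD //; apply: ler_sum_nat => e _; rewrite andbC indicM //.
rewrite -big_split /=; apply: ler_sum_nat => e /andP[e0 _]; rewrite -mulrDr.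
case: (boolP (e %| m)%N) => em; rewrite ?mul0r ?mul1r // -natrD ler_nat.
case: (leqP (e * e) N) => //= eN; rewrite add0n lt0b.
have mE : m = (m %/ e * e)%N by rewrite divnK.
have : (m %/ e < e)%N by rewrite ltn_divLR //; lia.
move=> lt; apply: leq_trans mN; rewrite [leqRHS]mE leq_mul //; lia.
Qed.

Lemma count_window (N : nat) (J : pred nat) (len : R) : 0 <= len ->
  (forall a b : nat, J a -> J b -> (a <= b)%N -> b%:R - a%:R <= len) ->
  \sum_(1 <= n < N.+1) (J n)%:R <= len + 1.
Proof.
move=> len0 dJ.
have -> : \sum_(1 <= n < N.+1) (J n)%:R = (size [seq n <- index_iota 1 N.+1 | J n])%:R :> R.
  by rewrite -natr_sum size_filter -sum1_count [in RHS]big_mkcond /=; congr (_%:R);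
     apply: eq_bigr => i _; case: (J i).
have [->|] := eqVneq [seq n <- index_iota 1 N.+1 | J n] [::]; first by rewrite /=; lra.
rewrite -has_filter => /hasP[n0 _ Jn0].
have ex : exists n, J n by exists n0.
case: (ex_minnP ex) => a Ja amin.
have : (size [seq n <- index_iota 1 N.+1 | J n] <= size (index_iota a (a + Num.truncn len).+1))%N.
  apply: uniq_leq_size; rewrite ?filter_uniq ?iota_uniq // => b.
  rewrite mem_filter mem_index_iota => /andP[Jb _]; rewrite mem_index_iota (amin _ Jb) /=.
  have ab := amin _ Jb; have := dJ _ _ Ja Jb ab; rewrite -natrB // => h.
  by rewrite ltnS -leq_subLR truncn_ge_nat.
rewrite size_iota -(ler_nat R) => /le_trans; apply.
rewrite subSn ?leq_addr // addKn -natr1 lerD2r truncn_le //.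
Qed.

Lemma count_window_multiples (N d : nat) (J : pred nat) (len : R) : (0 < d)%N -> 0 <= len ->
  (forall a b : nat, J a -> J b -> (a <= b)%N -> b%:R - a%:R <= len) ->
  \sum_(1 <= n < N.+1) (J n && (d %| n)%N)%:R <= len / d%:R + 1.
Proof.
move=> d0 len0 dJ; have d0' : 0 < (d%:R : R) by rewrite ltr0n.
have -> : \sum_(1 <= n < N.+1) (J n && (d %| n)%N)%:R =
   \sum_(1 <= n < N.+1) (d %| n)%N%:R * (J n)%:R :> R.
  by apply: eq_bigr => n _; rewrite andbC indicM.
rewrite sum_multiples //.
apply: le_trans (_ : \sum_(1 <= i < N.+1) (J (d * i)%N)%:R <= _).
  by apply: ler_sum_nat => i _; rewrite ler_piMl // indic_le1.
apply: (@count_window N (fun i => J (d * i)%N)); first by rewrite divr_ge0 // ltW.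
move=> a b Ja Jb ab; rewrite ler_pdivlMr // mulrBl -!natrM.
by have := dJ _ _ Ja Jb; rewrite leq_pmul2l // ![(d * _)%N]mulnC; apply.
Qed.

(** Only divisors e <= sqrt N <= len are used, so the rounding error 1 committed for each e adds up
    to at most len. With len = Q this is where the lower bound sqrt(2x) for Q enters the estimate of
    the kernel. *)
Lemma sum_tau_window (N : nat) (J : pred nat) (len : R) : (0 < N)%N -> 0 <= len ->
  N%:R <= len ^+ 2 ->
  (forall a b : nat, J a -> J b -> (a <= b)%N -> b%:R - a%:R <= len) ->
  \sum_(1 <= n < N.+1) (J n)%:R * (tau n)%:R <= 2 * len * (2 + ln N%:R).
Proof.
move=> N0 len0 Nlen dJ.
apply: le_trans (_ : \sum_(1 <= n < N.+1) (J n)%:R *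
   (2 * \sum_(1 <= e < N.+1) ((e * e <= N) && (e %| n))%N%:R) <= _).
  by apply: ler_sum_nat => n hn; rewrite ler_wpM2l // tau_le_sqrt //; lia.
rewrite (eq_bigr (fun n => \sum_(1 <= e < N.+1) 2 * ((e * e <= N)%N%:R * (J n && (e %| n)%N)%:R))); last first.
  move=> n _; rewrite !mulr_sumr; apply: eq_bigr => e _; rewrite !indicM; ring.
rewrite exchange_big_nat /=.
apply: le_trans (_ : \sum_(1 <= e < N.+1) 2 * ((e * e <= N)%N%:R * (len / e%:R + 1)) <= _).
  apply: ler_sum_nat => e /andP[e0 _]; rewrite -!mulr_sumr !ler_wpM2l //.
  exact: count_window_multiples.
rewrite -mulr_sumr -mulrA ler_wpM2l //.
apply: le_trans (_ : \sum_(1 <= e < N.+1) len * e%:R^-1 + \sum_(1 <= e < N.+1) (e * e <= N)%N%:R <= _).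
  rewrite -big_split /=; apply: ler_sum_nat => e _.
  by case: (_ <= _)%N; rewrite ?mul1r ?mul0r ?addr0 // mulr_ge0.
have h2 : \sum_(1 <= e < N.+1) (e * e <= N)%N%:R <= len.
  have N1 : 1 <= (N%:R : R) by rewrite ler1n.
  have len1 : 1 <= len by nra.
  rewrite (eq_big_nat _ _ (F2 := fun e => ((1 <= e) && (e * e <= N))%N%:R)); last first.
    by move=> e /andP[-> _].
  rewrite -[leRHS](subrK 1); apply: count_window; first by lra.
  move=> a b /andP[a1 _] /andP[_ bN] _.
  have : (1 : R) <= a%:R by rewrite ler1n.
  have : (b%:R : R) * b%:R <= N%:R by rewrite -natrM ler_nat.
  by nra.
rewrite -mulr_sumr; have := @harmonic_le R N; nra.
Qed.
(** From exp(-1/6) >= 5/6 one gets exp(1/6) <= 6/5, and (6/5)^6 < 3. Its purpose is ln P > 1 for all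
    P >= 3. *)
Lemma expR1_lt3 : expR (1 : R) < 3.
Proof.
have h : expR (1 / 6 : R) <= 6 / 5.
  have : (5 / 6 : R) <= expR (- (1/6)) by have := @expR_ge1Dx R (- (1/6)); lra.
  rewrite expRN => h; have e0 := expR_gt0 (1/6 : R).
  have : 5 / 6 * expR (1 / 6 : R) <= 1.
    rewrite -[leRHS](@mulVf _ (expR (1/6 : R))) ?gt_eqF //.
    by apply: ler_wpM2r => //; apply: ltW.
  by lra.
have -> : expR (1 : R) = expR (1/6) ^+ 6 by rewrite -expRM_natl; congr expR; lra.
apply: le_lt_trans (_ : (6 / 5) ^+ 6 < _); last by rewrite !exprS expr0; lra.
by rewrite ler_pXn2r // ?nnegrE ?expR_ge0 //; lra.
Qed.

Lemma ln3_gt1 : 1 < ln (3 : R).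
Proof. by rewrite -[ltLHS](@expRK R) ltr_ln ?posrE ?expR_gt0 ?expR1_lt3. Qed.

Lemma ln_sum_logn (N n : nat) : (0 < n <= N)%N ->
  ln n%:R = \sum_(1 <= p < N.+1) (logn p n)%:R * ln p%:R :> R.
Proof.
move=> /andP[n0 nN].
have lnP (s : seq nat) : (forall p, p \in s -> 0 < p)%N ->
   ln (\prod_(p <- s) (p ^ logn p n)%:R) = \sum_(p <- s) (logn p n)%:R * ln p%:R :> R.
  elim: s => [|p s IH] h; first by rewrite !big_nil ln1.
  have p0 : (0 < p)%N by apply: h; rewrite inE eqxx.
  rewrite !big_cons lnM ?posrE; last 2 first.
  - by rewrite ltr0n expn_gt0 p0.
  - rewrite big_seq prodr_gt0 // => q qs; rewrite ltr0n expn_gt0 h // inE qs orbT //.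
  by rewrite IH => [|q qs]; [rewrite natrX lnXn ?ltr0n // mulr_natl | apply: h; rewrite inE qs orbT].
rewrite (@big_cat_nat _ _ _ n.+1) //= [X in _ + X]big_nat [X in _ + X]big1 ?addr0; last first.
  by move=> p /andP[np _]; rewrite lognE gtnNdvd ?andbF ?mul0r.
rewrite -lnP => [|p]; last by rewrite mem_index_iota => /andP[].
congr ln; rewrite -natr_prod; congr (_%:R).
rewrite -[LHS](partnT n0) /partn big_mkcond /= big_ltn //.
by rewrite (_ : logn 0 n = 0)%N ?expn0 ?mul1n // lognE.
Qed.

Lemma logn_sum_dvd (N p n : nat) : (0 < n <= N)%N ->
  (logn p n)%:R = \sum_(1 <= k < N.+1) (prime p && (p ^ k %| n))%N%:R :> R.
Proof.
move=> /andP[n0 nN]; case: (boolP (prime p)) => pp /=; last first.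
  by rewrite lognE (negbTE pp) /= big1.
rewrite (@big_cat_nat _ _ _ n) //=; last by rewrite ltnW.
rewrite [X in _ + X]big_nat [X in _ + X]big1 ?addr0; last first.
  move=> k /andP[nk _]; rewrite gtnNdvd //; apply: leq_ltn_trans nk _.
  exact: ltn_expl (prime_gt1 pp).
by rewrite logn_count_dvd // natr_sum.
Qed.

(** A Mertens-type bound with a loose constant: each n <= z is weighted by the sum of ln p over its
    primes, which is at most ln n, and [z %/ p] is at least z/(2p). *)
Lemma sum_prime_log_le (z : nat) :
  \sum_(1 <= p < z.+1) (prime p)%:R * (ln p%:R / p%:R) <= 2 * ln z%:R :> R.
Proof.
case: (posnP z) => [->|z0]; first by rewrite big_geq // ln0 //; lra.
have z0' : 0 < (z%:R : R) by rewrite ltr0n.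
have lnp0 p : (0 < p)%N -> 0 <= ln (p%:R : R) by move=> p0; rewrite ln_ge0 // ler1n.
suff h : \sum_(1 <= p < z.+1) (prime p)%:R * (ln p%:R / p%:R) * (z%:R / 2) <= z%:R * ln z%:R :> R.
  by move: h; rewrite -mulr_suml => h; rewrite -(ler_pM2r z0'); lra.
apply: le_trans (_ : \sum_(1 <= p < z.+1) \sum_(1 <= n < z.+1)
    (prime p)%:R * ln p%:R * (p %| n)%N%:R <= _).
  apply: ler_sum_nat => p /andP[p0 pz]; rewrite -mulr_sumr count_multiples //.
  have p0' : 0 < (p%:R : R) by rewrite ltr0n.
  rewrite -!mulrA ler_wpM2l // ler_wpM2l ?lnp0 //.
  rewrite mulrC ler_pdivrMr // ler_pdivrMr // -!natrM ler_nat.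
  have q1 : (0 < z %/ p)%N by rewrite divn_gt0.
  have := ltn_ceil z p0; nia.
rewrite exchange_big_nat /=.
apply: le_trans (_ : \sum_(1 <= n < z.+1) ln z%:R <= _); last first.
  by rewrite big_const_nat iter_addr_0 subn1 mulr_natl.
apply: ler_sum_nat => n /andP[n0 nz]; have hn : (0 < n <= z)%N by rewrite n0.
apply: le_trans (_ : ln n%:R <= _); last by rewrite ler_ln ?posrE ?ltr0n // ler_nat.
rewrite (ln_sum_logn hn); apply: ler_sum_nat => p /andP[p0 _].
rewrite mulrAC ler_wpM2r ?lnp0 // -natrM ler_nat mulnb.
by case: (boolP (prime p && (p %| n)%N)) => // /andP[pp pn]; rewrite logn_gt0 mem_primes pp n0.
Qed.

(** Rankin's weight d^(lam - 1) on z-smooth d; it is completely multiplicative. *)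
Definition sf (lam : R) (z d : nat) : R := (smooth z d)%:R * (expR (lam * ln d%:R) / d%:R).

Lemma sf_ge0 lam z d : 0 <= sf lam z d.
Proof. by rewrite mulr_ge0 // divr_ge0 // expR_ge0. Qed.

Lemma sfM lam z a b : (0 < a)%N -> (0 < b)%N -> sf lam z (a * b) = sf lam z a * sf lam z b.
Proof.
move=> a0 b0; rewrite /sf smoothM // indicM natrM lnM ?posrE ?ltr0n // mulrDr expRD invfM; ring.
Qed.

Lemma sf1 lam z : sf lam z 1 = 1.
Proof. by rewrite /sf /smooth /= ln1 mulr0 expR0 invr1 !mulr1. Qed.

Lemma sfX lam z p k : (0 < p)%N -> sf lam z (p ^ k) = sf lam z p ^+ k.
Proof.
move=> p0; elim: k => [|k IH]; first by rewrite expn0 expr0 sf1.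
by rewrite expnS exprS sfM ?IH // expn_gt0 p0.
Qed.

(* With f d = sf (1 / ln P) z d one has sum f d * ln d <= C * ln P * sum f d, so by
   Markov half of the sum comes from d <= P ^ (2 C), where f d is O(1 / d). *)
Lemma sum_smooth_le : exists2 C : R, 0 <= C & forall (P : R) (z N : nat),
  3 <= P -> z%:R <= P -> \sum_(1 <= d < N.+1) sf (1 / ln P) z d <= C * ln P.
Proof.
have l3 := ln3_gt1.
(* An upper bound below 1 for p^(lam - 1), uniform in p >= 2 and in lam <= 1/ln 3, so that all
   geometric series over prime powers share the factor 1/(1 - r0). *)
pose r0 : R := expR (- ((1 - 1 / ln 3) * ln 2)).
have i3 : 1 / ln 3 < 1 :> R by rewrite ltr_pdivrMr; lra.
have l2 : 0 < ln (2 : R) by rewrite ln_gt0 //; lra.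
have r0lt : r0 < 1 by rewrite -expR0 ltr_expR; nra.
(* The factor 3/(1 - r0) of [geo] times the 2 of [sum_prime_log_le]. *)
pose C1 : R := 6 / (1 - r0).
have C10 : 0 < C1 by rewrite divr_gt0 //; lra.
exists (2 * (expR (2 * C1) * (1 + 2 * C1))).
  by rewrite !mulr_ge0 ?expR_ge0 //; lra.
move=> P z N P3 zP; set lam := 1 / ln P.
have lP : ln 3 <= ln P by rewrite ler_ln ?posrE //; lra.
have lP0 : 0 < ln P by lra.
have lam0 : 0 < lam by rewrite divr_gt0.
have laml : lam * ln P = 1 by rewrite /lam mul1r mulVf // gt_eqF.
have lam3 : lam <= 1 / ln 3 by rewrite /lam !div1r lef_pV2 ?posrE; lra.
set F := \sum_(1 <= d < N.+1) _.
have F0 : 0 <= F by apply: sumr_nat_ge0 => d _; exact: sf_ge0.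
have lnz : ln z%:R <= ln P.
  case: (posnP z) => [->|z0]; first by rewrite ln0 //; lra.
  by rewrite ler_ln ?posrE ?ltr0n //; lra.
have ln0' (p : nat) : (0 < p)%N -> 0 <= ln (p%:R : R) by move=> p0; rewrite ln_ge0 // ler1n.
(* Here p^lam <= e < 3, because p <= P and lam * ln P = 1. *)
have geo p : prime p -> \sum_(1 <= k < N.+1) sf lam z p ^+ k <= 3 / (1 - r0) * ((p <= z)%N%:R / p%:R).
  move=> pp; have p0 := prime_gt0 pp; have p0' : 0 < (p%:R : R) by rewrite ltr0n.
  case: (leqP p z) => pz; last first.
    rewrite mul0r mulr0 big_nat big1 // => k /andP[k0 _].
    rewrite /sf /smooth primes_prime //= leqNgt pz /= mul0r expr0n; by case: k k0.
  have sE : sf lam z p = expR (lam * ln p%:R) / p%:R.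
    by rewrite /sf /smooth primes_prime //= pz mul1r.
  have lp : ln p%:R <= ln P.
    by rewrite ler_ln ?posrE //; [apply: le_trans zP; rewrite ler_nat | lra].
  have s1 : sf lam z p <= 3 / p%:R.
    rewrite sE; apply: ler_wpM2r; first by rewrite invr_ge0 ltW.
    apply: le_trans (ltW expR1_lt3).
    by rewrite ler_expR -[leRHS]laml; apply: ler_wpM2l => //; apply: ltW.
  have s2 : sf lam z p <= r0.
    have pE : (p%:R^-1 : R) = expR (- ln p%:R) by rewrite expRN lnK ?posrE.
    rewrite sE pE -expRD ler_expR.
    have p2 : ln 2 <= ln (p%:R : R) by rewrite ler_ln ?posrE // ler_nat prime_gt1.
    by nra.
  have s0 : 0 <= sf lam z p := sf_ge0 _ _ _.
  set s := sf lam z p in s0 s1 s2 *.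
  have r1 : 0 < 1 - r0 by rewrite subr_gt0.
  have s1' : 0 < 1 - s by clear - s2 r0lt; lra.
  have sum_le : \sum_(1 <= k < N.+1) s ^+ k <= s / (1 - s).
    have geoE M : (1 - s) * \sum_(1 <= k < M.+1) s ^+ k = s - s ^+ M.+1.
      elim: M => [|M IH]; first by rewrite big_geq // mulr0 expr1 subrr.
      by rewrite big_nat_recr //= mulrDr IH !exprS; ring.
    by rewrite ler_pdivlMr // mulrC geoE gerBl exprn_ge0.
  apply: le_trans sum_le _; rewrite mul1r.
  apply: (@le_trans _ _ (s / (1 - r0))).
    by rewrite ler_wpM2l // lef_pV2 ?posrE // lerD2l lerN2.
  by rewrite [leRHS]mulrAC; apply: ler_wpM2r => //; rewrite invr_ge0 ltW.
(* ln d is the sum of ln p over prime powers p^k dividing d; complete multiplicativity pulls p^k out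
   and leaves at most the whole sum F. *)
have flog : \sum_(1 <= d < N.+1) sf lam z d * ln d%:R <= C1 * ln P * F.
  apply: (@le_trans _ _ (\sum_(1 <= d < N.+1) \sum_(1 <= p < N.+1) \sum_(1 <= k < N.+1)
     (prime p)%:R * ln p%:R * ((p ^ k %| d)%N%:R * sf lam z d))).
    apply: ler_sum_nat => d hd; rewrite (@ln_sum_logn N) // mulr_sumr; apply: ler_sum_nat => p _.
    rewrite (@logn_sum_dvd N) // mulr_suml mulr_sumr; apply: ler_sum_nat => k _.
    by rewrite indicM le_eqVlt; apply/orP; left; apply/eqP; ring.
  rewrite exchange_big_nat /=.
  apply: (@le_trans _ _ (\sum_(1 <= p < N.+1)
      (prime p)%:R * ln p%:R * (3 / (1 - r0) * ((p <= z)%N%:R / p%:R)) * F)).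
    apply: ler_sum_nat => p /andP[p0 _]; rewrite exchange_big_nat /=.
    case: (boolP (prime p)) => pp; last first.
      by rewrite !mul0r big1 // => k _; rewrite big1 // => d _; rewrite !mul0r.
    rewrite mul1r.
    apply: (@le_trans _ _ (\sum_(1 <= k < N.+1) ln p%:R * (sf lam z p ^+ k * F))).
      apply: ler_sum_nat => k _; rewrite -mulr_sumr ler_wpM2l ?ln0' //.
      rewrite sum_multiples ?expn_gt0 ?p0 // /F mulr_sumr; apply: ler_sum_nat => i /andP[i0 _].
      by rewrite sfM ?expn_gt0 ?p0 // sfX // ler_piMl ?indic_le1 // mulr_ge0 ?sf_ge0 // exprn_ge0 // sf_ge0.
    rewrite -mulr_sumr -mulr_suml mulrA ler_wpM2r // ler_wpM2l ?ln0' //.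
    exact: geo.
  rewrite -mulr_suml ler_wpM2r //.
  have C1E : C1 * ln P = 3 / (1 - r0) * (2 * ln P) by rewrite /C1; lra.
  rewrite C1E.
  apply: (@le_trans _ _ (3 / (1 - r0) * \sum_(1 <= p < N.+1) (p <= z)%N%:R * ((prime p)%:R * (ln p%:R / p%:R)))).
    by rewrite mulr_sumr; apply: ler_sum_nat => p _; rewrite le_eqVlt; apply/orP; left; apply/eqP; ring.
  rewrite ler_wpM2l ?divr_ge0 //; try lra.
  apply: (@le_trans _ _ (2 * ln z%:R)); last by lra.
  apply: le_trans (sum_prime_log_le z).
  have t0 p : (0 < p)%N -> 0 <= (prime p)%:R * (ln p%:R / p%:R) :> R.
    by move=> p0; rewrite mulr_ge0 // divr_ge0 // ln0'.
  case: (leqP z N) => zN; first by rewrite sum_cut.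
  rewrite [leRHS](@big_cat_nat _ _ _ N.+1) //=; last by rewrite ltnW.
  apply: ler_wpDr; first by apply: sumr_nat_ge0 => p /andP[Np _]; apply: t0; apply: leq_ltn_trans Np.
  by apply: ler_sum_nat => p /andP[p0 _]; rewrite ler_piMl ?indic_le1 ?t0.
have CP0 : 0 < 2 * C1 * ln P by apply: mulr_gt0 => //; apply: mulr_gt0.
pose y : R := expR (2 * C1 * ln P).
have y1 : 1 <= y by rewrite -expR0 ler_expR ltW.
have split : F <= \sum_(1 <= d < N.+1) (d <= Num.truncn y)%N%:R * sf lam z d +
   (2 * C1 * ln P)^-1 * \sum_(1 <= d < N.+1) sf lam z d * ln d%:R.
  rewrite mulr_sumr -big_split /=; apply: ler_sum_nat => d /andP[d0 _].
  have := sf_ge0 lam z d; set f := sf _ _ _ => f0.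
  case: leqP => dy; first by rewrite mul1r lerDl !mulr_ge0 ?ln0' // invr_ge0 ltW.
  rewrite mul0r add0r mulrCA; apply: ler_peMr => //; rewrite mulrC ler_pdivlMr // mul1r.
  rewrite -[leLHS]expRK ler_ln ?posrE ?expR_gt0 ?ltr0n // -/y ltW //.
  by rewrite -truncn_lt_nat // (le_trans ler01).
have small : \sum_(1 <= d < N.+1) (d <= Num.truncn y)%N%:R * sf lam z d <=
    expR (2 * C1) * (1 + 2 * C1 * ln P).
  apply: (@le_trans _ _ (\sum_(1 <= d < (Num.truncn y).+1) expR (2 * C1) * d%:R^-1)); last first.
    rewrite -mulr_sumr ler_wpM2l ?expR_ge0 //; apply: le_trans (harmonic_le _ _) _.
    rewrite lerD2l -[leRHS]expRK ler_ln ?posrE ?expR_gt0 ?ltr0n ?truncn_gt0 // -/y truncn_le; lra.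
  have bnd d : (0 < d <= Num.truncn y)%N -> sf lam z d <= expR (2 * C1) * d%:R^-1.
    move=> /andP[d0 dy]; rewrite /sf; apply: le_trans (_ : expR (lam * ln d%:R) / d%:R <= _).
      by rewrite ler_piMl ?indic_le1 // divr_ge0 ?expR_ge0.
    rewrite ler_wpM2r // ler_expR; have : ln (d%:R : R) <= 2 * C1 * ln P.
      rewrite -[leRHS]expRK ler_ln ?posrE ?expR_gt0 ?ltr0n // -/y -truncn_ge_nat //; lra.
    by move=> h; have := ler_wpM2l (ltW lam0) h; rewrite [lam * (_ * ln P)]mulrCA laml mulr1.
  have b0 d : 0 <= expR (2 * C1) * (d%:R : R)^-1 by rewrite mulr_ge0 ?expR_ge0.
  case: (leqP (Num.truncn y) N) => yN.
    by rewrite sum_cut //; apply: ler_sum_nat => d hd; apply: bnd.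
  rewrite [leRHS](@big_cat_nat _ _ _ N.+1) //=; last by rewrite ltnW.
  apply: ler_wpDr; first by apply: sumr_nat_ge0.
  apply: ler_sum_nat => d /andP[d0 dN].
  have dy : (d <= Num.truncn y)%N by apply: leq_trans (ltnW yN).
  by rewrite dy mul1r bnd // d0.
have half : (2 * C1 * ln P)^-1 * (C1 * ln P * F) = F / 2 by field; rewrite !gt_eqF.
have := ler_wpM2l (_ : 0 <= (2 * C1 * ln P)^-1) flog; rewrite half invr_ge0 => /(_ (ltW CP0)) h.
have e0 := expR_gt0 (2 * C1).
have lP1 : 1 <= ln P by clear - l3 lP; lra.
have e1 : expR (2 * C1) * 1 <= expR (2 * C1) * ln P by rewrite ler_pM2l.
by clear - split small h e1; lra.
Qed.

(** Writing d = e i, the weight factors into those of e and i, and every pair occurs in the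
    square. *)
Lemma sum_smooth_tau_le (lam : R) (z N : nat) :
  \sum_(1 <= d < N.+1) sf lam z d * (tau d)%:R <= (\sum_(1 <= d < N.+1) sf lam z d) ^+ 2.
Proof.
apply: (@le_trans _ _ (\sum_(1 <= d < N.+1) \sum_(1 <= e < N.+1) (e %| d)%N%:R * sf lam z d)).
  by apply: ler_sum_nat => d hd; rewrite (@tau_sum R N) // mulr_sumr;
     apply: ler_sum_nat => e _; rewrite mulrC.
rewrite exchange_big_nat /= expr2 mulr_suml; apply: ler_sum_nat => e /andP[e0 _].
rewrite sum_multiples // mulr_sumr; apply: ler_sum_nat => i /andP[i0 _].
by rewrite sfM // ler_piMl ?indic_le1 // mulr_ge0 ?sf_ge0.
Qed.
End SmoothSums.

(** * Comparison of divisor convolutions with tau3 and its truncation *)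

Lemma big_divisors_coprime (a c : nat) (F : nat -> nat) : (0 < a)%N -> (0 < c)%N ->
  coprime a c ->
  (\sum_(h <- divisors (a * c)) F h = \sum_(h1 <- divisors a) \sum_(h2 <- divisors c) F (h1 * h2))%N.
Proof.
move=> a0 c0 ac.
rewrite -(big_allpairs_dep (h := fun h1 h2 => (h1 * h2)%N) (r2 := fun=> divisors c)) /=.
apply: perm_big; apply: uniq_perm; rewrite ?divisors_uniq //.
  apply: allpairs_uniq; rewrite ?divisors_uniq // => -[h1 h2] [k1 k2].
  move=> /allpairsP[[x1 x2] [/= x1a x2c [-> ->]]] /allpairsP[[y1 y2] [/= y1a y2c [-> ->]]] /= E.
  rewrite -!dvdn_divisors // in x1a x2c y1a y2c.
  have cop x y : (x %| a)%N -> (y %| c)%N -> coprime x y.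
    by move=> xa yc; apply: coprime_dvdl xa _; apply: coprime_dvdr yc _.
  have e1 : (x1 = y1)%N.
    apply/eqP; rewrite eqn_dvd -(Gauss_dvdl y1 (cop _ _ x1a y2c)) -E dvdn_mulr //=.
    by rewrite -(Gauss_dvdl x1 (cop _ _ y1a x2c)) E dvdn_mulr.
  congr (_, _) => //; apply/eqP; rewrite e1 in E.
  by rewrite -(eqn_pmul2l (dvdn_gt0 a0 y1a)) E.
move=> h; rewrite -dvdn_divisors ?muln_gt0 ?a0 //; apply/idP/allpairsP => [hac|[[h1 h2] /= [ha hc ->]]].
  have h0 : (0 < h)%N by apply: dvdn_gt0 hac; rewrite muln_gt0 a0.
  have g0 : (0 < gcdn h a)%N by rewrite gcdn_gt0 h0.
  exists (gcdn h a, (h %/ gcdn h a)%N) => /=; rewrite -!dvdn_divisors // dvdn_gcdr; split => //.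
    rewrite dvdn_divLR ?dvdn_gcdl // muln_gcdr dvdn_gcd [(c * a)%N]mulnC hac andbT.
    by rewrite dvdn_mull.
  by rewrite mulnC divnK // dvdn_gcdl.
by rewrite -!dvdn_divisors // in ha hc; apply: dvdn_mul.
Qed.

(** The pairs (h, e) with h | m and e | m/h inject into triples with product m by adding the third
    factor m/(h e). *)
Lemma sum_tau_le_tau3 (m : nat) : (0 < m)%N ->
  (\sum_(h <- divisors m) tau (m %/ h) <= tau3 m)%N.
Proof.
move=> m0; pose l := [seq (h, e) | h <- divisors m, e <- divisors (m %/ h)].
have -> : (\sum_(h <- divisors m) tau (m %/ h) = size l)%N.
  rewrite /l size_allpairs_dep sumnE big_map; apply: eq_bigr => h _; by rewrite /tau.
pose f (t : nat * nat) : 'I_m.+1 * 'I_m.+1 * 'I_m.+1 :=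
  (inord t.1, inord t.2, inord (m %/ t.1 %/ t.2)).
have lP t : t \in l -> [/\ (0 < t.1)%N, (0 < t.2)%N, (t.1 <= m)%N & (t.2 <= m)%N /\ (t.1 * t.2 %| m)%N].
  case/allpairsPdep => h [e [hm em ->]] /=.
  have h' : (h %| m)%N by rewrite dvdn_divisors.
  have mh : (0 < m %/ h)%N by rewrite divn_gt0 ?(dvdn_gt0 m0 h') // dvdn_leq.
  have e' : (e %| m %/ h)%N by rewrite dvdn_divisors.
  split; rewrite ?(dvdn_gt0 m0 h') ?(dvdn_gt0 mh e') ?(dvdn_leq m0 h') //; split.
    by apply: leq_trans (dvdn_leq mh e') (leq_div _ _).
  by rewrite mulnC -dvdn_divRL.
have ul : uniq l.
  apply: allpairs_uniq_dep => [|h _|[a b] [c d] /= _ _ [-> ->]] //; exact: divisors_uniq.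
have uf : uniq (map f l).
  rewrite map_inj_in_uniq // => -[a b] [c d] /lP[_ _ /= a1 [b1 _]] /lP[_ _ /= c1 [d1 _]].
  rewrite /f /= => -[/(congr1 val) /= E1 /(congr1 val) /= E2 _].
  by move: E1 E2; rewrite !inordK // => -> ->.
rewrite -(size_map f) -(card_uniqP uf) /tau3; apply: subset_leq_card.
apply/fintype.subsetP => t /mapP[[a b] /lP[/= a0 b0 am [bm abm]] ->]; rewrite inE /f /=.
rewrite !inordK ?ltnS // -divnMA ?leq_div //.
by rewrite mulnC divnK.
Qed.

Lemma tau_le_tau3 (m : nat) : (0 < m)%N -> (tau m <= tau3 m)%N.
Proof.
move=> m0; apply: leq_trans (sum_tau_le_tau3 m0).
rewrite (big_rem 1%N) /= ?divn1 ?leq_addr //.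
by rewrite -dvdn_divisors // dvd1n.
Qed.

Lemma tau_gt0 (m : nat) : (0 < m)%N -> (0 < tau m)%N.
Proof.
move=> m0; rewrite /tau; have : (1%N \in divisors m) by rewrite -dvdn_divisors // dvd1n.
by case: (divisors m).
Qed.

Lemma tau3_gt0 (m : nat) : (0 < m)%N -> (0 < tau3 m)%N.
Proof. by move=> m0; apply: leq_trans (tau_le_tau3 m0); apply: tau_gt0. Qed.

Lemma divn_dvd_gt0 (h m : nat) : (0 < m)%N -> (h %| m)%N -> (0 < m %/ h)%N.
Proof. by move=> m0 hm; rewrite divn_gt0 ?(dvdn_gt0 m0 hm) // dvdn_leq. Qed.

Lemma wt_conv_le_tau3 (R : realType) (z m : nat) : (0 < m)%N ->
  (\sum_(h <- divisors m) wt z (m %/ h) <= tau3 m)%N.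
Proof.
move=> m0; apply: leq_trans (sum_tau_le_tau3 m0).
rewrite big_seq [X in (_ <= X)%N]big_seq; apply: leq_sum => h; rewrite -dvdn_divisors // => hm.
by apply: (wt_le_tau R); apply: divn_dvd_gt0.
Qed.

Lemma wt_mono (z b n : nat) : (z <= b)%N -> (wt z n <= wt b n)%N.
Proof.
move=> zb; rewrite /wt leq_exp2l //; apply: uniq_leq_size; rewrite ?small_primes_uniq //.
by move=> p; rewrite !mem_filter => /andP[pz ->]; rewrite (leq_trans pz).
Qed.

(** Induction by splitting off the full power p^e of the least prime. If p <= b, the local factor is
    at most tau3 (p^e), since [wt] is at most [tau]. If p > b, the only b-smooth divisor of p^e is 1
    and the weight there is 1. With b the integer part of Px/Q the right side is the truncated tau3
    of the theorem. *)
Lemma wt_conv_le_trunc (R : realType) (b m : nat) : (0 < m)%N ->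
  (\sum_(h <- divisors m | smooth b h) wt b (m %/ h) <=
   \prod_(p <- primes m) if p <= b then tau3 (p ^ logn p m) else 1)%N.
Proof.
elim/ltn_ind: m => m IH m0; case: (ltnP 1 m) => m1; last first.
  have -> : m = 1%N by apply/eqP; rewrite eqn_leq m1.
  by rewrite /divisors /= big_cons !big_nil.
have pp := pdiv_prime m1; set p := pdiv m in pp; have p0 := prime_gt0 pp.
have [m' pm' mE] := pfactor_coprime pp m0; set e := logn p m in mE.
have e0 : (0 < e)%N by rewrite /e logn_gt0 mem_primes pp m0 pdiv_dvd.
have pe0 : (0 < p ^ e)%N by rewrite expn_gt0 p0.
have m'0 : (0 < m')%N by move: m0; rewrite mE muln_gt0 => /andP[].
have m'm : (m' < m)%N.
  by rewrite mE ltn_Pmulr // -(expn0 p) ltn_exp2l // prime_gt1.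
have cop : coprime (p ^ e) m' by rewrite coprimeXl.
have npm' : p \notin primes m' by rewrite mem_primes m'0 pp /= -prime_coprime.
have permp : perm_eq (primes m) (p :: primes m').
  apply: uniq_perm; rewrite /= ?primes_uniq ?npm' // => q.
  rewrite mE primesM // primesX // (primes_prime pp).
  by rewrite mem_seq1 in_cons orbC.
rewrite (perm_big _ permp) big_cons /=.
have -> : (\prod_(q <- primes m') (if q <= b then tau3 (q ^ logn q m) else 1) =
  \prod_(q <- primes m') (if q <= b then tau3 (q ^ logn q m') else 1))%N.
  rewrite big_seq [RHS]big_seq; apply: eq_bigr => q qm'.
  have qp : prime q by move: qm'; rewrite mem_primes => /andP[].
  rewrite mE lognM // lognX (logn_prime _ pp).
  have -> : (q == p) = false by apply: contraNF npm' => /eqP <-.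
  by rewrite muln0 addn0.
have -> : (\sum_(h <- divisors m | smooth b h) wt b (m %/ h) =
   \sum_(h1 <- divisors (p ^ e)) \sum_(h2 <- divisors m') if smooth b (h1 * h2) then wt b (m %/ (h1 * h2)) else 0)%N.
  rewrite -(big_divisors_coprime (fun h => if smooth b h then wt b (m %/ h) else 0%N) pe0 m'0 cop).
  by rewrite [(p ^ e * m')%N]mulnC -mE big_mkcond.
apply: (@leq_trans ((\sum_(h1 <- divisors (p ^ e) | smooth b h1) wt b (p ^ e %/ h1)) *
   (\sum_(h2 <- divisors m' | smooth b h2) wt b (m' %/ h2)))%N).
  rewrite big_distrl /= [X in (_ <= X)%N]big_mkcond big_seq [X in (_ <= X)%N]big_seq.
  apply: leq_sum => h1; rewrite -dvdn_divisors // => h1p.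
  have h10 := dvdn_gt0 pe0 h1p.
  case: ifP => sh1; last first.
    rewrite big_seq big1 // => h2; rewrite -dvdn_divisors // => h2m.
    by rewrite smoothM ?(dvdn_gt0 m'0 h2m) // sh1.
  rewrite [X in (_ <= _ * X)%N]big_mkcond big_distrr /=.
  rewrite big_seq [X in (_ <= X)%N]big_seq; apply: leq_sum => h2; rewrite -dvdn_divisors // => h2m.
  have h20 := dvdn_gt0 m'0 h2m.
  rewrite smoothM // sh1 /=; case: ifP => // _.
  have -> : (m %/ (h1 * h2) = (p ^ e %/ h1) * (m' %/ h2))%N.
    have -> : m = ((p ^ e %/ h1 * (m' %/ h2)) * (h1 * h2))%N.
      by rewrite mulnACA !divnK // mulnC.
    by rewrite mulnK // muln_gt0 h10.
  by apply: wtM_le; apply: divn_dvd_gt0.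
apply: leq_mul; last exact: IH.
case: (leqP p b) => pb.
  apply: leq_trans (wt_conv_le_tau3 R b pe0); rewrite big_mkcond; apply: leq_sum => h _.
  by case: ifP.
rewrite big_seq_cond (eq_bigr (fun=> 1%N)) => [|h /andP[]]; last first.
  rewrite -dvdn_divisors // => hp _; rewrite /wt.
  have -> // : small_primes b (p ^ e %/ h) = [::].
  apply/eqP; rewrite -size_eq0 size_filter -leqn0 leqNgt -has_count; apply/hasPn => q.
  rewrite mem_primes => /and3P[qp _ /dvdn_trans]/(_ _ (dvdn_div hp)).
  by rewrite Euclid_dvdX // e0 andbT dvdn_prime2 // => /eqP->; rewrite -ltnNge.
rewrite sum1_count -size_filter; apply: (@uniq_leq_size _ _ [:: 1%N]).
  by rewrite filter_uniq ?divisors_uniq.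
move=> h; rewrite mem_filter inE -andbA => /and3P[].
rewrite -dvdn_divisors // => /dvdn_pfactor - /(_ pp)[[|k] ke ->] //.
by rewrite /smooth primesX // primes_prime //= leqNgt pb.
Qed.

Lemma tau3_trunc_nat (R : realType) (y : R) (n : nat) : 0 <= y ->
  tau3_trunc y n = (\prod_(p <- primes n) if p <= Num.truncn y then tau3 (p ^ logn p n) else 1)%N.
Proof. by move=> y0; apply: eq_bigr => p _; rewrite truncn_ge_nat. Qed.

Lemma tau3_trunc_gt0 (R : realType) (y : R) (n : nat) : (0 < n)%N -> (0 < tau3_trunc y n)%N.
Proof.
move=> n0; rewrite /tau3_trunc big_seq; elim/big_ind: _ => // [a b a0 b0|p].
  by rewrite muln_gt0 a0.
by rewrite mem_primes => /and3P[pp _ _]; case: ifP => // _; rewrite tau3_gt0 // expn_gt0 prime_gt0.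
Qed.

(** * Smooth part and rough cofactor of an integer *)

Definition low_primes (z : nat) : nat_pred := [pred p | (p <= z)%N].
Definition smpart (z n : nat) : nat := n`_(low_primes z).
Definition roughn (z n : nat) : bool := all (fun p => z < p)%N (primes n).

Lemma smpart_gt0 z n : (0 < smpart z n)%N. Proof. exact: part_gt0. Qed.

Lemma smpart_dvd z n : (smpart z n %| n)%N. Proof. exact: dvdn_part. Qed.

Lemma primes_smpart z n : primes (smpart z n) = small_primes z n.
Proof. by rewrite /smpart primes_part. Qed.

Lemma smpart_smooth z n : smooth z (smpart z n).
Proof. by rewrite /smooth primes_smpart filter_all. Qed.

Lemma small_primes_smpart z n : small_primes z (smpart z n) = small_primes z n.
Proof. by rewrite {1}/small_primes primes_smpart /small_primes filter_id. Qed.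

Lemma smpartM_eq z u v : (0 < u)%N -> (0 < v)%N -> smooth z u ->
  (smpart z (u * v) == u) = roughn z v.
Proof.
move=> u0 v0 su; rewrite /smpart partnM // part_pnat_id; last first.
  by rewrite /pnat u0 /=; apply: sub_all su.
rewrite -{2}[u]muln1 eqn_pmul2l // partn_eq1 // /pnat v0 /=.
by apply: eq_all => p; rewrite !inE -ltnNge.
Qed.

Lemma sum_smooth_rough (V : pzRingType) (z N : nat) (F : nat -> V) :
  \sum_(1 <= n < N.+1) F n =
  \sum_(1 <= u < N.+1) (smooth z u)%:R *
    \sum_(1 <= v < N.+1) ((u * v <= N) && roughn z v)%N%:R * F (u * v)%N.
Proof.
transitivity (\sum_(1 <= n < N.+1) \sum_(1 <= u < N.+1) (u == smpart z n)%:R * F n).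
  apply: eq_big_nat => n /andP[n0 nN]; rewrite sum_pick smpart_gt0 /=.
  by rewrite (leq_trans (dvdn_leq n0 (smpart_dvd z n))) ?mul1r.
rewrite exchange_big_nat /=; apply: eq_big_nat => u /andP[u0 uN].
case: (boolP (smooth z u)) => su; last first.
  rewrite mul0r big1 // => n _; case: eqP => [uE|]; last by rewrite mul0r.
  by rewrite uE smpart_smooth in su.
rewrite mul1r.
transitivity (\sum_(1 <= n < N.+1) (u %| n)%N%:R * ((u == smpart z n)%:R * F n)).
  apply: eq_bigr => n _; case: (eqVneq u (smpart z n)) => [->|_]; last by rewrite !mul0r mulr0.
  by rewrite smpart_dvd !mul1r.
rewrite sum_multiples //; apply: eq_big_nat => v /andP[v0 _].
rewrite eq_sym smpartM_eq // mulrA -mulnb natrM //.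
Qed.

(** The least divisor of u exceeding X works: cancelling one of its primes, which is at most P,
    brings it down to at most X. *)
Lemma smooth_divisor_between (R : realType) (z u : nat) (P X : R) : (0 < u)%N -> smooth z u ->
  z%:R <= P -> 1 <= X -> X < u%:R -> exists d : nat, [/\ (d %| u)%N, X < d%:R & d%:R <= X * P].
Proof.
move=> u0 su zP X1 Xu.
have ex : exists d : nat, (d %| u)%N && (X < d%:R) by exists u; rewrite dvdnn.
case: (ex_minnP ex) => d /andP[du Xd] dmin; exists d; split=> //.
have d0 := dvdn_gt0 u0 du.
have d1 : (1 < d)%N by rewrite -(ltr_nat R); apply: le_lt_trans Xd.
have pp := pdiv_prime d1; set p := pdiv d in pp; have pd : (p %| d)%N := pdiv_dvd d.
have p0 := prime_gt0 pp.
have pz : (p <= z)%N.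
  by apply: (allP su); rewrite mem_primes pp u0 (dvdn_trans pd du).
have : ~~ ((d %/ p %| u)%N && (X < (d %/ p)%N%:R)).
  apply/negP => /dmin; rewrite leqNgt ltn_Pdiv // prime_gt1 //.
rewrite (dvdn_trans _ du) ?dvdn_div //= -leNgt => dX.
have -> : (d%:R : R) = (d %/ p)%N%:R * p%:R by rewrite -natrM divnK.
apply: ler_pM => //; apply: le_trans zP; by rewrite ler_nat.
Qed.

(** * Residue classes and the variance as a quadratic form *)

Lemma eqmod_shift (q a b : nat) : (a <= b)%N -> (a == b %[mod q]) = (q %| b - a)%N.
Proof. by move=> ab; rewrite eq_sym eqn_mod_dvd. Qed.

Lemma sum_residue (V : pzRingType) (q n : nat) (F : nat -> V) : (0 < q)%N ->
  (forall c c', c = c' %[mod q] -> F c = F c') ->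
  \sum_(1 <= c < q.+1) (c == n %[mod q])%:R * F c = F n.
Proof.
move=> q0 per; pose c0 := if (n %% q == 0)%N then q else (n %% q)%N.
have c0P : (1 <= c0 <= q)%N.
  rewrite /c0; case: eqP => [_|/eqP h]; first by rewrite q0 leqnn.
  by rewrite lt0n h /= ltnW // ltn_pmod.
have c0n : c0 = n %[mod q].
  by rewrite /c0; case: eqP => [h|_]; [rewrite modnn h | rewrite modn_mod].
transitivity (\sum_(1 <= c < q.+1) (c == c0)%:R * F c); last first.
  by rewrite sum_pick c0P mul1r (per _ _ c0n).
apply: eq_big_nat => c /andP[c1 cq]; congr (_%:R * _); congr nat_of_bool.
apply/idP/eqP => [/eqP cn|->]; last by rewrite c0n eqxx.
have {cn} : c = c0 %[mod q] by rewrite c0n.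
have rep d : (1 <= d <= q)%N -> (d %% q)%N = if d == q then 0%N else d.
  by move=> /andP[d1 dq]; case: eqP => [->|/eqP h]; rewrite ?modnn // modn_small // ltn_neqAle h.
rewrite !rep ?c1 //; case: eqP => [->|_]; case: eqP => [->|_] // h.
  by move: c0P; rewrite -h.
by move: c1; rewrite h.
Qed.

Lemma gcdn_mod_eq (q c c' : nat) : c = c' %[mod q] -> gcdn c q = gcdn c' q.
Proof. by move=> h; rewrite -gcdn_modl h gcdn_modl. Qed.

Lemma count_gcd (V : pzRingType) (q h : nat) : (0 < q)%N -> (h %| q)%N ->
  \sum_(1 <= c < q.+1) (gcdn c q == h)%:R = (totient (q %/ h))%:R :> V.
Proof.
move=> q0 hq; have h0 := dvdn_gt0 q0 hq; set k := (q %/ h)%N.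
have qE : q = (h * k)%N by rewrite mulnC divnK.
have k0 : (0 < k)%N by move: q0; rewrite qE muln_gt0 => /andP[].
transitivity (\sum_(1 <= c < q.+1) (h %| c)%N%:R * ((gcdn c q == h)%:R : V)).
  apply: eq_bigr => c _; case: eqP => [gE|_]; last by rewrite mulr0.
  by rewrite -gE dvdn_gcdl mulr1.
rewrite sum_multiples //.
transitivity (\sum_(1 <= i < q.+1) (i <= k)%N%:R * ((coprime i k)%:R : V)).
  apply: eq_bigr => i _; rewrite {1 2}qE leq_pmul2l // -muln_gcdr.
  by rewrite -{2}[h]muln1 eqn_pmul2l.
rewrite sum_cut ?leq_div //; rewrite totient_count_coprime -natr_sum; congr (_%:R).
rewrite (big_nat_recr k) //= (@big_ltn _ _ _ 0) //=.
rewrite addnC; congr (_ + _)%N.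
  by rewrite /coprime gcdnn gcdn0.
by apply: eq_bigr => i _; rewrite coprime_sym.
Qed.

Section ProgressionVariance.
Variable R : realType.

(** The weight that n carries in the average [aver] at the class of m. *)
Definition rho (q m n : nat) : R :=
  (gcdn m q == gcdn n q)%:R * invphi R (q %/ gcdn m q).

Definition devker (q m n : nat) : R := (m == n %[mod q])%:R - rho q m n.

Lemma rho_sym q m n : rho q m n = rho q n m.
Proof. by rewrite /rho eq_sym; case: eqP => [->|_]; rewrite ?mul0r. Qed.

Lemma rho_modl q c c' n : c = c' %[mod q] -> rho q c n = rho q c' n.
Proof. by move=> h; rewrite /rho (gcdn_mod_eq h). Qed.

Lemma devker_modl q c c' n : c = c' %[mod q] -> devker q c n = devker q c' n.
Proof. by move=> h; rewrite /devker (rho_modl _ h) h. Qed.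

(** On functions modulo q the congruence is the identity and [rho] the orthogonal projection onto
    functions of gcd (c, q), so their difference is a symmetric projection. Hence the sum of squares
    over classes is a quadratic form whose kernel is [devker] itself. *)
Lemma devker_idem (q m n : nat) : (0 < q)%N ->
  \sum_(1 <= c < q.+1) devker q c m * devker q c n = devker q m n.
Proof.
move=> q0.
transitivity (\sum_(1 <= c < q.+1) (c == m %[mod q])%:R * devker q c n
  - \sum_(1 <= c < q.+1) (c == n %[mod q])%:R * rho q c m
  + \sum_(1 <= c < q.+1) rho q c m * rho q c n).
  by rewrite -sumrB -big_split /=; apply: eq_bigr => c _; rewrite /devker; ring.
rewrite (sum_residue _ q0 (F := fun c => devker q c n)); last first.
  by move=> c c'; apply: devker_modl.
rewrite (sum_residue _ q0 (F := fun c => rho q c m)); last by move=> c c'; apply: rho_modl.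
have -> : \sum_(1 <= c < q.+1) rho q c m * rho q c n = rho q m n.
  transitivity (\sum_(1 <= c < q.+1) (gcdn c q == gcdn m q)%:R *
     (rho q m n * invphi R (q %/ gcdn m q))).
    apply: eq_bigr => c _; rewrite /rho; case: eqP => [->|_]; rewrite ?mul0r //.
    by rewrite !mul1r mulrC.
  rewrite -mulr_suml count_gcd ?dvdn_gcdr // mulrCA /invphi mulfV ?mulr1 //.
  rewrite pnatr_eq0 -lt0n totient_gt0 divn_gt0 ?gcdn_gt0 ?q0 ?orbT //.
  by apply: dvdn_leq => //; apply: dvdn_gcdr.
by rewrite (rho_sym q n m); ring.
Qed.

Definition rprog (b : nat -> R) (z q c : nat) : R :=
  \sum_(1 <= n < z.+1) (n == c %[mod q])%:R * b n.

Definition raver (b : nat -> R) (z q h : nat) : R :=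
  invphi R (q %/ h) * \sum_(1 <= c < q.+1 | gcdn c q == h) rprog b z q c.

Lemma raver_rho (b : nat -> R) (z q c : nat) : (0 < q)%N ->
  raver b z q (gcdn c q) = \sum_(1 <= n < z.+1) rho q c n * b n.
Proof.
move=> q0; rewrite /raver sum_indic.
rewrite (eq_bigr (fun d => \sum_(1 <= n < z.+1) (d == n %[mod q])%:R * ((gcdn d q == gcdn c q)%:R * b n))); last first.
  by move=> d _; rewrite /rprog mulr_sumr; apply: eq_bigr => n _; rewrite [(n %% q == _)%N]eq_sym mulrCA.
rewrite exchange_big_nat /= mulr_sumr; apply: eq_bigr => n _.
rewrite (sum_residue _ q0 (F := fun d => (gcdn d q == gcdn c q)%:R * b n)); last first.
  by move=> d d' /gcdn_mod_eq->.
by rewrite /rho eq_sym mulrA [_ * (_%:R)]mulrC.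
Qed.

Lemma rprog_dev (b : nat -> R) (z q c : nat) : (0 < q)%N ->
  rprog b z q c - raver b z q (gcdn c q) = \sum_(1 <= n < z.+1) devker q c n * b n.
Proof.
move=> q0; rewrite raver_rho // /rprog -sumrB; apply: eq_bigr => n _.
by rewrite /devker [in RHS]eq_sym mulrBl.
Qed.

Lemma sum_sqr_dev (b : nat -> R) (z q : nat) : (0 < q)%N ->
  \sum_(1 <= c < q.+1) (rprog b z q c - raver b z q (gcdn c q)) ^+ 2 =
  \sum_(1 <= m < z.+1) \sum_(1 <= n < z.+1) b m * b n * devker q m n.
Proof.
move=> q0.
rewrite (eq_bigr (fun c => \sum_(1 <= m < z.+1) \sum_(1 <= n < z.+1)
   (b m * b n) * (devker q c m * devker q c n))); last first.
  move=> c _; rewrite rprog_dev // expr2 mulr_suml; apply: eq_bigr => m _.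
  by rewrite mulr_sumr; apply: eq_bigr => n _; ring.
rewrite exchange_big_nat /=; apply: eq_bigr => m _.
rewrite exchange_big_nat /=; apply: eq_bigr => n _.
by rewrite -mulr_sumr devker_idem.
Qed.

Definition rV (b : nat -> R) (N : nat) (Q : R) : R :=
  \sum_(1 <= q < (Num.truncn Q).+1 | Q / 2 < q%:R)
    \sum_(1 <= c < q.+1) (rprog b N q c - raver b N q (gcdn c q)) ^+ 2.

Definition ndist (m n : nat) : nat := (m - n + (n - m))%N.

Lemma ndistC m n : ndist m n = ndist n m. Proof. by rewrite /ndist addnC. Qed.

Lemma eqmod_ndist (q m n : nat) : (m == n %[mod q]) = (q %| ndist m n)%N.
Proof.
rewrite /ndist; case: (leqP m n) => mn.
  by rewrite (eqnP mn) add0n eqmod_shift.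
have nm := ltnW mn; rewrite (eqnP nm) addn0 eq_sym eqmod_shift //.
Qed.

Lemma dvdn_ndist (h m n : nat) : ndist (h * m) (h * n) = (h * ndist m n)%N.
Proof. by rewrite /ndist mulnDr !mulnBr. Qed.

Lemma convex_interval (N : nat) (J : pred nat) :
  (forall a b c, (a <= b <= c)%N -> J a -> J c -> J b) ->
  (forall n, (1 <= n <= N)%N -> ~~ J n) \/
  exists s t, [/\ (1 <= s <= t)%N, (t <= N)%N, J s, J t &
    forall n, (1 <= n <= N)%N -> J n = (s <= n <= t)%N].
Proof.
move=> cJ; case: (boolP (has J (index_iota 1 N.+1))) => [/hasP[n0]|/hasPn h]; last first.
  by left=> n hn; apply: h; rewrite mem_index_iota ltnS.
rewrite mem_index_iota ltnS => n0N Jn0; right.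
pose J' n := J n && (1 <= n <= N)%N.
have ex : exists n, J' n by exists n0; rewrite /J' Jn0.
have ub n : J' n -> (n <= N)%N by case/and3P.
case: (ex_minnP ex) => s /and3P[Js s1 sN] smin.
case: (ex_maxnP ex ub) => t /and3P[Jt t1 tN] tmax.
exists s, t; split=> //; first by rewrite s1 smin // /J' Jt t1.
move=> n nN; apply/idP/idP => [Jn|/cJ]; last by apply.
by rewrite smin ?tmax // /J' Jn.
Qed.

(** A convex set of integers is an interval, hence a difference of two initial segments. In this way
    the maximum over z <= x in the Progressions Condition controls windows. *)
Lemma sum_convex_le (N : nat) (J : pred nat) (F : nat -> R) (G : R) :
  (forall a b c, (a <= b <= c)%N -> J a -> J c -> J b) ->
  (forall z, (z <= N)%N -> `|\sum_(1 <= n < z.+1) F n| <= G) ->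
  `|\sum_(1 <= n < N.+1) (J n)%:R * F n| <= 2 * G.
Proof.
move=> cJ hG; have G0 : 0 <= G by apply: le_trans (hG 0%N _) => //; rewrite normr_ge0.
case: (convex_interval N cJ) => [h|[s [t [/andP[s1 st] tN _ _ h]]]].
  rewrite big_nat big1 ?normr0; first by lra.
  by move=> n hn; rewrite (negbTE (h _ _)) ?mul0r.
have -> : \sum_(1 <= n < N.+1) (J n)%:R * F n =
   \sum_(1 <= n < t.+1) F n - \sum_(1 <= n < s.-1.+1) F n.
  rewrite prednK // (@big_cat_nat _ _ _ t.+1 _ N.+1) //=.
  rewrite [X in _ + X]big_nat [X in _ + X]big1 ?addr0; last first.
    move=> n /andP[tn nN]; rewrite h; last by rewrite (leq_ltn_trans _ tn).
    by rewrite [(n <= t)%N]leqNgt tn andbF mul0r.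
  rewrite (@big_cat_nat _ _ _ s _ t.+1) //=; last by rewrite leqW.
  rewrite [X in X + _]big_nat [X in X + _]big1 ?add0r; last first.
    move=> n /andP[n1 ns]; rewrite h; last by rewrite n1 (leq_trans (ltnW ns)) // (leq_trans st).
    by rewrite leqNgt ns mul0r.
  rewrite [X in _ = X - _](@big_cat_nat _ _ _ s _ t.+1) //=; last by rewrite leqW.
  rewrite addrC addrK; apply: eq_big_nat => n /andP[sn nt].
  rewrite h; last by rewrite (leq_trans s1 sn) (leq_trans _ tN).
  by rewrite sn -ltnS nt mul1r.
apply: le_trans (ler_normB _ _) _; have := hG t tN.
have : (s.-1 <= N)%N by rewrite (leq_trans (leq_pred _)) // (leq_trans st).
by move=> /hG; lra.
Qed.
End ProgressionVariance.

(** * Divisor switching and reduction to a bilinear form *)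

Lemma gcdn_charact (h m r : nat) : (0 < r)%N -> (0 < h)%N ->
  [&& (h %| r)%N, (h %| m)%N & coprime (m %/ h) (r %/ h)] = (h == gcdn m r).
Proof.
move=> r0 h0; apply/and3P/eqP => [[hr hm cop]|->]; last first.
  have g0 : (0 < gcdn m r)%N by rewrite gcdn_gt0 r0 orbT.
  split; rewrite ?dvdn_gcdl ?dvdn_gcdr //.
  rewrite /coprime -(eqn_pmul2r g0) muln_gcdl mul1n.
  by rewrite !divnK ?dvdn_gcdl ?dvdn_gcdr.
rewrite -{1}(divnK hm) -{1}(divnK hr) -muln_gcdl.
by rewrite (eqP cop) mul1n.
Qed.

Section VarianceForm.
Variable R : realType.
Variables (N z Yn : nat) (Q P : R).
Let M := Num.truncn Q.
Hypotheses (N0 : (0 < N)%N) (Q2 : 2 <= Q) (MN : (M <= N)%N).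
Hypotheses (hY : 2 * N%:R / Q < Yn.+1%:R) (YM : (Yn <= M)%N).
Hypotheses (P3 : 3 <= P) (Pz : P < z.+1%:R).

Let Q0 : 0 < Q. Proof. by have := Q2; lra. Qed.
Let P0 : 0 < P. Proof. by have := P3; lra. Qed.
Let lP : 0 < ln P. Proof. by rewrite ln_gt0 //; have := P3; lra. Qed.

(** The scale of the complementary divisor: if |m - n| = q r, then Q/2 < q <= Q says exactly that r
    < [offd m n] <= 2 r. *)
Definition offd (m n : nat) : R := 2 * (ndist m n)%:R / Q.

(** The integer endpoint M + 1 turns the closed condition q <= Q into the strict one of [dyad]. *)
Lemma inQ_dyad (q : nat) : dyad (M.+1%:R : R) q = (Q / 2 < q%:R) && (q%:R <= Q).
Proof.
rewrite /dyad ltr_nat ltnS truncn_ge_nat ?(ltW Q0) // andbC; congr (_ && _).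
rewrite -natrM ler_nat truncn_lt_nat ?(ltW Q0) // natrM.
by rewrite ltr_pdivrMr // mulrC.
Qed.

Lemma offd_dyad (m n r : nat) : dyad (offd m n) r =
  (Q * r%:R / 2 < (ndist m n)%:R) && ((ndist m n)%:R <= Q * r%:R).
Proof.
rewrite /dyad /offd ltr_pdivlMr // [X in _ && X]ler_pdivrMr //; congr (_ && _).
  by rewrite ltr_pdivrMr // [r%:R * _]mulrC [2 * _]mulrC.
by rewrite -mulrA ler_pM2l // mulrC.
Qed.

Lemma offd_le (m n : nat) : (m <= N)%N -> (n <= N)%N -> offd m n < Yn.+1%:R.
Proof.
move=> mN nN; apply: le_lt_trans hY; apply: ler_wpM2r; first by rewrite invr_ge0 ltW.
by apply: ler_wpM2l => //; rewrite ler_nat /ndist; clear - mN nN; lia.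
Qed.

Lemma offd_leM (m n : nat) : (m <= N)%N -> (n <= N)%N -> offd m n <= M.+1%:R.
Proof. by move=> mN nN; apply: ltW; apply: lt_le_trans (offd_le mN nN) _; rewrite ler_nat ltnS. Qed.

Definition cntQ : R := \sum_(1 <= q < N.+1) (dyad (M.+1%:R : R) q)%:R.

Lemma cntQ_approx : `|cntQ - Q / 2| <= 1.
Proof.
pose h := Num.truncn (Q / 2).
have Q2' : 0 <= Q / 2 by have := Q0; lra.
have hM : (h <= M)%N by apply: le_truncn; have := Q0; lra.
have -> : cntQ = M%:R - h%:R.
  rewrite /cntQ.
  transitivity (\sum_(1 <= q < N.+1) (q <= M)%N%:R * (1 : R) - \sum_(1 <= q < N.+1) (q <= h)%N%:R * (1 : R)).
    rewrite -sumrB; apply: eq_bigr => q _; rewrite inQ_dyad !mulr1.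
    rewrite -truncn_ge_nat ?(ltW Q0) // -/M -truncn_lt_nat // -/h.
    case: (ltnP h q) => hq /=; first by rewrite subr0.
    by rewrite (leq_trans hq hM) subrr.
  by rewrite !sum_cut ?(leq_trans hM) // !big_const_nat !iter_addr_0 !subn1.
have /andP[h1 h2] := truncn_itv Q2'; have /andP[M1 M2] := truncn_itv (ltW Q0).
move: h1 h2 M1 M2; rewrite -/h -/M -[h.+1%:R]natr1 -[M.+1%:R]natr1 => h1 h2 M1 M2.
by rewrite ler_norml; apply/andP; split; lra.
Qed.

Lemma switch_divisor (m n : nat) : (0 < m <= N)%N -> (0 < n <= N)%N ->
  \sum_(1 <= q < N.+1) (dyad (M.+1%:R : R) q)%:R * (m == n %[mod q])%:R =
  (m == n)%:R * cntQ + \sum_(1 <= r < N.+1) (dyad (offd m n) r)%:R * (m == n %[mod r])%:R :> R.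
Proof.
move=> mN nN; case: (eqVneq m n) => [<-|mn].
  rewrite mul1r [X in _ + X]big1 ?addr0 => [|r _]; last first.
    have -> : offd m m = 0 by rewrite /offd /ndist subnn mulr0 mul0r.
    by rewrite /dyad ltNge ler0n mul0r.
  by apply: eq_bigr => q _; rewrite eqxx mulr1.
rewrite mul0r add0r; set D := ndist m n.
have D0 : (0 < D <= N)%N by move: mn mN nN; clear; rewrite /D /ndist; lia.
have D0' : (0 < D)%N by case/andP: D0.
transitivity (\sum_(1 <= q < N.+1) (q %| D)%N%:R * ((dyad (M.+1%:R : R) q)%:R : R)).
  by apply: eq_bigr => q _; rewrite eqmod_ndist mulrC.
rewrite (sum_cofactor (fun q => (dyad (M.+1%:R : R) q)%:R : R) D0).
apply: eq_big_nat => r /andP[r0 _]; rewrite eqmod_ndist mulrC -/D.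
case: (boolP (r %| D)%N) => rD; rewrite ?mulr0 // !mulr1 inQ_dyad offd_dyad -/D.
have r0' : 0 < (r%:R : R) by rewrite ltr0n.
have -> : (D%:R : R) = (D %/ r)%N%:R * r%:R by rewrite -natrM divnK.
by rewrite mulrAC ltr_pM2r // ler_pM2r.
Qed.

Definition rsum (E : R) (m n : nat) : R := \sum_(1 <= r < N.+1) (dyad E r)%:R * rho R r m n.

(* Divisor switching: q is replaced by r = |m - n| / q off the diagonal. *)
Lemma rV_split (b : nat -> R) :
  rV b N Q = cntQ * \sum_(1 <= n < N.+1) b n ^+ 2
   + \sum_(1 <= r < N.+1) \sum_(1 <= m < N.+1) b m *
       \sum_(1 <= n < N.+1) (dyad (offd m n) r)%:R * (devker R r m n * b n)
   + \sum_(1 <= m < N.+1) \sum_(1 <= n < N.+1) b m * b n *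
       (rsum (offd m n) m n - rsum M.+1%:R m n).
Proof.
transitivity (\sum_(1 <= q < N.+1) (dyad (M.+1%:R : R) q)%:R *
   \sum_(1 <= m < N.+1) \sum_(1 <= n < N.+1) b m * b n * devker R q m n).
  rewrite /rV sum_indic.
  rewrite -(sum_cut (fun q => (Q / 2 < q%:R)%R%:R * \sum_(1 <= c < q.+1) (rprog b N q c - raver b N q (gcdn c q)) ^+ 2) MN).
  apply: eq_big_nat => q /andP[q0 _]; rewrite sum_sqr_dev // inQ_dyad mulrA; congr (_ * _).
  by rewrite -indicM andbC truncn_ge_nat ?(ltW Q0).
transitivity (\sum_(1 <= m < N.+1) \sum_(1 <= n < N.+1) b m * b n *
   \sum_(1 <= q < N.+1) (dyad (M.+1%:R : R) q)%:R * devker R q m n).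
  rewrite (eq_bigr (fun q => \sum_(1 <= m < N.+1) \sum_(1 <= n < N.+1)
     b m * b n * ((dyad (M.+1%:R : R) q)%:R * devker R q m n))); last first.
    move=> q _; rewrite mulr_sumr; apply: eq_bigr => m _; rewrite mulr_sumr.
    by apply: eq_bigr => n _; ring.
  rewrite exchange_big_nat /=; apply: eq_bigr => m _.
  rewrite exchange_big_nat /=; apply: eq_bigr => n _.
  by rewrite -mulr_sumr.
have -> : \sum_(1 <= r < N.+1) \sum_(1 <= m < N.+1) b m *
       \sum_(1 <= n < N.+1) (dyad (offd m n) r)%:R * (devker R r m n * b n) =
   \sum_(1 <= m < N.+1) \sum_(1 <= n < N.+1) b m * b n *
     \sum_(1 <= r < N.+1) (dyad (offd m n) r)%:R * devker R r m n.
  rewrite exchange_big_nat /=; apply: eq_bigr => m _.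
  rewrite -mulr_sumr exchange_big_nat /= mulr_sumr; apply: eq_bigr => n _.
  by rewrite !mulr_sumr; apply: eq_bigr => r _; ring.
have -> : cntQ * \sum_(1 <= n < N.+1) b n ^+ 2 =
   \sum_(1 <= m < N.+1) \sum_(1 <= n < N.+1) b m * b n * ((m == n)%:R * cntQ).
  rewrite mulr_sumr; apply: eq_big_nat => m hm.
  rewrite (eq_bigr (fun n => (n == m)%:R * (b m * b n * cntQ))); last first.
    by move=> n _; rewrite eq_sym; ring.
  by rewrite sum_pick hm mul1r; ring.
rewrite -!big_split /=; apply: eq_big_nat => m hm.
rewrite -!big_split /=; apply: eq_big_nat => n hn.
rewrite -!mulrDr; congr (_ * _).
have := switch_divisor hm hn; set X := _ * cntQ => E.
rewrite /rsum [in RHS]addrA -!addrA.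
transitivity (\sum_(1 <= q < N.+1) (dyad (M.+1%:R : R) q)%:R * (m == n %[mod q])%:R
   - \sum_(1 <= q < N.+1) (dyad (M.+1%:R : R) q)%:R * rho R q m n).
  by rewrite -sumrB; apply: eq_bigr => q _; rewrite /devker mulrBr.
rewrite E -addrA; congr (_ + _); rewrite !addrA; congr (_ - _).
by rewrite -big_split /=; apply: eq_bigr => r _; rewrite /devker; ring.
Qed.

(** For fixed m and r the admissible n form two intervals, one on each side of m, and each is a
    difference of two initial segments; hence the 4. No r > Yn occurs because 2|m - n|/Q < Yn +
    1. *)
Lemma prog_error (b s : nat -> R) (G : nat -> nat -> R) :
  (forall n, `|b n| <= s n) ->
  (forall r m y, (0 < r)%N -> (y <= N)%N -> `|\sum_(1 <= n < y.+1) devker R r m n * b n| <= G r m) ->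
  `|\sum_(1 <= r < N.+1) \sum_(1 <= m < N.+1) b m *
       \sum_(1 <= n < N.+1) (dyad (offd m n) r)%:R * (devker R r m n * b n)| <=
  4 * \sum_(1 <= r < Yn.+1) \sum_(1 <= m < N.+1) s m * G r m.
Proof.
move=> bs hG; have s0 n : 0 <= s n by apply: le_trans (bs n).
have YN : (Yn <= N)%N by apply: leq_trans MN.
rewrite mulr_sumr -(sum_cut _ YN); apply: norm_sum_le_nat => r /andP[r0 _].
case: (leqP r Yn) => rY; last first.
  rewrite mul0r big1_seq ?normr0 // => m /andP[_]; rewrite mem_index_iota => /andP[_ mN].
  rewrite big1_seq ?mulr0 // => n /andP[_]; rewrite mem_index_iota => /andP[_ nN].
  rewrite /dyad (_ : (r%:R < _) = false) ?mul0r //; apply/negbTE; rewrite -leNgt.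
  by apply: ltW; apply: lt_le_trans (offd_le mN nN) _; rewrite ler_nat.
rewrite mul1r mulr_sumr; apply: norm_sum_le_nat => m /andP[m0 mN].
rewrite normrM [leRHS]mulrCA ler_pM ?normr_ge0 //.
pose J1 n : bool := (m <= n)%N && dyad (offd m n) r.
pose J2 n : bool := (n < m)%N && dyad (offd m n) r.
have -> : \sum_(1 <= n < N.+1) (dyad (offd m n) r)%:R * (devker R r m n * b n) =
   \sum_(1 <= n < N.+1) (J1 n)%:R * (devker R r m n * b n) +
   \sum_(1 <= n < N.+1) (J2 n)%:R * (devker R r m n * b n).
  rewrite -big_split /=; apply: eq_bigr => n _; rewrite -mulrDl; congr (_ * _).
  by rewrite /J1 /J2; case: leqP; rewrite ?addr0 ?add0r.
have c1 : forall a b c, (a <= b <= c)%N -> J1 a -> J1 c -> J1 b.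
  move=> a c d /andP[ac cd] /andP[ma]; rewrite offd_dyad => /andP[a1 a2] /andP[md].
  rewrite offd_dyad => /andP[d1 d2]; rewrite /J1 (leq_trans ma ac) offd_dyad /=.
  have l1 : ((ndist m a)%:R : R) <= (ndist m c)%:R by rewrite ler_nat /ndist; clear - ma ac; lia.
  have l2 : ((ndist m c)%:R : R) <= (ndist m d)%:R by rewrite ler_nat /ndist; clear - ma ac cd; lia.
  by rewrite (lt_le_trans a1 l1) (le_trans l2 d2).
have c2 : forall a b c, (a <= b <= c)%N -> J2 a -> J2 c -> J2 b.
  move=> a c d /andP[ac cd] /andP[ma]; rewrite offd_dyad => /andP[a1 a2] /andP[md].
  rewrite offd_dyad => /andP[d1 d2]; rewrite /J2 (leq_ltn_trans cd md) offd_dyad /=.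
  have l1 : ((ndist m c)%:R : R) <= (ndist m a)%:R by rewrite ler_nat /ndist; clear - md ac cd; lia.
  have l2 : ((ndist m d)%:R : R) <= (ndist m c)%:R by rewrite ler_nat /ndist; clear - md ac cd; lia.
  by rewrite (lt_le_trans d1 l2) (le_trans l1 a2).
have hG' y : (y <= N)%N -> `|\sum_(1 <= n < y.+1) devker R r m n * b n| <= G r m by exact: hG.
have g1 := sum_convex_le c1 hG'; have g2 := sum_convex_le c2 hG'.
by apply: le_trans (ler_normD _ _) _; lra.
Qed.

(** [rho] forces gcd (m, r) = gcd (n, r); this common value is h, and r = h k. *)
Lemma rsum_expand (E : R) (m n : nat) : (0 < m <= N)%N -> (0 < n <= N)%N -> E <= N.+1%:R ->
  rsum E m n = \sum_(1 <= h < N.+1) ((h %| m) && (h %| n))%N%:R *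
    \sum_(1 <= k < N.+1) (dyad (E / h%:R) k)%:R *
       ((coprime (m %/ h) k && coprime (n %/ h) k)%:R * invphi R k).
Proof.
move=> mN nN EN.
pose G (h k : nat) : R := (dyad E (h * k))%:R * (((h %| m) && (h %| n))%N%:R *
  ((coprime (m %/ h) k && coprime (n %/ h) k)%:R * invphi R k)).
transitivity (\sum_(1 <= r < N.+1) \sum_(1 <= h < N.+1) (h %| r)%N%:R * G h (r %/ h)%N).
  apply: eq_big_nat => r /andP[r0 rN].
  transitivity ((dyad E r)%:R * \sum_(1 <= h < N.+1) (h == gcdn m r)%:R * ((h == gcdn n r)%:R * invphi R (r %/ h))).
    rewrite sum_pick /rho gcdn_gt0 r0 orbT /=.
    rewrite (leq_trans (dvdn_leq r0 (dvdn_gcdr m r))) // mul1r //.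
  rewrite mulr_sumr; apply: eq_big_nat => h /andP[h0 _].
  rewrite -!gcdn_charact // /G.
  case: (boolP (h %| r)%N) => hr /=; rewrite ?mul0r ?mulr0 // mul1r mulnC divnK //.
  by rewrite !indicM; ring.
rewrite sum_divisor_pairs; apply: eq_big_nat => h /andP[h0 _].
rewrite mulr_sumr; apply: eq_bigr => k _; rewrite /G dyad_mul //.
case: (boolP (dyad _ k)) => dk; last by rewrite !mul0r !mulr0.
rewrite (_ : (h * k <= N)%N = true) ?mul1r; first by [].
by apply: (dyad_le EN); rewrite dyad_mul.
Qed.

(* [rsum] with coprimality required only at primes p <= z. *)
Definition rsum' (E : R) (m n : nat) : R :=
  \sum_(1 <= h < N.+1) ((h %| m) && (h %| n))%N%:R *
    dphi N (small_primes z ((m %/ h) * (n %/ h))) (E / h%:R).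

Definition bigp (p : nat) : bool := prime p && (z < p)%N.

(** The two conditions can differ only when a prime above z divides k and one of m, n; the right
    side is the union bound over such primes. *)
Lemma avoids_coprime (m n k : nat) : (0 < m <= N)%N -> (0 < n <= N)%N -> (0 < k)%N ->
  `|(avoids (small_primes z (m * n)) k)%:R - (coprime m k && coprime n k)%:R| <=
  \sum_(1 <= p < N.+1) (bigp p)%:R * (((p %| m)%N%:R + (p %| n)%N%:R) * (p %| k)%N%:R) :> R.
Proof.
move=> /andP[m0 mN] /andP[n0 nN] k0.
have r0 : 0 <= \sum_(1 <= p < N.+1) (bigp p)%:R * (((p %| m)%N%:R + (p %| n)%N%:R) * (p %| k)%N%:R) :> R.
  by apply: sumr_nat_ge0 => p _; rewrite !mulr_ge0 // addr_ge0.
have av_cop : coprime m k && coprime n k -> avoids (small_primes z (m * n)) k.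
  rewrite -coprimeMl => cop; apply/allP => p; rewrite mem_filter mem_primes => /and4P[_ pp _ pmn].
  by apply/negP => pk; have := prime_coprime k pp; rewrite pk (coprime_dvdl pmn cop).
case: (boolP (avoids _ k)) => av; last first.
  by rewrite (contraNF av_cop av) subrr normr0.
case: (boolP (coprime m k && coprime n k)) => cop; first by rewrite subrr normr0.
rewrite subr0 normr1.
have [p [pp pk pmn]] : exists p, [/\ prime p, (p %| k)%N & (p %| m)%N || (p %| n)%N].
  move: cop; rewrite -coprimeMl /coprime => g1.
  have g0 : (0 < gcdn (m * n) k)%N by rewrite gcdn_gt0 k0 orbT.
  have g2 : (1 < gcdn (m * n) k)%N by rewrite ltn_neqAle eq_sym g1.
  exists (pdiv (gcdn (m * n) k)); have pp := pdiv_prime g2; split=> //.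
    exact: dvdn_trans (pdiv_dvd _) (dvdn_gcdr _ _).
  by rewrite -Euclid_dvdM //; apply: dvdn_trans (pdiv_dvd _) (dvdn_gcdl _ _).
have zp : (z < p)%N.
  rewrite ltnNge; apply/negP => pz; have : p \in small_primes z (m * n).
    by rewrite mem_filter pz mem_primes pp muln_gt0 m0 n0 Euclid_dvdM.
  by move=> /(allP av); rewrite pk.
have pN : (1 <= p < N.+1)%N.
  by rewrite prime_gt0 //= ltnS; case/orP: pmn => h; apply: leq_trans (dvdn_leq _ h) _.
rewrite (bigD1_seq p) ?mem_index_iota ?iota_uniq //= /bigp pp zp pk mul1r mulr1.
apply: ler_wpDr; first by apply: sumr_ge0 => q _; rewrite !mulr_ge0 // addr_ge0.
by case/orP: pmn => ->; rewrite (lerDl, lerDr).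
Qed.

Lemma count_bigp (m : nat) : (0 < m <= N)%N ->
  \sum_(1 <= p < N.+1) (bigp p)%:R * (p %| m)%N%:R <= ln N%:R / ln P :> R.
Proof.
move=> hm; have /andP[m0 mN] := hm.
rewrite ler_pdivlMr //; apply: (@le_trans _ _ (ln m%:R)); last first.
  by rewrite ler_ln ?posrE ?ltr0n ?(leq_trans m0 mN) // ler_nat.
rewrite mulr_suml (ln_sum_logn R hm); apply: ler_sum_nat => p /andP[p0 _].
have lp0 : 0 <= ln (p%:R : R) by rewrite ln_ge0 // ler1n.
case: (boolP (bigp p)) => bp; last by rewrite !mul0r mulr_ge0.
case: (boolP (p %| m)%N) => pm; last by rewrite mulr0 mul0r mulr_ge0.
have /andP[pp zp] := bp.
have l1 : 1 <= ((logn p m)%:R : R) by rewrite ler1n logn_gt0 mem_primes pp m0.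
have l2 : ln P <= ln (p%:R : R).
  rewrite ler_ln ?posrE ?ltr0n //.
  by apply: ltW; apply: lt_le_trans Pz _; rewrite ler_nat.
by rewrite !mul1r; nra.
Qed.

(** A prime p > P dividing k costs 16/p <= 16/P, and at most ln N / ln P such primes divide each of
    m/h and n/h. The condition h < E records that the inner sums are otherwise empty; it confines h
    to h <= M, the range of the non-concentration hypothesis. *)
Lemma rsum_approx (E : R) (m n : nat) : (0 < m <= N)%N -> (0 < n <= N)%N -> E <= N.+1%:R ->
  `|rsum' E m n - rsum E m n| <=
  \sum_(1 <= h < N.+1) ((h %| m) && (h %| n))%N%:R * ((h%:R < E)%R%:R * (32 / P * (ln N%:R / ln P))).
Proof.
move=> mN nN EN; rewrite rsum_expand // /rsum' -sumrB.
have lN0 : 0 <= ln (N%:R : R) by rewrite ln_ge0 // ler1n.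
apply: norm_sum_le_nat => h /andP[h0 hN]; rewrite -mulrBr.
case: (boolP ((h %| m) && (h %| n))%N) => [/andP[hm hn]|_]; last by rewrite !mul0r normr0.
rewrite !mul1r; have h0' : 0 < (h%:R : R) by rewrite ltr0n.
have mh : (0 < m %/ h <= N)%N.
  case/andP: mN => m0 mN; rewrite divn_gt0 // (dvdn_leq _ hm) //=.
  exact: leq_trans (leq_div _ _) mN.
have nh : (0 < n %/ h <= N)%N.
  case/andP: nN => n0 nN; rewrite divn_gt0 // (dvdn_leq _ hn) //=.
  exact: leq_trans (leq_div _ _) nN.
set m' := (m %/ h)%N in mh *; set n' := (n %/ h)%N in nh *.
rewrite /dphi -sumrB.
case: (ltP h%:R E) => hE; last first.
  rewrite big1_seq ?normr0 ?mul0r // => k /andP[_]; rewrite mem_index_iota => /andP[k1 _].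
  rewrite (_ : dyad _ k = false) /= ?mul0r ?subrr //; apply/negbTE; rewrite negb_and -leNgt.
  apply/orP; left; rewrite ler_pdivrMr //; apply: le_trans hE _.
  by rewrite ler_peMl ?ler1n // ltW.
rewrite mul1r; have E0 : 0 < E / h%:R by rewrite divr_gt0 //; lra.
have EhN : E / h%:R <= N.+1%:R.
  by apply: le_trans EN; rewrite ler_pdivrMr // ler_peMr ?ler1n //; lra.
apply: (@le_trans _ _ (\sum_(1 <= k < N.+1) \sum_(1 <= p < N.+1)
   (bigp p)%:R * ((p %| m')%N%:R + (p %| n')%N%:R) *
     ((dyad (E / h%:R) k && (p %| k)%N)%:R * invphi R k))).
  apply: norm_sum_le_nat => k /andP[k0 _]; rewrite indicM -mulrA -mulrBr -mulrBl !normrM.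
  rewrite ger0_norm // (ger0_norm (invphi_ge0 _ _)).
  apply: le_trans (ler_wpM2l _ (ler_wpM2r _ (avoids_coprime mh nh k0))) _ => //.
    exact: invphi_ge0.
  by rewrite mulr_suml mulr_sumr; apply: ler_sum_nat => p _; rewrite indicM le_eqVlt;
     apply/orP; left; apply/eqP; ring.
rewrite exchange_big_nat /=.
apply: (@le_trans _ _ (\sum_(1 <= p < N.+1)
   (16 / P) * ((bigp p)%:R * (p %| m')%N%:R + (bigp p)%:R * (p %| n')%N%:R))).
  apply: ler_sum_nat => p /andP[p0 _]; rewrite -mulr_sumr.
  case: (boolP (bigp p)) => bp; last by rewrite !mul0r addr0 mulr0.
  have /andP[pp zp] := bp; rewrite !mul1r mulrC ler_wpM2r ?addr_ge0 //.
  apply: le_trans (sum_dyad_multiples pp E0 EhN) _.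
  rewrite ler_wpM2l // lef_pV2 ?posrE ?ltr0n // ltW //.
  by apply: lt_le_trans Pz _; rewrite ler_nat.
rewrite -mulr_sumr big_split /=.
have c1 := count_bigp mh; have c2 := count_bigp nh.
have P16 : 0 <= 16 / P by rewrite divr_ge0 // ltW.
have -> : 32 / P * (ln N%:R / ln P) = 16 / P * (ln N%:R / ln P + ln N%:R / ln P) by ring.
by rewrite ler_wpM2l // lerD.
Qed.

Definition kap (h m n : nat) : R :=
  dphi N (small_primes z (m * n)) (offd m n) -
  dphi N (small_primes z (m * n)) (M.+1%:R / h%:R).

Definition bform (f g : nat -> R) : R :=
  \sum_(1 <= h < N.+1) \sum_(1 <= m < N.+1) \sum_(1 <= n < N.+1)
    f (h * m)%N * g (h * n)%N * kap h m n.

Lemma sum_multiples_supp (h : nat) (f : nat -> R) (F : nat -> R) : (0 < h)%N ->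
  (forall n, (N < n)%N -> f n = 0) ->
  \sum_(1 <= m < N.+1) (h %| m)%N%:R * (f m * F (m %/ h)%N) =
  \sum_(1 <= m < N.+1) f (h * m)%N * F m.
Proof.
move=> h0 f0; rewrite sum_multiples //; apply: eq_bigr => m _; rewrite mulKn //.
by case: leqP => [|/f0 ->]; rewrite ?mul1r ?mul0r ?mulr0.
Qed.

Lemma bform_rsum (b : nat -> R) : (forall n, (N < n)%N -> b n = 0) ->
  \sum_(1 <= m < N.+1) \sum_(1 <= n < N.+1) b m * b n *
       (rsum' (offd m n) m n - rsum' M.+1%:R m n) = bform b b.
Proof.
move=> b0; rewrite /bform.
transitivity (\sum_(1 <= m < N.+1) \sum_(1 <= n < N.+1) \sum_(1 <= h < N.+1)
   (h %| m)%N%:R * (b m * ((h %| n)%N%:R * (b n * kap h (m %/ h) (n %/ h))))).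
  apply: eq_bigr => m _; apply: eq_bigr => n _; rewrite /rsum' -sumrB mulr_sumr.
  apply: eq_big_nat => h /andP[h0 _]; rewrite -mulrBr indicM.
  case: (boolP (h %| m)%N) => hm; last by rewrite !mul0r mulr0.
  case: (boolP (h %| n)%N) => hn; last by rewrite !(mul0r, mulr0).
  have -> : offd m n / h%:R = offd (m %/ h) (n %/ h).
    have h0' : (h%:R : R) != 0 by rewrite pnatr_eq0 -lt0n.
    rewrite /offd -{1}(divnK hm) -{1}(divnK hn) ![(_ %/ h * h)%N]mulnC dvdn_ndist natrM.
    by field; rewrite h0' gt_eqF.
  by rewrite /kap; ring.
rewrite (eq_bigr (fun m => \sum_(1 <= h < N.+1) \sum_(1 <= n < N.+1)
   (h %| m)%N%:R * (b m * ((h %| n)%N%:R * (b n * kap h (m %/ h) (n %/ h)))))); last first.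
  by move=> m _; rewrite exchange_big_nat.
rewrite exchange_big_nat /=; apply: eq_big_nat => h /andP[h0 _].
rewrite (eq_bigr (fun m => (h %| m)%N%:R * (b m * (\sum_(1 <= n < N.+1) b (h * n)%N * kap h (m %/ h) n)))); last first.
  move=> m _; rewrite -!mulr_sumr.
  by rewrite (sum_multiples_supp (fun n => kap h (m %/ h) n)).
rewrite (sum_multiples_supp (fun m => \sum_(1 <= n < N.+1) b (h * n)%N * kap h m n)) //.
by apply: eq_bigr => m _; rewrite mulr_sumr; apply: eq_bigr => n _; ring.
Qed.

(** The three errors come from replacing [cntQ] by Q/2, from the congruences modulo r, and from the
    primes above P. The last has 64 instead of 32 because [rsum] is taken at two scales. *)
Lemma variance_bform (b s : nat -> R) (G : nat -> nat -> R) :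
  (forall n, `|b n| <= s n) -> (forall n, (N < n)%N -> b n = 0) ->
  (forall r m y, (0 < r)%N -> (y <= N)%N -> `|\sum_(1 <= n < y.+1) devker R r m n * b n| <= G r m) ->
  `|rV b N Q - Q / 2 * \sum_(1 <= n < N.+1) b n ^+ 2 - bform b b| <=
  \sum_(1 <= n < N.+1) s n ^+ 2 +
  4 * \sum_(1 <= r < Yn.+1) \sum_(1 <= m < N.+1) s m * G r m +
  64 / P * (ln N%:R / ln P) *
    \sum_(1 <= h < M.+1) (\sum_(1 <= n < N.+1) (h %| n)%N%:R * s n) ^+ 2.
Proof.
move=> bs b0 hG; have s0 n : 0 <= s n by apply: le_trans (bs n).
have lN0 : 0 <= ln (N%:R : R) by rewrite ln_ge0 // ler1n.
rewrite rV_split -bform_rsum //; set X1 := \sum_(1 <= r < _) _; set B2 := \sum_(_ <= n < _) b n ^+ 2.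
set T := \sum_(1 <= m < _) _; set T' := \sum_(1 <= m < _) _.
have e1 := prog_error bs hG; rewrite -/X1 in e1.
have e2 : `|(cntQ - Q / 2) * B2| <= \sum_(1 <= n < N.+1) s n ^+ 2.
  have B20 : 0 <= B2 by apply: sumr_nat_ge0 => n _; rewrite sqr_ge0.
  rewrite normrM (ger0_norm B20); apply: le_trans (_ : 1 * B2 <= _).
    by rewrite ler_wpM2r // cntQ_approx.
  rewrite mul1r; apply: ler_sum_nat => n _; rewrite -real_normK ?num_real //.
  by rewrite ler_pXn2r ?nnegrE.
have e3 : `|T - T'| <= 64 / P * (ln N%:R / ln P) *
    \sum_(1 <= h < M.+1) (\sum_(1 <= n < N.+1) (h %| n)%N%:R * s n) ^+ 2.
  pose c : R := 32 / P * (ln N%:R / ln P).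
  have c0 : 0 <= c by rewrite /c !mulr_ge0 ?invr_ge0 // ltW.
  have -> : 64 / P * (ln N%:R / ln P) = 2 * c by rewrite /c; ring.
  apply: (@le_trans _ _ (\sum_(1 <= m < N.+1) \sum_(1 <= n < N.+1) \sum_(1 <= h < N.+1)
     (h <= M)%N%:R * (2 * c * (((h %| m)%N%:R * s m) * ((h %| n)%N%:R * s n))))).
    rewrite /T /T' -sumrB; apply: norm_sum_le_nat => m hm.
    rewrite -sumrB; apply: norm_sum_le_nat => n hn.
    have EM1 : (M.+1%:R : R) <= N.+1%:R by rewrite ler_nat ltnS.
    have mN' : (m <= N)%N by case/andP: hm.
    have nN' : (n <= N)%N by case/andP: hn.
    have Eo := offd_leM mN' nN'.
    have a1 := rsum_approx hm hn (le_trans Eo EM1); have a2 := rsum_approx hm hn EM1.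
    rewrite -mulrBr !normrM.
    set r1 := rsum _ m n in a1 *; set r1' := rsum' _ m n in a1 *.
    set r2 := rsum _ m n in a2 *; set r2' := rsum' _ m n in a2 *.
    have -> : r1 - r2 - (r1' - r2') = (r2' - r2) - (r1' - r1) by ring.
    apply: (@le_trans _ _ (s m * s n * \sum_(1 <= h < N.+1) (h <= M)%N%:R * (2 * c * ((h %| m) && (h %| n))%N%:R))).
      apply: ler_pM; rewrite ?mulr_ge0 ?normr_ge0 //.
        by apply: ler_pM.
      apply: le_trans (ler_normB _ _) _; apply: le_trans (lerD a2 a1) _.
      rewrite -big_split /=; apply: ler_sum_nat => h _.
      rewrite -/c -mulrDr -mulrDl.
      have i1 : (h%:R < (M.+1%:R : R))%R%:R = (h <= M)%N%:R :> R by rewrite ltr_nat ltnS.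
      have i2 : (h%:R < offd m n)%R%:R <= (h <= M)%N%:R :> R.
        rewrite -i1 ler_nat; case: (ltP h%:R (offd m n)) => //= lt.
        by rewrite (lt_le_trans lt Eo).
      rewrite i1 [leRHS](_ : _ = ((h %| m) && (h %| n))%N%:R * (((h <= M)%N%:R + (h <= M)%N%:R) * c)); last by ring.
      by apply: ler_wpM2l => //; apply: ler_wpM2r => //; rewrite lerD2l.
    rewrite mulr_sumr; apply: ler_sum_nat => h _; rewrite indicM le_eqVlt.
    by apply/orP; left; apply/eqP; ring.
  rewrite (eq_bigr (fun m => \sum_(1 <= h < N.+1) \sum_(1 <= n < N.+1)
     (h <= M)%N%:R * (2 * c * (((h %| m)%N%:R * s m) * ((h %| n)%N%:R * s n))))); last first.
    by move=> m _; rewrite exchange_big_nat.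
  rewrite exchange_big_nat /= mulr_sumr -(sum_cut _ MN) /=; apply: ler_sum_nat => h _.
  rewrite le_eqVlt; apply/orP; left; apply/eqP.
  rewrite expr2 mulr_suml !mulr_sumr; apply: eq_bigr => m _.
  by rewrite !mulr_sumr; apply: eq_bigr => n _; ring.
have -> : cntQ * B2 + X1 + T - Q / 2 * B2 - T' = (cntQ - Q / 2) * B2 + X1 + (T - T') by ring.
apply: le_trans (ler_normD _ _) _; apply: lerD => //.
by apply: le_trans (ler_normD _ _) _; apply: lerD.
Qed.
End VarianceForm.

(** * Comparison of a sequence with its sieve model on short windows *)

Section Window.
Variable R : realType.
Variables (N z : nat) (P X k1 k2 k3 al : R) (b s : nat -> R).
Hypotheses (k1_ge0 : 0 <= k1) (k2_ge0 : 0 <= k2) (k3_ge0 : 0 <= k3).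
Hypotheses (bs : forall n, `|b n| <= s n) (s_supp : forall n, (N < n)%N -> s n = 0).
Hypothesis resembles1 : forall h c d : nat, (0 < h)%N -> (0 < c <= d)%N -> (h * d <= N)%N ->
  `|\sum_(1 <= n < N.+1) ((c <= n <= d)%N && roughn z n)%:R * (b (h * n)%N - al)| <=
  (d%:R - c%:R) * k1 + k2.
Hypothesis resembles2 : forall h c d : nat, (0 < h)%N -> (0 < c <= d)%N -> (h * d <= N)%N ->
  \sum_(1 <= n < N.+1) (c <= n <= d)%N%:R * (s (h * n)%N * (tau n)%:R) <=
  (d%:R - c%:R) * k3 + k2.

Let s_ge0 n : 0 <= s n. Proof. exact: le_trans (bs n). Qed.

Lemma b_supp n : (N < n)%N -> b n = 0.
Proof. by move=> /s_supp sn; apply/eqP; rewrite -normr_le0 -sn. Qed.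

Lemma resembles1_window (h : nat) (J : pred nat) (len : R) : (0 < h)%N -> 0 <= len ->
  (forall a c d, (a <= c <= d)%N -> J a -> J d -> J c) ->
  (forall c d : nat, J c -> J d -> (c <= d)%N -> d%:R - c%:R <= len) ->
  `|\sum_(1 <= n < N.+1) [&& J n, roughn z n & (h * n <= N)%N]%:R * (b (h * n)%N - al)| <=
  len * k1 + k2.
Proof.
move=> h0 len0 cJ dJ; pose J' n := J n && (h * n <= N)%N.
have cJ' a c d : (a <= c <= d)%N -> J' a -> J' d -> J' c.
  move=> acd /andP[Ja _] /andP[Jd dN]; rewrite /J' (cJ a c d) //=.
  by apply: leq_trans dN; rewrite leq_pmul2l //; case/andP: acd.
case: (convex_interval N cJ') => [em|[c [d [cd dN /andP[Jc cN] /andP[Jd hdN] hJ]]]].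
  rewrite big_nat big1 ?normr0 ?addr_ge0 ?mulr_ge0 // => n hn.
  by have := em n hn; rewrite /J' negb_and => /orP[|] /negbTE->; rewrite ?andbF mul0r.
apply: (@le_trans _ _ ((d%:R - c%:R) * k1 + k2)); last first.
  by rewrite lerD2r ler_wpM2r // dJ //; case/andP: cd.
rewrite [X in `|X|](eq_big_nat _ _ (F2 := fun n => ((c <= n <= d)%N && roughn z n)%:R * (b (h * n)%N - al))).
  exact: resembles1.
by move=> n hn; rewrite -hJ // /J'; congr (_%:R * _); case: (J n); case: (roughn z n); case: (_ <= N)%N.
Qed.

Lemma resembles2_window (h : nat) (J : pred nat) (len : R) : (0 < h)%N -> 0 <= len ->
  (forall a c d, (a <= c <= d)%N -> J a -> J d -> J c) ->
  (forall c d : nat, J c -> J d -> (c <= d)%N -> d%:R - c%:R <= len) ->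
  \sum_(1 <= n < N.+1) (J n)%:R * (s (h * n)%N * (tau n)%:R) <= len * k3 + k2.
Proof.
move=> h0 len0 cJ dJ; pose J' n := J n && (h * n <= N)%N.
have cJ' a c d : (a <= c <= d)%N -> J' a -> J' d -> J' c.
  move=> acd /andP[Ja _] /andP[Jd dN]; rewrite /J' (cJ a c d) //=.
  by apply: leq_trans dN; rewrite leq_pmul2l //; case/andP: acd.
have -> : \sum_(1 <= n < N.+1) (J n)%:R * (s (h * n)%N * (tau n)%:R) =
   \sum_(1 <= n < N.+1) (J' n)%:R * (s (h * n)%N * (tau n)%:R).
  apply: eq_bigr => n _; rewrite /J'; case: leqP => [|/s_supp ->]; rewrite ?andbT //.
  by rewrite mul0r !mulr0.
case: (convex_interval N cJ') => [em|[c [d [cd dN /andP[Jc cN] /andP[Jd hdN] hJ]]]].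
  rewrite big_nat big1 ?addr_ge0 ?mulr_ge0 // => n hn.
  by rewrite (negbTE (em n hn)) mul0r.
apply: (@le_trans _ _ ((d%:R - c%:R) * k3 + k2)); last first.
  by rewrite lerD2r ler_wpM2r // dJ //; case/andP: cd.
rewrite [leLHS](eq_big_nat _ _ (F2 := fun n => (c <= n <= d)%N%:R * (s (h * n)%N * (tau n)%:R))).
  exact: resembles2.
by move=> n hn; rewrite -hJ.
Qed.

(** The smooth part is measured on the cofactor n and not on h n: resemblance is applied to
    multiples of h u with u the smooth part of n, and only u needs a cutoff. *)
Definition model (h n : nat) : R := al * (((smpart z n)%:R <= X)%R%:R * (h * n <= N)%N%:R).

(** Let u be the smooth part of n. For u <= X the weight th is constant on the rough cofactors, and
    the first resemblance hypothesis is applied to multiples of h u in a window of length len/u. For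
    u > X the model vanishes, and n = d i with a smooth d in (X, X P]; since wt (d i) <= wt d * tau
    i, the second hypothesis for multiples of h d bounds |b|, and this is the purpose of its factor
    tau. *)
Lemma fundamental_window (h : nat) (J : pred nat) (len Th : R) (th : nat -> R) :
  (0 < h)%N -> 0 <= len -> 1 <= X -> z%:R <= P ->
  (forall a c d, (a <= c <= d)%N -> J a -> J d -> J c) ->
  (forall c d : nat, J c -> J d -> (c <= d)%N -> d%:R - c%:R <= len) ->
  (forall n, (0 < n)%N -> th n = th (smpart z n)) -> 0 <= Th -> (forall n, (0 < n <= N)%N -> `|th n| <= Th * (wt z n)%:R) ->
  `|\sum_(1 <= n < N.+1) (J n)%:R * ((b (h * n)%N - model h n) * th n)| <=
   len * k1 * (\sum_(1 <= u < N.+1) (smooth z u && (u%:R <= X)%R)%:R * (`|th u| / u%:R)) +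
   k2 * (\sum_(1 <= u < N.+1) (smooth z u && (u%:R <= X)%R)%:R * `|th u|) +
   Th * (len * k3 * (\sum_(1 <= d < N.+1) (smooth z d && (X < d%:R <= X * P)%R)%:R * ((wt z d)%:R / d%:R)) +
         k2 * (\sum_(1 <= d < N.+1) (smooth z d && (X < d%:R <= X * P)%R)%:R * (wt z d)%:R)).
Proof.
move=> h0 len0 X1 zP cJ dJ thS Th0 thB.
pose sm n : bool := ((smpart z n)%:R <= X).
have -> : \sum_(1 <= n < N.+1) (J n)%:R * ((b (h * n)%N - model h n) * th n) =
   \sum_(1 <= n < N.+1) (J n)%:R * ((sm n)%:R * ((b (h * n)%N - al * (h * n <= N)%N%:R) * th n)) +
   \sum_(1 <= n < N.+1) (J n)%:R * ((~~ sm n)%:R * (b (h * n)%N * th n)).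
  rewrite -big_split /=; apply: eq_bigr => n _; rewrite /model -/(sm n).
  by case: (sm n) => /=; ring.
apply: le_trans (ler_normD _ _) _; apply: lerD.
  rewrite (sum_smooth_rough z) !mulr_sumr -big_split /=; apply: norm_sum_le_nat => u /andP[u0 uN].
  case: (boolP (smooth z u)) => su; last by rewrite !mul0r !mulr0 addr0 normr0.
  rewrite mul1r /=.
  have u0' : 0 < (u%:R : R) by rewrite ltr0n.
  have -> : \sum_(1 <= v < N.+1) ((u * v <= N)%N && roughn z v)%:R *
     ((J (u * v)%N)%:R * ((sm (u * v)%N)%:R * ((b (h * (u * v))%N - al * (h * (u * v) <= N)%N%:R) * th (u * v)%N))) =
     (u%:R <= X)%R%:R * (th u * \sum_(1 <= v < N.+1) [&& J (u * v)%N, roughn z v & (h * u * v <= N)%N]%:R * (b (h * u * v)%N - al)).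
    rewrite !mulr_sumr; apply: eq_big_nat => v /andP[v0 _].
    case: (boolP (roughn z v)) => rv; last by rewrite !andbF !mul0r !mulr0.
    have spE : smpart z (u * v) = u by apply/eqP; rewrite smpartM_eq.
    rewrite /sm spE (thS (u * v)%N) ?muln_gt0 ?u0 // spE mulnA.
    case: (leqP (h * u * v) N) => hN; last first.
      by rewrite !andbF b_supp // mulr0 subr0 !mul0r !mulr0.
    have -> : (u * v <= N)%N by apply: leq_trans hN; rewrite -mulnA leq_pmull.
    by rewrite !andbT /= ; ring.
  case: (leP u%:R X) => uX; last by rewrite !mul0r !mulr0 addr0 normr0.
  rewrite !mul1r normrM.
  have := @resembles1_window (h * u) (fun v => J (u * v)%N) (len / u%:R).
  rewrite muln_gt0 h0 u0 divr_ge0 ?(ltW u0') // => /(_ isT isT) H.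
  apply: le_trans (ler_wpM2l (normr_ge0 _) (H _ _)) _.
  - move=> a c d /andP[ac cd]; apply: cJ; by rewrite !leq_pmul2l // ac.
  - move=> c d Jc Jd cd; rewrite ler_pdivlMr // mulrBl -!natrM ![(_ * u)%N]mulnC.
    by apply: dJ => //; rewrite leq_pmul2l.
  by rewrite le_eqVlt; apply/orP; left; apply/eqP; ring.
pose cd (d : nat) : bool := smooth z d && (X < d%:R <= X * P)%R.
apply: (@le_trans _ _ (\sum_(1 <= n < N.+1) \sum_(1 <= d < N.+1)
    (d %| n)%N%:R * ((cd d)%:R * ((J n)%:R * (s (h * n)%N * (Th * (wt z n)%:R)))))).
  apply: norm_sum_le_nat => n /andP[n0 nN].
  rewrite !normrM (ger0_norm (indic_ge0 R (J n))) (ger0_norm (indic_ge0 R (~~ sm n))).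
  have nonneg d : 0 <= (d %| n)%N%:R * ((cd d)%:R * ((J n)%:R * (s (h * n)%N * (Th * (wt z n)%:R)))).
    by rewrite !mulr_ge0 // s_ge0.
  case: (boolP (sm n)) => /= smn; first by rewrite mul0r mulr0; apply: sumr_ge0 => d _.
  have := @smooth_divisor_between R z (smpart z n) P X (smpart_gt0 z n) (smpart_smooth z n) zP X1.
  rewrite ltNge => /(_ smn)[d [du Xd dXP]].
  have dn : (d %| n)%N := dvdn_trans du (smpart_dvd z n).
  have d0 := dvdn_gt0 n0 dn.
  have sd : smooth z d := smooth_dvd (smpart_gt0 z n) du (smpart_smooth z n).
  rewrite (bigD1_seq d) ?iota_uniq ?mem_index_iota //=; last first.
    by rewrite d0 ltnS (leq_trans (dvdn_leq n0 dn)).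
  apply: ler_wpDr; first by apply: sumr_ge0.
  rewrite dn /cd sd Xd dXP !mul1r ler_wpM2l // ler_pM ?normr_ge0 ?bs //.
  by apply: thB; rewrite n0.
rewrite exchange_big_nat /= !mulr_sumr -big_split mulr_sumr /=.
apply: ler_sum_nat => d /andP[d0 _].
rewrite -/(cd d); case: (boolP (cd d)) => cdd; last first.
  by rewrite big1 ?(mulr0, mul0r, addr0) // => n _; rewrite mul0r mulr0.
have d0' : 0 < (d%:R : R) by rewrite ltr0n.
rewrite sum_multiples // !mul1r.
apply: (@le_trans _ _ (Th * (wt z d)%:R * \sum_(1 <= i < N.+1) (J (d * i)%N)%:R * (s (h * d * i)%N * (tau i)%:R))).
  rewrite mulr_sumr; apply: ler_sum_nat => i /andP[i0 _].
  have w : (wt z (d * i))%:R <= (wt z d)%:R * (tau i)%:R :> R.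
    rewrite -natrM ler_nat; apply: leq_trans (wtM_le z d0 i0) _.
    by rewrite leq_mul2l (wt_le_tau R) ?orbT.
  apply: (@le_trans _ _ ((J (d * i)%N)%:R * (s (h * (d * i))%N * (Th * (wt z (d * i))%:R)))).
    by rewrite [true%:R * _]mul1r ler_piMl ?indic_le1 // !mulr_ge0 // s_ge0.
  rewrite mulnA [leRHS](_ : _ = (J (d * i)%N)%:R * (s (h * d * i)%N * (Th * ((wt z d)%:R * (tau i)%:R)))); last by ring.
  by rewrite !ler_wpM2l.
have := @resembles2_window (h * d) (fun i => J (d * i)%N) (len / d%:R).
rewrite muln_gt0 h0 d0 divr_ge0 ?(ltW d0') // => /(_ isT isT) H.
apply: le_trans (ler_wpM2l _ (H _ _)) _.
- by rewrite mulr_ge0.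
- move=> a c e /andP[ac ce]; apply: cJ; by rewrite !leq_pmul2l // ac.
- move=> c e Jc Je ce; rewrite ler_pdivlMr // mulrBl -!natrM ![(_ * d)%N]mulnC.
  by apply: dJ => //; rewrite leq_pmul2l.
by rewrite le_eqVlt; apply/orP; left; apply/eqP; ring.
Qed.
End Window.

(** * Numerical bounds for the sums over smooth numbers *)

Section SmoothNumerics.
Variable R : realType.
Variables (N z : nat) (P X F : R).
Hypotheses (P3 : 3 <= P) (zP : z%:R <= P) (X1 : 1 <= X).
Hypothesis hF : \sum_(1 <= d < N.+1) sf (1 / ln P) z d <= F.

Let lP : 0 < ln P. Proof. by rewrite ln_gt0 //; have := P3; lra. Qed.
Let X0 : 0 < X. Proof. by have := X1; lra. Qed.
Let lX : 0 <= ln X. Proof. by rewrite ln_ge0. Qed.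

Lemma sf_ge (d : nat) : (0 < d)%N -> (smooth z d)%:R / d%:R <= sf (1 / ln P) z d :> R.
Proof.
move=> d0; rewrite /sf ler_wpM2l // ler_peMl // -[leLHS]expR0 ler_expR mulr_ge0 ?divr_ge0 ?(ltW lP) //.
by rewrite ln_ge0 // ler1n.
Qed.

Lemma sum_sf_tau : \sum_(1 <= d < N.+1) sf (1 / ln P) z d * (tau d)%:R <= F ^+ 2.
Proof.
apply: le_trans (sum_smooth_tau_le _ _ _) _; rewrite ler_pXn2r // nnegrE.
  by apply: sumr_nat_ge0 => d _; exact: sf_ge0.
by apply: le_trans hF; apply: sumr_nat_ge0 => d _; exact: sf_ge0.
Qed.

Lemma sum_smooth_inv (c : pred nat) :
  \sum_(1 <= u < N.+1) (smooth z u && c u)%:R / u%:R <= F.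
Proof.
apply: le_trans hF; apply: ler_sum_nat => u /andP[u0 _]; apply: le_trans (sf_ge u0).
by rewrite ler_wpM2r // indicM ler_piMr // indic_le1.
Qed.

Lemma sum_smooth_wt_inv (c : pred nat) :
  \sum_(1 <= u < N.+1) (smooth z u && c u)%:R * ((wt z u)%:R / u%:R) <= F ^+ 2.
Proof.
apply: le_trans sum_sf_tau; apply: ler_sum_nat => u /andP[u0 _].
rewrite mulrCA mulrC; apply: ler_pM; rewrite ?mulr_ge0 //; last first.
  by rewrite ler_nat (wt_le_tau R).
apply: le_trans (sf_ge u0).
by rewrite ler_wpM2r // indicM ler_piMr // indic_le1.
Qed.

(** Rankin's trick: for d > X the factor (d/X)^(1/ln P) is at least 1. The saving X^(-1/ln P) is the
    factor R^(1/log P) in the denominator of the theorem. *)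
Lemma sum_smooth_tail (c : pred nat) :
  \sum_(1 <= d < N.+1) (smooth z d && ((X < d%:R)%R && c d))%:R * ((wt z d)%:R / d%:R) <=
  expR (- (ln X / ln P)) * F ^+ 2.
Proof.
apply: le_trans (ler_wpM2l (expR_ge0 _) sum_sf_tau).
rewrite mulr_sumr; apply: ler_sum_nat => d /andP[d0 _].
case: (boolP (smooth z d)) => sd /=; last by rewrite mul0r /sf (negbTE sd) !mul0r mulr0.
case: (ltP X d%:R) => Xd /=; last by rewrite mul0r !mulr_ge0 ?expR_ge0 // sf_ge0.
apply: (@le_trans _ _ ((tau d)%:R / d%:R)).
  apply: (@le_trans _ _ ((wt z d)%:R / d%:R)); first by rewrite ler_piMl ?indic_le1 // mulr_ge0.
  by rewrite ler_wpM2r // ler_nat (wt_le_tau R).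
rewrite /sf sd [true%:R * _]mul1r.
rewrite [leRHS](_ : _ = (expR (- (ln X / ln P)) * expR (1 / ln P * ln d%:R)) * ((tau d)%:R / d%:R)); last by ring.
rewrite -expRD ler_peMl ?divr_ge0 // -[leLHS]expR0 ler_expR mul1r addrC [_^-1 * _]mulrC -mulrBl.
rewrite mulr_ge0 ?invr_ge0 ?(ltW lP) //.
by rewrite subr_ge0 ler_ln ?posrE ?ltr0n // ltW.
Qed.

Lemma sum_wt_le (y : R) (c : pred nat) : 1 <= y ->
  \sum_(1 <= u < N.+1) ((u%:R <= y)%R && c u)%:R * (wt z u)%:R <= y * (1 + ln y).
Proof.
move=> y1; have y0 : 0 <= y by lra.
apply: (@le_trans _ _ (\sum_(1 <= u < (Num.truncn y).+1) (tau u)%:R)); last first.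
  have ty : (Num.truncn y)%:R <= y by rewrite truncn_le.
  have t0 : 0 < ((Num.truncn y)%:R : R) by rewrite ltr0n truncn_gt0.
  apply: le_trans (sum_tau_le _ _) _; apply: ler_pM => //.
    by rewrite addr_ge0 // ln_ge0 // ler1n truncn_gt0.
  by rewrite lerD2l ler_ln ?posrE //; lra.
apply: (@le_trans _ _ (\sum_(1 <= u < N.+1) (u <= Num.truncn y)%N%:R * (tau u)%:R)).
  apply: ler_sum_nat => u /andP[u0 _]; apply: ler_pM => //; last by rewrite ler_nat (wt_le_tau R).
  by rewrite indicM truncn_ge_nat // ler_piMr // indic_le1.
case: (leqP (Num.truncn y) N) => yN; first by rewrite sum_cut.
rewrite [leRHS](@big_cat_nat _ _ _ N.+1) //=; last by rewrite ltnW.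
apply: ler_wpDr; first by apply: sumr_nat_ge0.
by apply: ler_sum_nat => d _; rewrite ler_piMl ?indic_le1.
Qed.
End SmoothNumerics.

(** * Size of the kernel and the windows on which it is constant *)

Lemma mem_small_primesM (z m n p : nat) : (0 < m)%N -> (0 < n)%N ->
  (p \in small_primes z (m * n)) = (p \in small_primes z m) || (p \in small_primes z n).
Proof. by move=> m0 n0; rewrite !mem_filter primesM // andb_orr. Qed.

Section KernelBounds.
Variable R : realType.

Lemma dphi_eq_mem (N : nat) (ps ps' : seq nat) (e : R) : ps =i ps' ->
  dphi N ps e = dphi N ps' e.
Proof.
by move=> E; apply: eq_bigr => k _; rewrite /avoids (eq_all_r E).
Qed.

Lemma dphi_le1 (N : nat) (ps : seq nat) (e : R) : e <= 1 -> dphi N ps e = 0.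
Proof.
move=> e1; rewrite /dphi big_nat big1 // => k /andP[k1 _].
rewrite /dyad (_ : (k%:R < e) = false) ?mul0r //; apply/negbTE; rewrite -leNgt.
by apply: le_trans e1 _; rewrite ler1n.
Qed.

(** Makes the kernel depend on |m - n| through one integer only, so that it is constant on windows
    apart from its dependence on small primes. *)
Lemma dphi_ceil (N : nat) (ps : seq nat) (e : R) : 0 <= e ->
  dphi N ps e = dphi N ps (nceil e)%:R.
Proof.
move=> e0; apply: eq_bigr => k _; congr ((_ && _)%:R * _); rewrite /dyad.
by rewrite ltr_nat nceilP // -natrM ler_nat nceil_le.
Qed.

Variables (N z Yn : nat) (Q P : R).
Let M := Num.truncn Q.
Hypotheses (N0 : (0 < N)%N) (Q2 : 2 <= Q) (MN : (M <= N)%N).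
Hypotheses (hY : 2 * N%:R / Q < Yn.+1%:R) (YM : (Yn <= M)%N).
Variable Lb : R.
Hypothesis hLb : 1 + ln (Yn.+2)%:R <= Lb.

Let Q0 : 0 < Q. Proof. by have := Q2; lra. Qed.
Let Lb1 : 1 <= Lb.
Proof. by apply: le_trans hLb; rewrite lerDl ln_ge0 // ler1n. Qed.
Let MN1 : (M.+1%:R : R) <= N.+1%:R. Proof. by rewrite ler_nat ltnS. Qed.

(** The index j of the window: (j - 1) Q/2 < |m - n| <= j Q/2. *)
Definition jj (m n : nat) : nat := nceil (offd Q m n).

Lemma offd_ge0 m n : 0 <= offd Q m n.
Proof. by rewrite /offd !mulr_ge0 ?invr_ge0 // ltW. Qed.

Lemma offd_scale (h m n : nat) : (h * m <= N)%N -> (h * n <= N)%N ->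
  h%:R * offd Q m n < Yn.+1%:R.
Proof.
move=> hm hn; have := offd_le Q2 hY hm hn; rewrite /offd dvdn_ndist natrM.
by rewrite mulrCA !mulrA.
Qed.

Definition kapj (j h m n : nat) : R :=
  dphi N (small_primes z (m * n)) j%:R - dphi N (small_primes z (m * n)) (M.+1%:R / h%:R).

Lemma kap_jj (h m n : nat) : kap N z Q h m n = kapj (jj m n) h m n.
Proof. by rewrite /kap /kapj dphi_ceil ?offd_ge0. Qed.

Lemma kap_sym (h m n : nat) : kap N z Q h m n = kap N z Q h n m.
Proof. by rewrite /kap /offd ndistC mulnC. Qed.

Lemma divM_le (h : nat) : (0 < h)%N -> 0 < (M.+1%:R / h%:R : R) <= N.+1%:R.
Proof.
move=> h0; rewrite divr_gt0 ?ltr0n //= ler_pdivrMr ?ltr0n //.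
by apply: le_trans MN1 _; rewrite ler_peMr ?ler1n.
Qed.

Lemma kapj_le8 (j h m n : nat) : (0 < h)%N -> (j <= N.+1)%N -> `|kapj j h m n| <= 8.
Proof.
move=> h0 jN; have /andP[d1 d2] := divM_le h0.
have aps := small_primes_prime z (m * n).
have a1 := dphi_le8 aps d1 d2; have a2 := dphi_ge0 N (small_primes z (m * n)) (M.+1%:R / h%:R : R).
have a3 := dphi_ge0 N (small_primes z (m * n)) (j%:R : R).
have a4 : dphi N (small_primes z (m * n)) (j%:R : R) <= 8.
  case: (posnP j) => [->|j0]; first by rewrite dphi_le1 //; lra.
  by apply: dphi_le8 => //; rewrite ?ltr0n // ler_nat.
by rewrite /kapj ler_norml; apply/andP; split; lra.
Qed.

(** Both sums are compared with [dphi_main] at the common threshold T = j - 1, and [dphi_main]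
    cancels. The condition (j - 1) h <= M + 1 makes T admissible for the second scale. Each
    comparison costs 20 Lb / (j - 1), and 1/(j - 1) <= 3/(j + 1); for j <= 1 the trivial bound 8
    suffices. *)
Lemma kapj_le (j h m n : nat) : (0 < h)%N -> (0 < m)%N -> (0 < n)%N ->
  (j <= Yn.+1)%N -> (j.-1 * h <= M.+1)%N ->
  `|kapj j h m n| <= 120 * Lb * (wt z m)%:R * (wt z n)%:R / j.+1%:R.
Proof.
move=> h0 m0 n0 jY jh.
have w1 : 1 <= ((wt z m)%:R : R) by rewrite ler1n wt_gt0.
have w2 : 1 <= ((wt z n)%:R : R) by rewrite ler1n wt_gt0.
have w12 : 1 <= ((wt z m)%:R * (wt z n)%:R : R) by rewrite -natrM ler1n muln_gt0 !wt_gt0.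
have jN : (j <= N.+1)%N by apply: leq_trans jY _; rewrite ltnS (leq_trans YM).
case: (leqP j 1) => j1.
  apply: le_trans (kapj_le8 m n h0 jN) _; rewrite ler_pdivlMr ?ltr0n //.
  have : (j.+1%:R : R) <= 2 by rewrite ler_nat.
  rewrite -mulrA; have := Lb1; set w := _ * _ in w12 *; nra.
have j0 : (0 < j.-1)%N by rewrite -ltnS prednK // ltnW.
have j1' : (j.-1%:R : R) = j%:R - 1 by rewrite -subn1 natrB // ltnW.
have j2 : 2 <= (j%:R : R) by rewrite ler_nat.
have /andP[d1 d2] := divM_le h0.
have ups := small_primes_uniq z (m * n); have aps := small_primes_prime z (m * n).
have T1 : (j.-1%:R : R) <= j%:R by rewrite j1'; lra.
have T2 : (j.-1%:R : R) <= M.+1%:R / h%:R by rewrite ler_pdivlMr ?ltr0n // -natrM ler_nat.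
have jN' : (j%:R : R) <= N.+1%:R by rewrite ler_nat.
have a1 := dphi_approx ups aps j0 T1 jN'; have a2 := dphi_approx ups aps j0 T2 d2.
set main := dphi_main R N _ in a1 a2.
have wE : (2 : R) ^+ size (small_primes z (m * n)) <= (wt z m)%:R * (wt z n)%:R.
  have -> : (2 : R) ^+ size (small_primes z (m * n)) = (wt z (m * n))%:R by rewrite /wt natrX.
  by rewrite -natrM ler_nat wtM_le.
have lnb : 1 + ln (j.-1%:R : R) <= Lb.
  apply: le_trans hLb; rewrite lerD2l ler_ln ?posrE ?ltr0n // ler_nat.
  by rewrite (leq_trans (leq_pred _)) // leqW.
have ln0 : 0 <= ln (j.-1%:R : R) by rewrite ln_ge0 // ler1n.
have inv3 : (j.-1%:R : R)^-1 <= 3 / j.+1%:R.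
  rewrite -natr1 j1' ler_pdivlMr; last by lra.
  by rewrite mulrC ler_pdivrMr; lra.
have rhs : (2 : R) ^+ size (small_primes z (m * n)) * (20 * (1 + ln j.-1%:R) / j.-1%:R) <=
   60 * Lb * (wt z m)%:R * (wt z n)%:R / j.+1%:R.
  apply: (@le_trans _ _ (((wt z m)%:R * (wt z n)%:R) * (20 * Lb * (3 / j.+1%:R)))); last first.
    by rewrite le_eqVlt; apply/orP; left; apply/eqP; ring.
  apply: ler_pM => //.
    by rewrite !mulr_ge0 ?invr_ge0 //; lra.
  by apply: ler_pM => //; lra.
have -> : kapj j h m n = (dphi N (small_primes z (m * n)) j%:R - main) -
   (dphi N (small_primes z (m * n)) (M.+1%:R / h%:R) - main) by rewrite /kapj; ring.
apply: le_trans (ler_normB _ _) _; apply: le_trans (lerD (le_trans a1 rhs) (le_trans a2 rhs)) _.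
by rewrite le_eqVlt; apply/orP; left; apply/eqP; ring.
Qed.

(** Since h m and h n are at most N, h times 2|m - n|/Q stays below Yn + 1; this supplies the side
    conditions of [kapj_le]. *)
Lemma jj_le (h m n : nat) : (0 < h)%N -> (h * m <= N)%N -> (h * n <= N)%N ->
  (jj m n <= Yn.+1)%N /\ ((jj m n).-1 * h <= M.+1)%N.
Proof.
move=> h0 hm hn; have lt := offd_scale hm hn; have o0 := offd_ge0 m n.
have h1 : 1 <= (h%:R : R) by rewrite ler1n.
split.
  rewrite /jj nceil_le //; apply: ltW; apply: le_lt_trans lt.
  by rewrite ler_peMl.
case: (posnP (jj m n)) => [->|j0]; first by rewrite mul0n.
have : ((jj m n).-1 < jj m n)%N by rewrite prednK.
rewrite {2}/jj nceilP // => jo.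
rewrite -(ler_nat R) natrM; apply: ltW; apply: le_lt_trans (_ : h%:R * offd Q m n < _).
  by rewrite mulrC ler_wpM2l // ltW.
by apply: lt_le_trans lt _; rewrite ler_nat ltnS.
Qed.

(** A level set of [jj m] has a branch on either side of m; only the separate branches are convex
    and of diameter at most Q/2. *)
Definition pieceR (m j n : nat) : bool := (m <= n)%N && (jj m n == j).
Definition pieceL (m j n : nat) : bool := (n < m)%N && (jj m n == j).

Lemma jj_mono (m n n' : nat) : (ndist m n <= ndist m n')%N -> (jj m n <= jj m n')%N.
Proof.
move=> le; rewrite leqNgt; apply/negP; rewrite {2}/jj nceilP ?offd_ge0 //; apply/negP; rewrite -leNgt.
apply: (@le_trans _ _ (offd Q m n')); last by rewrite -nceil_le ?offd_ge0.
by rewrite /offd ler_wpM2r ?invr_ge0 ?(ltW Q0) // ler_wpM2l // ler_nat.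
Qed.

Lemma jj_diam (m n n' : nat) : jj m n = jj m n' ->
  (ndist m n')%:R - (ndist m n)%:R <= Q / 2 :> R.
Proof.
move=> E; have o0 := offd_ge0 m n.
have up : offd Q m n' <= (jj m n)%:R by rewrite E /jj -nceil_le ?offd_ge0.
have lo : (jj m n)%:R <= offd Q m n + 1.
  case: (posnP (jj m n)) => [->|j0]; first by rewrite addr_ge0.
  have : ((jj m n).-1 < jj m n)%N by rewrite prednK.
  rewrite {2}/jj nceilP // => /ltW; rewrite -subn1 natrB //; lra.
have oE k : (ndist m k)%:R = offd Q m k * (Q / 2) by rewrite /offd; field; rewrite gt_eqF.
rewrite !oE -mulrBl ler_piMl ?divr_ge0 ?(ltW Q0) //; lra.
Qed.

Lemma pieceR_convex m j a c d : (a <= c <= d)%N -> pieceR m j a -> pieceR m j d -> pieceR m j c.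
Proof.
move=> /andP[ac cd] /andP[ma /eqP ja] /andP[md /eqP jd]; rewrite /pieceR (leq_trans ma ac) /=.
rewrite eqn_leq -{1}jd -{1}ja !jj_mono // /ndist; clear - ma ac cd; lia.
Qed.

Lemma pieceL_convex m j a c d : (a <= c <= d)%N -> pieceL m j a -> pieceL m j d -> pieceL m j c.
Proof.
move=> /andP[ac cd] /andP[ma /eqP ja] /andP[md /eqP jd]; rewrite /pieceL (leq_ltn_trans cd md) /=.
rewrite eqn_leq -{1}ja -{1}jd !jj_mono // /ndist; clear - md ac cd; lia.
Qed.

Lemma pieceR_diam m j (c d : nat) : pieceR m j c -> pieceR m j d -> (c <= d)%N -> d%:R - c%:R <= Q / 2.
Proof.
move=> /andP[mc /eqP jc] /andP[md /eqP jd] cd; have := @jj_diam m c d; rewrite jc jd => /(_ erefl).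
have -> : ndist m d = (d - m)%N by rewrite /ndist; clear - md; lia.
have -> : ndist m c = (c - m)%N by rewrite /ndist; clear - mc; lia.
by rewrite !natrB //; lra.
Qed.

Lemma pieceL_diam m j (c d : nat) : pieceL m j c -> pieceL m j d -> (c <= d)%N -> d%:R - c%:R <= Q / 2.
Proof.
move=> /andP[mc /eqP jc] /andP[md /eqP jd] cd; have := @jj_diam m d c; rewrite jc jd => /(_ erefl).
have -> : ndist m d = (m - d)%N by rewrite /ndist; clear - md; lia.
have -> : ndist m c = (m - c)%N by rewrite /ndist; clear - mc; lia.
by rewrite !natrB ?(ltnW mc) ?(ltnW md) //; lra.
Qed.

Lemma sum_pieces (m : nat) (F : nat -> R) :
  (forall n, (0 < n <= N)%N -> (Yn.+1 < jj m n)%N -> F n = 0) ->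
  \sum_(1 <= n < N.+1) F n = \sum_(0 <= j < Yn.+2)
     (\sum_(1 <= n < N.+1) (pieceR m j n)%:R * F n + \sum_(1 <= n < N.+1) (pieceL m j n)%:R * F n).
Proof.
move=> F0; rewrite [RHS](eq_bigr (fun j => \sum_(1 <= n < N.+1) (jj m n == j)%:R * F n)); last first.
  move=> j _; rewrite -big_split /=; apply: eq_bigr => n _; rewrite -mulrDl; congr (_ * _).
  by rewrite /pieceR /pieceL; case: leqP; rewrite /= ?addr0 ?add0r.
rewrite exchange_big_nat /=; apply: eq_big_nat => n hn.
rewrite -mulr_suml; case: (leqP (jj m n) Yn.+1) => jY; last by rewrite F0 // mulr0.
rewrite (bigD1_seq (jj m n)) ?iota_uniq ?mem_index_iota //= eqxx big1_seq ?addr0 ?mul1r //.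
by move=> j /andP[/negbTE]; rewrite eq_sym => ->.
Qed.

Lemma sum_inv_succ : \sum_(0 <= j < Yn.+2) (j.+1%:R : R)^-1 <= Lb.
Proof.
apply: le_trans hLb; apply: le_trans (harmonic_le R Yn.+2).
by rewrite big_add1.
Qed.
End KernelBounds.

(** * Replacing the sequence by its model in the bilinear form *)

Section SieveComparison.
Variable R : realType.
Variables (N z Yn : nat) (Q P X Lb F : R).
Let M := Num.truncn Q.
Hypotheses (N0 : (0 < N)%N) (Q2 : 2 <= Q) (MN : (M <= N)%N).
Hypotheses (hY : 2 * N%:R / Q < Yn.+1%:R) (YM : (Yn <= M)%N).
Hypothesis hLb : 1 + ln (Yn.+2)%:R <= Lb.
Hypotheses (P3 : 3 <= P) (zP : z%:R <= P) (X1 : 1 <= X).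
Hypothesis hF : \sum_(1 <= d < N.+1) sf (1 / ln P) z d <= F.
Hypothesis NQ : N%:R <= Q ^+ 2.

Let Q0 : 0 < Q. Proof. by have := Q2; lra. Qed.
Let P1 : 1 <= P. Proof. by have := P3; lra. Qed.
Let XP1 : 1 <= X * P. Proof. by rewrite -[leLHS]mulr1 ler_pM. Qed.
Let Lb1 : 1 <= Lb.
Proof. by apply: le_trans hLb; rewrite lerDl ln_ge0 // ler1n. Qed.
Let F0 : 0 <= F.
Proof. by apply: le_trans hF; apply: sumr_nat_ge0 => d _; exact: sf_ge0. Qed.

(** The saving X^(-1/ln P). *)
Definition rankin : R := expR (- (ln X / ln P)).
(** Bounds the total weight of the smooth parts u <= X and of the divisors d <= X P, each of which
    pays the K_int^(2) error once. *)
Definition xpl : R := X * P * (1 + ln (X * P)).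

Lemma xpl_ge0 : 0 <= xpl.
Proof. by rewrite mulr_ge0 ?addr_ge0 ?ln_ge0 //; have := XP1; lra. Qed.

Lemma rankin_ge0 : 0 <= rankin. Proof. exact: expR_ge0. Qed.

Lemma sum_wt_X : \sum_(1 <= u < N.+1) (smooth z u && (u%:R <= X)%R)%:R * (wt z u)%:R <= xpl.
Proof.
apply: (@le_trans _ _ (\sum_(1 <= u < N.+1) ((u%:R <= X * P)%R && smooth z u)%:R * (wt z u)%:R)).
  apply: ler_sum_nat => u _; rewrite ler_wpM2r // andbC ler_nat.
  case: (smooth z u); rewrite ?andbF ?andbT //.
  case: (leP u%:R X) => //= uX; rewrite (le_trans uX) //.
  by rewrite ler_peMr //; have := X1; lra.
exact: sum_wt_le.
Qed.

Lemma sum_wt_XP : \sum_(1 <= d < N.+1) (smooth z d && (X < d%:R <= X * P)%R)%:R * (wt z d)%:R <= xpl.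
Proof.
apply: le_trans (sum_wt_le N z (fun d => smooth z d && (X < d%:R)) XP1).
apply: ler_sum_nat => u _; rewrite ler_wpM2r // ler_nat.
by case: (smooth z u); case: (X < u%:R); case: (u%:R <= X * P).
Qed.

Lemma sum_wt_inv_XP : \sum_(1 <= d < N.+1) (smooth z d && (X < d%:R <= X * P)%R)%:R * ((wt z d)%:R / d%:R)
  <= rankin * F ^+ 2.
Proof. exact: (sum_smooth_tail P3 X1 hF (fun d => d%:R <= X * P)). Qed.

Section Sequence.
Variables (k1 k2 k3 al : R) (b s : nat -> R).
Hypotheses (k1_ge0 : 0 <= k1) (k2_ge0 : 0 <= k2) (k3_ge0 : 0 <= k3).
Hypotheses (bs : forall n, `|b n| <= s n) (s_supp : forall n, (N < n)%N -> s n = 0).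
Hypothesis resembles1 : forall h c d : nat, (0 < h)%N -> (0 < c <= d)%N -> (h * d <= N)%N ->
  `|\sum_(1 <= n < N.+1) ((c <= n <= d)%N && roughn z n)%:R * (b (h * n)%N - al)| <=
  (d%:R - c%:R) * k1 + k2.
Hypothesis resembles2 : forall h c d : nat, (0 < h)%N -> (0 < c <= d)%N -> (h * d <= N)%N ->
  \sum_(1 <= n < N.+1) (c <= n <= d)%N%:R * (s (h * n)%N * (tau n)%:R) <=
  (d%:R - c%:R) * k3 + k2.

Let s_ge0 n : 0 <= s n. Proof. exact: le_trans (bs n). Qed.

Definition devm (h n : nat) : R := b (h * n)%N - model N z X al h n.

Lemma devm_supp (h n : nat) : (N < h * n)%N -> devm h n = 0.
Proof.
move=> lt; rewrite /devm (b_supp bs s_supp) // /model [(h * n <= N)%N]leqNgt lt.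
by rewrite !mulr0 subrr.
Qed.

(** The error of [fundamental_scaled] on one window of length Q/2 with weight bound 1. *)
Definition omega1 : R := Q / 2 * (k1 + k3 * rankin) * F ^+ 2 + 2 * k2 * xpl.

Lemma omega1_ge0 : 0 <= omega1.
Proof.
apply: addr_ge0; last by apply: mulr_ge0; [apply: mulr_ge0 | exact: xpl_ge0].
apply: mulr_ge0; last exact: exprn_ge0.
apply: mulr_ge0; first by rewrite divr_ge0 // ltW.
by apply: addr_ge0 => //; apply: mulr_ge0 => //; exact: rankin_ge0.
Qed.

Lemma kapj_smpart (j h m n : nat) : (0 < m)%N -> (0 < n)%N ->
  kapj N z Q j h m n = kapj N z Q j h m (smpart z n).
Proof.
move=> m0 n0; have E : small_primes z (m * n) =i small_primes z (m * smpart z n).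
  by move=> p; rewrite !mem_small_primesM ?smpart_gt0 // small_primes_smpart.
by rewrite /kapj !(dphi_eq_mem _ _ E).
Qed.

Lemma fundamental_scaled (h : nat) (J : pred nat) (len Th : R) (th : nat -> R) :
  (0 < h)%N -> 0 <= len ->
  (forall a c d, (a <= c <= d)%N -> J a -> J d -> J c) ->
  (forall c d : nat, J c -> J d -> (c <= d)%N -> d%:R - c%:R <= len) ->
  (forall n, (0 < n)%N -> th n = th (smpart z n)) -> 0 <= Th ->
  (forall n, (0 < n <= N)%N -> `|th n| <= Th * (wt z n)%:R) ->
  `|\sum_(1 <= n < N.+1) (J n)%:R * (devm h n * th n)| <=
   Th * (len * (k1 + k3 * rankin) * F ^+ 2 + 2 * k2 * xpl).
Proof.
move=> h0 len0 cJ dJ thS Th0 thB.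
apply: le_trans (fundamental_window k1_ge0 k2_ge0 k3_ge0 bs s_supp resembles1 resembles2
   h0 len0 X1 zP cJ dJ thS Th0 thB) _.
have b1 : \sum_(1 <= u < N.+1) (smooth z u && (u%:R <= X)%R)%:R * (`|th u| / u%:R) <= Th * F ^+ 2.
  apply: le_trans (ler_wpM2l Th0 (sum_smooth_wt_inv P3 hF (fun u => u%:R <= X))).
  rewrite mulr_sumr; apply: ler_sum_nat => u hu; rewrite [leRHS]mulrCA ler_wpM2l // mulrA ler_wpM2r //.
  exact: thB.
have b2 : \sum_(1 <= u < N.+1) (smooth z u && (u%:R <= X)%R)%:R * `|th u| <= Th * xpl.
  apply: le_trans (ler_wpM2l Th0 sum_wt_X).
  rewrite mulr_sumr; apply: ler_sum_nat => u hu; rewrite [leRHS]mulrCA ler_wpM2l //.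
  exact: thB.
have b3 := sum_wt_inv_XP; have b4 := sum_wt_XP.
have lk1 : 0 <= len * k1 by rewrite mulr_ge0.
have lk3 : 0 <= len * k3 by rewrite mulr_ge0.
apply: le_trans (lerD (lerD (ler_wpM2l lk1 b1) (ler_wpM2l k2_ge0 b2))
   (ler_wpM2l Th0 (lerD (ler_wpM2l lk3 b3) (ler_wpM2l k2_ge0 b4)))) _.
by rewrite le_eqVlt; apply/orP; left; apply/eqP; ring.
Qed.

(** Window j contributes at most 1/(j + 1) times a constant containing one [Lb]; the sum over j
    gives the second [Lb], and the two branches double 120 to 240. *)
Lemma inner_small (h m : nat) : (0 < h)%N -> (0 < m)%N -> (h * m <= N)%N ->
  `|\sum_(1 <= n < N.+1) devm h n * kap N z Q h m n| <= 240 * Lb ^+ 2 * omega1 * (wt z m)%:R.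
Proof.
move=> h0 m0 hm.
have Q20 : 0 <= Q / 2 by rewrite divr_ge0 // ltW.
rewrite (@sum_pieces R N Yn Q m) => [|n hn jn]; last first.
  case: (leqP (h * n) N) => hnN; last by rewrite devm_supp // mul0r.
  by have [le _] := jj_le Q2 hY YM h0 hm hnN; rewrite ltnNge le in jn.
apply: (@le_trans _ _ (\sum_(0 <= j < Yn.+2) 240 * Lb * omega1 * (wt z m)%:R * j.+1%:R^-1)); last first.
  rewrite -mulr_sumr; have := sum_inv_succ hLb => h1.
  have Lb0 : 0 <= Lb by have := Lb1; lra.
  have c0 := mulr_ge0 (mulr_ge0 (mulr_ge0 (ler0n R 240) Lb0) omega1_ge0) (ler0n R (wt z m)).
  apply: le_trans (ler_wpM2l c0 h1) _.
  by rewrite le_eqVlt; apply/orP; left; apply/eqP; ring.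
apply: norm_sum_le_nat => j /andP[_ jY]; rewrite ltnS in jY.
have piece (J : pred nat) : (forall n, J n -> jj Q m n = j) ->
   (forall a c d, (a <= c <= d)%N -> J a -> J d -> J c) ->
   (forall c d : nat, J c -> J d -> (c <= d)%N -> d%:R - c%:R <= Q / 2) ->
   `|\sum_(1 <= n < N.+1) (J n)%:R * (devm h n * kap N z Q h m n)| <=
   120 * Lb * omega1 * (wt z m)%:R * j.+1%:R^-1.
  (* If (j - 1) h > M + 1, then by [jj_le] the window contains no n with h n <= N, and the deviation
     vanishes beyond N. *)
  move=> Jj cJ dJ; case: (leqP (j.-1 * h) M.+1) => jh; last first.
    rewrite big_nat big1 ?normr0.
      have Lb0 : 0 <= Lb by have := Lb1; lra.
      apply: mulr_ge0; last by rewrite invr_ge0.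
      exact: (mulr_ge0 (mulr_ge0 (mulr_ge0 (ler0n _ _) Lb0) omega1_ge0) (ler0n _ _)).
    move=> n _; case: (boolP (J n)) => Jn; last by rewrite mul0r.
    case: (leqP (h * n) N) => hnN; last by rewrite devm_supp // mul0r mulr0.
    by have [_] := jj_le Q2 hY YM h0 hm hnN; rewrite (Jj n Jn) leqNgt jh.
  pose Th : R := 120 * Lb * (wt z m)%:R / j.+1%:R.
  have Th0 : 0 <= Th by rewrite !mulr_ge0 ?invr_ge0 //; have := Lb1; lra.
  rewrite [X in `|X|](eq_bigr (fun n => (J n)%:R * (devm h n * kapj N z Q j h m n))); last first.
    by move=> n _; case: (boolP (J n)) => [/Jj E|_]; rewrite ?mul0r // kap_jj // E.
  apply: le_trans (fundamental_scaled h0 Q20 cJ dJ _ Th0 _) _.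
  - by move=> n n0; apply: kapj_smpart.
  - move=> n /andP[n0 _]; apply: le_trans (kapj_le z MN YM hLb h0 m0 n0 jY jh) _.
    by rewrite le_eqVlt; apply/orP; left; apply/eqP; rewrite /Th; ring.
  by rewrite -/omega1 /Th le_eqVlt; apply/orP; left; apply/eqP; ring.
have p1 := piece (pieceR Q m j) _ _ _; have p2 := piece (pieceL Q m j) _ _ _.
apply: le_trans (ler_normD _ _) _.
apply: le_trans (lerD (p1 _ _ _) (p2 _ _ _)) _.
- by move=> n /andP[_ /eqP].
- by move=> a c d; apply: pieceR_convex.
- by move=> c d; apply: pieceR_diam.
- by move=> n /andP[_ /eqP].
- by move=> a c d; apply: pieceL_convex.
- by move=> c d; apply: pieceL_diam.
by rewrite le_eqVlt; apply/orP; left; apply/eqP; ring.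
Qed.

(** Here h > Yn forces 2|m - n|/Q < 1, and a dyadic range below 1 contains no positive integer. *)
Lemma kap_large (h m n : nat) : (Yn < h)%N -> (h * m <= N)%N -> (h * n <= N)%N ->
  kap N z Q h m n = - dphi N (small_primes z (m * n)) (M.+1%:R / h%:R).
Proof.
move=> Yh hm hn; have h0 : 0 < (h%:R : R) by rewrite ltr0n (leq_ltn_trans _ Yh).
rewrite /kap [X in X - _]dphi_le1 ?sub0r // -(ler_pM2l h0) mulr1.
by apply: ltW; apply: lt_le_trans (offd_scale Q2 hY hm hn) _; rewrite ler_nat.
Qed.

(** F multiplies k1 only to the first power, because for h > Yn the kernel is bounded by 8 without
    the weight [wt]. This is why the K_conc[2x/Q] term carries a single log P. *)
Definition omega2 (h : nat) : R :=
  N%:R / h%:R * (k1 * F + k3 * rankin * F ^+ 2) + 2 * k2 * xpl.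

(** The kernel is now a function of small primes alone, so the whole range n <= N/h serves as one
    window. *)
Lemma inner_large (h m : nat) : (Yn < h)%N -> (0 < m)%N -> (h * m <= N)%N ->
  `|\sum_(1 <= n < N.+1) devm h n * kap N z Q h m n| <= 8 * omega2 h.
Proof.
move=> Yh m0 hm; have h0 : (0 < h)%N by rewrite (leq_ltn_trans _ Yh).
have h0' : 0 < (h%:R : R) by rewrite ltr0n.
pose th (n : nat) : R := - dphi N (small_primes z (m * n)) (M.+1%:R / h%:R).
pose J (n : nat) : bool := (h * n <= N)%N.
have -> : \sum_(1 <= n < N.+1) devm h n * kap N z Q h m n =
   \sum_(1 <= n < N.+1) (J n)%:R * (devm h n * th n).
  apply: eq_bigr => n _; rewrite /J; case: leqP => hn; last by rewrite devm_supp // !mul0r ?mulr0.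
  by rewrite mul1r kap_large.
have th8 n : `|th n| <= 8.
  have /andP[d1 d2] := divM_le MN h0.
  rewrite normrN ger0_norm ?dphi_ge0 //; apply: dphi_le8 => //.
  exact: small_primes_prime.
have thS n : (0 < n)%N -> th n = th (smpart z n).
  move=> n0; have E : small_primes z (m * n) =i small_primes z (m * smpart z n).
    by move=> p; rewrite !mem_small_primesM ?smpart_gt0 // small_primes_smpart.
  by rewrite /th (dphi_eq_mem _ _ E).
have len0 : 0 <= N%:R / h%:R :> R by rewrite divr_ge0.
have cJ a c d : (a <= c <= d)%N -> J a -> J d -> J c.
  by move=> /andP[_ cd] _; apply: leq_trans; rewrite leq_pmul2l.
have dJ (c d : nat) : J c -> J d -> (c <= d)%N -> d%:R - c%:R <= N%:R / h%:R :> R.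
  move=> _ Jd _; rewrite ler_pdivlMr // mulrBl -natrM mulnC.
  by rewrite lerBlDr ler_wpDr ?mulr_ge0 // ler_nat.
have thB n : (0 < n <= N)%N -> `|th n| <= 8 * (wt z n)%:R.
  by move=> _; apply: le_trans (th8 n) _; rewrite ler_peMr // ler1n wt_gt0.
have e8 : 0 <= 8 :> R by [].
apply: le_trans (fundamental_window k1_ge0 k2_ge0 k3_ge0 bs s_supp resembles1 resembles2
   h0 len0 X1 zP cJ dJ thS e8 thB) _.
have b1 : \sum_(1 <= u < N.+1) (smooth z u && (u%:R <= X)%R)%:R * (`|th u| / u%:R) <= 8 * F.
  apply: le_trans (ler_wpM2l e8 (sum_smooth_inv P3 hF (fun u => u%:R <= X))).
  rewrite mulr_sumr; apply: ler_sum_nat => u hu; rewrite [leRHS]mulrCA ler_wpM2l // ler_wpM2r //.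
have b2 : \sum_(1 <= u < N.+1) (smooth z u && (u%:R <= X)%R)%:R * `|th u| <= 8 * xpl.
  apply: le_trans (ler_wpM2l e8 sum_wt_X).
  rewrite mulr_sumr; apply: ler_sum_nat => u hu; rewrite [leRHS]mulrCA ler_wpM2l //.
  by apply: thB.
have b3 := sum_wt_inv_XP; have b4 := sum_wt_XP.
have lk1 : 0 <= N%:R / h%:R * k1 by rewrite mulr_ge0.
have lk3 : 0 <= N%:R / h%:R * k3 by rewrite mulr_ge0.
apply: le_trans (lerD (lerD (ler_wpM2l lk1 b1) (ler_wpM2l k2_ge0 b2))
   (ler_wpM2l e8 (lerD (ler_wpM2l lk3 b3) (ler_wpM2l k2_ge0 b4)))) _.
by rewrite /omega2 le_eqVlt; apply/orP; left; apply/eqP; ring.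
Qed.

Lemma kap_beyond (h m n : nat) : (M < h)%N -> (h * m <= N)%N -> (h * n <= N)%N ->
  kap N z Q h m n = 0.
Proof.
move=> Mh hm hn; rewrite kap_large ?(leq_ltn_trans YM) // dphi_le1 ?oppr0 //.
by rewrite ler_pdivrMr ?mul1r ?ler_nat // ltr0n (leq_ltn_trans _ Mh).
Qed.

Definition bhform (h : nat) (f g : nat -> R) : R :=
  \sum_(1 <= m < N.+1) \sum_(1 <= n < N.+1) f m * g n * kap N z Q h m n.

Lemma bhform_diff (h : nat) (f g : nat -> R) :
  bhform h f f - bhform h g g =
  \sum_(1 <= m < N.+1) (f m + g m) * \sum_(1 <= n < N.+1) (f n - g n) * kap N z Q h m n.
Proof.
have sym : bhform h f g = bhform h g f.
  rewrite /bhform exchange_big_nat; apply: eq_bigr => m _; apply: eq_bigr => n _.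
  by rewrite kap_sym; ring.
have -> : bhform h f f - bhform h g g =
  (bhform h f f - bhform h f g) + (bhform h g f - bhform h g g) by rewrite sym; ring.
rewrite /bhform -!sumrB -big_split; apply: eq_bigr => m _ /=.
by rewrite -!sumrB -big_split mulr_sumr; apply: eq_bigr => n _ /=; ring.
Qed.

(** For h <= Yn the windows of [inner_small] apply, for Yn < h <= M the single window of
    [inner_large], and beyond M the kernel vanishes. Only the difference b - g is summed with its
    signs; the sum b + g is taken in absolute value. *)
Lemma bform_model :
  `|bform N z Q b b - \sum_(1 <= h < N.+1) bhform h (model N z X al h) (model N z X al h)| <=
  \sum_(1 <= h < Yn.+1) 240 * Lb ^+ 2 * omega1 *
     \sum_(1 <= m < N.+1) (s (h * m)%N + `|al| * (h * m <= N)%N%:R) * (wt z m)%:R +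
  \sum_(1 <= h < M.+1) (Yn < h)%N%:R * (8 * omega2 h *
     \sum_(1 <= m < N.+1) (s (h * m)%N + `|al| * (h * m <= N)%N%:R)).
Proof.
have o1 := omega1_ge0.
have o2 h : 0 <= omega2 h.
  apply: addr_ge0; last by apply: mulr_ge0; [apply: mulr_ge0 | exact: xpl_ge0].
  apply: mulr_ge0; first by rewrite divr_ge0.
  apply: addr_ge0; first exact: mulr_ge0.
  by apply: mulr_ge0; [apply: mulr_ge0 => //; exact: rankin_ge0 | exact: exprn_ge0].
rewrite /bform -sumrB.
have YN : (Yn <= N)%N by apply: leq_trans MN.
rewrite -(sum_cut _ YN) -[X in _ <= _ + X](sum_cut _ MN) -big_split /=.
apply: norm_sum_le_nat => h /andP[h0 hN].
rewrite -/(bhform h (fun m => b (h * m)%N) (fun m => b (h * m)%N)) bhform_diff.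
have fb m : `|b (h * m)%N + model N z X al h m| <= s (h * m)%N + `|al| * (h * m <= N)%N%:R.
  apply: le_trans (ler_normD _ _) _; apply: lerD => //; rewrite /model normrM ler_wpM2l //.
  rewrite ger0_norm ?mulr_ge0 // ler_piMl // indic_le1 //.
have fb0 m : 0 <= s (h * m)%N + `|al| * (h * m <= N)%N%:R by rewrite addr_ge0 ?mulr_ge0.
case: (leqP h Yn) => hY'.
  have -> : (h <= M)%N by apply: leq_trans YM.
  rewrite mul0r mulr0 addr0 mul1r mulr_sumr.
  apply: norm_sum_le_nat => m /andP[m0 mN]; rewrite normrM.
  case: (leqP (h * m) N) => hm; last first.
    rewrite (b_supp bs s_supp) // /model [(h * m <= N)%N]leqNgt hm !mulr0 addr0 normr0 mul0r.
    by rewrite (s_supp hm) addr0 mul0r mulr0.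
  have := fb m; rewrite hm => fbm; have := fb0 m; rewrite hm => fbm0.
  apply: le_trans (ler_pM _ _ fbm (inner_small h0 m0 hm)) _; rewrite ?normr_ge0 //.
  by rewrite le_eqVlt; apply/orP; left; apply/eqP; ring.
rewrite mul0r add0r.
case: (leqP h M) => hM.
  rewrite !mul1r mulr_sumr; apply: norm_sum_le_nat => m /andP[m0 mN]; rewrite normrM.
  case: (leqP (h * m) N) => hm; last first.
    rewrite (b_supp bs s_supp) // /model [(h * m <= N)%N]leqNgt hm !mulr0 addr0 normr0 mul0r.
    by rewrite s_supp // addr0 mulr0.
  have := fb m; rewrite hm => fbm; have := fb0 m; rewrite hm => fbm0.
  apply: le_trans (ler_pM _ _ fbm (inner_large hY' m0 hm)) _; rewrite ?normr_ge0 //.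
  by rewrite le_eqVlt; apply/orP; left; apply/eqP; ring.
rewrite mul0r big_nat big1 ?normr0 // => m _.
case: (leqP (h * m) N) => hm; last first.
  rewrite (b_supp bs s_supp) // /model [(h * m <= N)%N]leqNgt hm !mulr0 addr0 mul0r //.
rewrite [X in _ * X]big1 ?mulr0 // => n _; rewrite -/(devm h n).
case: (leqP (h * n) N) => hn; last by rewrite devm_supp // mul0r.
by rewrite kap_beyond // mulr0.
Qed.
End Sequence.
End SieveComparison.

(** * Counting integers by their smooth part *)

Section Counting.
Variable R : realType.
Variables (N z : nat) (P X F : R).
Hypotheses (N0 : (0 < N)%N) (P3 : 3 <= P) (zP : z%:R <= P) (X1 : 1 <= X).
Hypothesis hF : \sum_(1 <= d < N.+1) sf (1 / ln P) z d <= F.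

Let lN : 0 <= ln (N%:R : R). Proof. by rewrite ln_ge0 // ler1n. Qed.

Lemma count_scaled (c : nat) : (0 < c)%N ->
  \sum_(1 <= i < N.+1) (c * i <= N)%N%:R <= N%:R / c%:R :> R.
Proof.
move=> c0; rewrite (eq_bigr (fun i => (i <= N %/ c)%N%:R * (1 : R))); last first.
  by move=> i _; rewrite mulr1 leq_divRL // mulnC.
rewrite sum_cut ?leq_div // big_const_nat iter_addr_0 subn1 /=.
by rewrite ler_pdivlMr ?ltr0n // -natrM ler_nat leq_divM.
Qed.

Lemma sum_tau_scaled (c : nat) : (0 < c)%N ->
  \sum_(1 <= i < N.+1) (c * i <= N)%N%:R * (tau i)%:R <= N%:R / c%:R * (1 + ln N%:R) :> R.
Proof.
move=> c0; rewrite (eq_bigr (fun i => (i <= N %/ c)%N%:R * ((tau i)%:R : R))); last first.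
  by move=> i _; rewrite leq_divRL // mulnC.
rewrite sum_cut ?leq_div //; apply: le_trans (sum_tau_le R _) _.
case: (posnP (N %/ c)) => [->|q0].
  by rewrite mul0r mulr_ge0 ?divr_ge0 // addr_ge0.
apply: ler_pM => //; first by rewrite addr_ge0 // ln_ge0 // ler1n.
  by rewrite ler_pdivlMr ?ltr0n // -natrM ler_nat leq_divM.
by rewrite lerD2l ler_ln ?posrE ?ltr0n // ler_nat leq_div.
Qed.

Lemma sum_wt_scaled (h : nat) : (0 < h)%N ->
  \sum_(1 <= m < N.+1) (h * m <= N)%N%:R * (wt z m)%:R <= N%:R / h%:R * F.
Proof.
move=> h0; have h0' : 0 < (h%:R : R) by rewrite ltr0n.
apply: (@le_trans _ _ (\sum_(1 <= m < N.+1) \sum_(1 <= e < N.+1)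
   (e %| m)%N%:R * ((smooth z e)%:R * (h * m <= N)%N%:R))).
  apply: ler_sum_nat => m hm; apply: le_trans (ler_wpM2l _ (wt_le_smooth_divisors R z hm)) _ => //.
  by rewrite mulr_sumr; apply: ler_sum_nat => e _; rewrite indicM le_eqVlt;
     apply/orP; left; apply/eqP; ring.
rewrite exchange_big_nat /=.
apply: (@le_trans _ _ (\sum_(1 <= e < N.+1) N%:R / h%:R * ((smooth z e && true)%:R / e%:R))); last first.
  by rewrite -mulr_sumr ler_wpM2l ?divr_ge0 // (sum_smooth_inv P3 hF (fun=> true)).
apply: ler_sum_nat => e /andP[e0 _]; rewrite sum_multiples // andbT.
apply: (@le_trans _ _ ((smooth z e)%:R * \sum_(1 <= i < N.+1) (h * e * i <= N)%N%:R)).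
  rewrite mulr_sumr; apply: ler_sum_nat => i _; rewrite mulnA ler_piMl ?indic_le1 ?mulr_ge0 //.
have he0 : (0 < h * e)%N by rewrite muln_gt0 h0.
apply: le_trans (ler_wpM2l _ (count_scaled he0)) _ => //.
by rewrite natrM invfM le_eqVlt; apply/orP; left; apply/eqP; ring.
Qed.

(** As in [fundamental_window], a smooth part above X contains a divisor d in (X, X P]; Rankin's
    bound is then summed over d. *)
Lemma sum_wt_tail (h : nat) : (0 < h)%N ->
  \sum_(1 <= n < N.+1) ((h * n <= N)%N && (X < (smpart z n)%:R)%R)%:R * (wt z n)%:R <=
  N%:R / h%:R * (1 + ln N%:R) * (rankin P X * F ^+ 2).
Proof.
move=> h0; have h0' : 0 < (h%:R : R) by rewrite ltr0n.
pose cd (d : nat) : bool := smooth z d && (X < d%:R <= X * P)%R.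
apply: (@le_trans _ _ (\sum_(1 <= n < N.+1) \sum_(1 <= d < N.+1)
   (d %| n)%N%:R * ((cd d)%:R * ((h * n <= N)%N%:R * (wt z n)%:R)))).
  apply: ler_sum_nat => n /andP[n0 nN]; rewrite indicM.
  have nonneg d : 0 <= (d %| n)%N%:R * ((cd d)%:R * ((h * n <= N)%N%:R * (wt z n)%:R)) :> R.
    by rewrite !mulr_ge0.
  case: (ltP X (smpart z n)%:R) => smn; last by rewrite mulr0 mul0r; apply: sumr_ge0 => d _.
  have [d [du Xd dXP]] := smooth_divisor_between (smpart_gt0 z n) (smpart_smooth z n) zP X1 smn.
  have dn : (d %| n)%N := dvdn_trans du (smpart_dvd z n).
  have d0 := dvdn_gt0 n0 dn.
  have sd : smooth z d := smooth_dvd (smpart_gt0 z n) du (smpart_smooth z n).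
  rewrite (bigD1_seq d) ?iota_uniq ?mem_index_iota //=; last first.
    by rewrite d0 ltnS (leq_trans (dvdn_leq n0 dn)).
  apply: ler_wpDr; first by apply: sumr_ge0.
  by rewrite dn /cd sd Xd dXP !mul1r mulr1.
rewrite exchange_big_nat /=.
apply: (@le_trans _ _ (\sum_(1 <= d < N.+1) (N%:R / h%:R * (1 + ln N%:R)) *
    ((smooth z d && ((X < d%:R)%R && (d%:R <= X * P)))%:R * ((wt z d)%:R / d%:R)))); last first.
  rewrite -mulr_sumr ler_wpM2l ?mulr_ge0 ?invr_ge0 ?addr_ge0 //.
  exact: (sum_smooth_tail P3 X1 hF (fun d => d%:R <= X * P)).
apply: ler_sum_nat => d /andP[d0 _]; rewrite sum_multiples // -/(cd d).
apply: (@le_trans _ _ ((cd d)%:R * (wt z d)%:R * \sum_(1 <= i < N.+1) (h * d * i <= N)%N%:R * (tau i)%:R)).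
  rewrite mulr_sumr; apply: ler_sum_nat => i /andP[i0 _]; rewrite mulnA.
  have w : (wt z (d * i))%:R <= (wt z d)%:R * (tau i)%:R :> R.
    rewrite -natrM ler_nat; apply: leq_trans (wtM_le z d0 i0) _.
    by rewrite leq_mul2l (wt_le_tau R) ?orbT.
  apply: (@le_trans _ _ ((cd d)%:R * ((h * d * i <= N)%N%:R * (wt z (d * i))%:R))).
    by rewrite ler_piMl ?indic_le1 // !mulr_ge0.
  rewrite -mulrA ler_wpM2l // [leRHS]mulrCA ler_wpM2l //.
have hd0 : (0 < h * d)%N by rewrite muln_gt0 h0.
apply: le_trans (ler_wpM2l _ (sum_tau_scaled hd0)) _; first by rewrite mulr_ge0.
by rewrite natrM invfM le_eqVlt; apply/orP; left; apply/eqP; ring.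
Qed.
End Counting.

(** * Removing the cutoff from the model *)

Section ModelTail.
Variable R : realType.
Variables (N z Yn : nat) (Q P X Lb F al : R).
Let M := Num.truncn Q.
Hypotheses (N0 : (0 < N)%N) (Q2 : 2 <= Q) (MN : (M <= N)%N).
Hypotheses (hY : 2 * N%:R / Q < Yn.+1%:R) (YM : (Yn <= M)%N).
Hypothesis hLb : 1 + ln (Yn.+2)%:R <= Lb.
Hypotheses (P3 : 3 <= P) (zP : z%:R <= P) (X1 : 1 <= X).
Hypothesis hF : \sum_(1 <= d < N.+1) sf (1 / ln P) z d <= F.
Hypothesis NQ : N%:R <= Q ^+ 2.

Let Q0 : 0 < Q. Proof. by have := Q2; lra. Qed.
Let Lb1 : 1 <= Lb.
Proof. by apply: le_trans hLb; rewrite lerDl ln_ge0 // ler1n. Qed.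
Let lN : 0 <= ln (N%:R : R). Proof. by rewrite ln_ge0 // ler1n. Qed.

Definition one (n : nat) : R := (n <= N)%N%:R.

(** Absolute values are affordable here: [wt] is at most [tau], and since N <= Q^2 the sum of tau
    over a window is at most 2 Q (2 + ln N). *)
Lemma sum_abs_kap_small (h n : nat) : (0 < h)%N -> (0 < n)%N -> (h * n <= N)%N ->
  \sum_(1 <= m < N.+1) (h * m <= N)%N%:R * `|kap N z Q h m n| <=
  480 * Lb ^+ 2 * Q * (2 + ln N%:R) * (wt z n)%:R.
Proof.
move=> h0 n0 hn; rewrite (@sum_pieces R N Yn Q n) => [|m hm jm]; last first.
  case: (leqP (h * m) N) => hmN; last by rewrite mul0r.
  by have [le _] := jj_le Q2 hY YM h0 hn hmN; rewrite ltnNge le in jm.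
apply: (@le_trans _ _ (\sum_(0 <= j < Yn.+2) 480 * Lb * Q * (2 + ln N%:R) * (wt z n)%:R * j.+1%:R^-1)); last first.
  rewrite -mulr_sumr; have h1 := sum_inv_succ hLb.
  have c0 : 0 <= 480 * Lb * Q * (2 + ln N%:R) * (wt z n)%:R.
    have Lb0 : 0 <= Lb by have := Lb1; lra.
    exact: (mulr_ge0 (mulr_ge0 (mulr_ge0 (mulr_ge0 (ler0n _ _) Lb0) (ltW Q0)) (addr_ge0 (ler0n _ _) lN)) (ler0n _ _)).
  apply: le_trans (ler_wpM2l c0 h1) _.
  by rewrite le_eqVlt; apply/orP; left; apply/eqP; ring.
apply: ler_sum_nat => j /andP[_ jY].
have piece (J : pred nat) : (forall m, J m -> jj Q n m = j) ->
   (forall c d : nat, J c -> J d -> (c <= d)%N -> d%:R - c%:R <= Q / 2) ->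
   \sum_(1 <= m < N.+1) (J m)%:R * ((h * m <= N)%N%:R * `|kap N z Q h m n|) <=
   240 * Lb * Q * (2 + ln N%:R) * (wt z n)%:R * j.+1%:R^-1.
  move=> Jj dJ; pose c : R := 120 * Lb * (wt z n)%:R / j.+1%:R.
  have c0 : 0 <= c by rewrite !mulr_ge0 ?invr_ge0 //; have := Lb1; lra.
  apply: (@le_trans _ _ (\sum_(1 <= m < N.+1) c * ((J m)%:R * (tau m)%:R))).
    apply: ler_sum_nat => m /andP[m0 _].
    case: (boolP (J m)) => Jm; last by rewrite !mul0r mulr0.
    case: (leqP (h * m) N) => hm; last by rewrite mul0r mulr0 mulr_ge0 // mulr_ge0.
    rewrite !mul1r kap_sym kap_jj // (Jj m Jm).
    have [jY' jh] := jj_le Q2 hY YM h0 hn hm; rewrite (Jj m Jm) in jY' jh.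
    apply: le_trans (kapj_le z MN YM hLb h0 n0 m0 jY' jh) _.
    rewrite [leLHS](_ : _ = c * (wt z m)%:R); last by rewrite /c; ring.
    by rewrite ler_wpM2l // ler_nat (wt_le_tau R).
  rewrite -mulr_sumr.
  have st := sum_tau_window N0 (ltW Q0) NQ (J := J).
  apply: le_trans (ler_wpM2l c0 (st _)) _.
    by move=> a d Ja Jd ad; apply: le_trans (dJ a d Ja Jd ad) _; have := Q0; lra.
  by rewrite /c le_eqVlt; apply/orP; left; apply/eqP; ring.
apply: le_trans (lerD (piece (pieceR Q n j) _ _) (piece (pieceL Q n j) _ _)) _.
- by move=> m /andP[_ /eqP].
- by move=> c d; apply: pieceR_diam.
- by move=> m /andP[_ /eqP].
- by move=> c d; apply: pieceL_diam.
by rewrite le_eqVlt; apply/orP; left; apply/eqP; ring.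
Qed.

Lemma sum_abs_kap_large (h n : nat) : (Yn < h)%N -> (h * n <= N)%N ->
  \sum_(1 <= m < N.+1) (h * m <= N)%N%:R * `|kap N z Q h m n| <= 8 * (N%:R / h%:R).
Proof.
move=> Yh hn; have h0 : (0 < h)%N by rewrite (leq_ltn_trans _ Yh).
apply: le_trans (ler_wpM2l _ (count_scaled R N h0)) => //.
rewrite mulr_sumr; apply: ler_sum_nat => m _; rewrite [leRHS]mulrC.
case: leqP => hm; last by rewrite !mul0r.
rewrite !mul1r (kap_large z Q2 hY Yh hm hn) normrN ger0_norm ?dphi_ge0 //.
have /andP[d1 d2] := divM_le MN h0; apply: dphi_le8 => //; exact: small_primes_prime.
Qed.

(** The model differs from the constant [al] only where the smooth part exceeds X, a sparse set over
    which n is summed while m is free. The constant is 2 (480 + 8): the ranges h <= Yn and h > Yn,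
    the second through the tail of 1/h^2, which turns N^2 into N Q. *)
Lemma model_tail :
  `|\sum_(1 <= h < N.+1) bhform N z Q h (model N z X al h) (model N z X al h)
    - al ^+ 2 * bform N z Q one one| <=
  976 * Lb ^+ 3 * (2 + ln N%:R) ^+ 2 * (N%:R * Q) * (rankin P X * F ^+ 2) * al ^+ 2.
Proof.
have F0 : 0 <= F by apply: le_trans hF; apply: sumr_nat_ge0 => d _; exact: sf_ge0.
pose W : R := (1 + ln N%:R) * (rankin P X * F ^+ 2).
have W0 : 0 <= W by rewrite mulr_ge0 ?addr_ge0 // mulr_ge0 ?exprn_ge0 // expR_ge0.
pose T (h : nat) : R := \sum_(1 <= n < N.+1) ((h * n <= N)%N && (X < (smpart z n)%:R)%R)%:R *
    \sum_(1 <= m < N.+1) (h * m <= N)%N%:R * `|kap N z Q h m n|.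
have YN : (Yn <= N)%N by apply: leq_trans MN.
have LQ0 : 0 <= 480 * Lb ^+ 2 * Q * (2 + ln N%:R).
  rewrite -2!mulrA; apply: (mulr_ge0 (ler0n _ _)); apply: mulr_ge0; first exact: sqr_ge0.
  by apply: mulr_ge0; [exact: ltW Q0 | have := lN; lra].
apply: (@le_trans _ _ (\sum_(1 <= h < N.+1) 2 * al ^+ 2 * T h)).
  rewrite /bform mulr_sumr -sumrB; apply: norm_sum_le_nat => h /andP[h0 _].
  pose f (n : nat) : R := al * one (h * n).
  have -> : al ^+ 2 * \sum_(1 <= m < N.+1) \sum_(1 <= n < N.+1) one (h * m) * one (h * n) * kap N z Q h m n =
     bhform N z Q h f f.
    rewrite /bhform mulr_sumr; apply: eq_bigr => m _; rewrite mulr_sumr; apply: eq_bigr => n _.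
    by rewrite /f; ring.
  rewrite distrC bhform_diff.
  apply: (@le_trans _ _ (\sum_(1 <= m < N.+1) \sum_(1 <= n < N.+1)
     2 * al ^+ 2 * (((h * n <= N)%N && (X < (smpart z n)%:R)%R)%:R * ((h * m <= N)%N%:R * `|kap N z Q h m n|)))).
    apply: norm_sum_le_nat => m _; rewrite mulr_sumr; apply: norm_sum_le_nat => n _.
    rewrite !normrM mulrA.
    have e1 : `|f m + model N z X al h m| <= 2 * `|al| * (h * m <= N)%N%:R.
      rewrite /f /model /one -mulrDr normrM [2 * _]mulrC -mulrA ler_wpM2l //.
      rewrite ger0_norm ?addr_ge0 ?mulr_ge0 //.
      by rewrite [leRHS]mulr_natl mulr2n lerD2l ler_piMl ?indic_le1.
    have e2 : `|f n - model N z X al h n| = `|al| * ((h * n <= N)%N && (X < (smpart z n)%:R)%R)%:R.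
      rewrite /f /model /one -mulrBr normrM; congr (_ * _).
      rewrite ltNge; case: (_ <= X); case: (_ <= N)%N; rewrite /= ?mul1r ?mul0r ?mulr0 ?subrr ?subr0 ?normr0 ?normr1 //.
    rewrite e2; apply: le_trans (ler_wpM2r _ (ler_wpM2r _ e1)) _ => //.
    have -> : al ^+ 2 = `|al| * `|al| by rewrite -expr2 real_normK ?num_real.
    by rewrite le_eqVlt; apply/orP; left; apply/eqP; ring.
  rewrite exchange_big_nat /= /T mulr_sumr; apply: ler_sum_nat => n _.
  by rewrite !mulr_sumr le_eqVlt; apply/orP; left; apply/eqP; apply: eq_bigr.
have T1 h : (0 < h)%N -> T h <= 480 * Lb ^+ 2 * Q * (2 + ln N%:R) * (N%:R / h%:R * W).
  move=> h0; pose c : R := 480 * Lb ^+ 2 * Q * (2 + ln N%:R).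
  have c0 : 0 <= c by exact: LQ0.
  rewrite -/c [N%:R / h%:R * W]mulrA; apply: le_trans (ler_wpM2l c0 (sum_wt_tail N0 P3 zP X1 hF h0)).
  rewrite mulr_sumr; apply: ler_sum_nat => n /andP[n0 _].
  case: (boolP (_ && _)) => [/andP[hn _]|_]; last by rewrite !mul0r mulr0.
  by rewrite !mul1r; apply: sum_abs_kap_small.
have T2 h : (Yn < h)%N -> T h <= 8 * (N%:R / h%:R) * (N%:R / h%:R * W).
  move=> Yh; have h0 : (0 < h)%N by rewrite (leq_ltn_trans _ Yh).
  pose c : R := 8 * (N%:R / h%:R).
  have c0 : 0 <= c by rewrite mulr_ge0 // divr_ge0.
  rewrite -/c [N%:R / h%:R * W]mulrA; apply: le_trans (ler_wpM2l c0 (sum_wt_tail N0 P3 zP X1 hF h0)).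
  rewrite mulr_sumr; apply: ler_sum_nat => n /andP[n0 _].
  case: (boolP (_ && _)) => [/andP[hn _]|_]; last by rewrite !mul0r mulr0.
  rewrite !mul1r; apply: le_trans (sum_abs_kap_large Yh hn) _.
  by rewrite -/c ler_peMr // ler1n wt_gt0.
pose A : R := 480 * Lb ^+ 2 * Q * (2 + ln N%:R) * (N%:R * W).
pose B : R := 8 * N%:R ^+ 2 * W.
have A0 : 0 <= A.
  rewrite /A; apply: mulr_ge0; last by rewrite mulr_ge0.
  exact: LQ0.
have al2 : 0 <= 2 * al ^+ 2 by apply: mulr_ge0 => //; exact: sqr_ge0.
have B0 : 0 <= B by rewrite /B; apply: mulr_ge0 => //; rewrite mulr_ge0 // exprn_ge0.
apply: (@le_trans _ _ (2 * al ^+ 2 * (A * \sum_(1 <= h < Yn.+1) h%:R^-1 +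
    B * \sum_(1 <= h < N.+1) (Yn.+1%:R <= h%:R :> R)%R%:R / h%:R ^+ 2))).
  rewrite -mulr_sumr; apply: ler_wpM2l => //.
  rewrite -(sum_cut _ YN) !mulr_sumr -big_split /=; apply: ler_sum_nat => h /andP[h0 _].
  have h0' : (h%:R : R) != 0 by rewrite pnatr_eq0 -lt0n.
  rewrite ler_nat; case: (leqP h Yn) => hY'.
    rewrite mul0r mulr0 addr0 mul1r; apply: le_trans (T1 h h0) _.
    by rewrite /A le_eqVlt; apply/orP; left; apply/eqP; ring.
  rewrite mul0r mulr0 add0r [_ / _]mul1r; apply: le_trans (T2 h hY') _.
  by rewrite /B le_eqVlt; apply/orP; left; apply/eqP; field.
have s1 : \sum_(1 <= h < Yn.+1) h%:R^-1 <= Lb.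
  apply: le_trans (harmonic_le R Yn) _; apply: le_trans hLb; rewrite lerD2l.
  case: (posnP Yn) => [->|Y0]; first by rewrite ln0 // ln_ge0 // ler1n.
  by rewrite ler_ln ?posrE ?ltr0n // ler_nat !leqW.
have s2 : \sum_(1 <= h < N.+1) (Yn.+1%:R <= h%:R :> R)%R%:R / h%:R ^+ 2 <= 2 / Yn.+1%:R :> R.
  by apply: sum_invsq_tail; rewrite ltr0n.
have s3 : N%:R / Yn.+1%:R <= Q / 2.
  have Y0 : 0 < (Yn.+1%:R : R) by rewrite ltr0n.
  by rewrite ler_pdivrMr // mulrAC ler_pdivlMr // -ler_pdivrMl // mulrC [N%:R * 2]mulrC ltW.
apply: le_trans (ler_wpM2l al2 (lerD (ler_wpM2l A0 s1) (ler_wpM2l B0 s2))) _.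
have l0 := lN.
have r0 : 0 <= rankin P X * F ^+ 2 by rewrite mulr_ge0 ?exprn_ge0 // expR_ge0.
have BE : B * (2 / Yn.+1%:R) = 16 * N%:R * W * (N%:R / Yn.+1%:R) by rewrite /B; ring.
have b1 : B * (2 / Yn.+1%:R) <= 8 * (N%:R * Q) * W.
  rewrite BE; apply: le_trans (ler_wpM2l _ s3) _; first by apply: mulr_ge0 => //; rewrite mulr_ge0.
  by rewrite le_eqVlt; apply/orP; left; apply/eqP; field.
have L3 : 1 <= Lb ^+ 3 * (2 + ln N%:R).
  rewrite -[leLHS]mulr1; apply: ler_pM => //; first exact: exprn_ege1.
  by lra.
have NQW : 0 <= N%:R * Q * W by apply: mulr_ge0 => //; apply: mulr_ge0 => //; exact: ltW.
have b2 : A * Lb + B * (2 / Yn.+1%:R) <= 488 * (Lb ^+ 3 * (2 + ln N%:R)) * (N%:R * Q * W).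
  have -> : 488 * (Lb ^+ 3 * (2 + ln N%:R)) * (N%:R * Q * W) =
     A * Lb + 8 * (Lb ^+ 3 * (2 + ln N%:R)) * (N%:R * Q * W) by rewrite /A; ring.
  rewrite lerD2l; apply: le_trans b1 _.
  rewrite -[leLHS]mulrA -[leRHS]mulrA ler_wpM2l // ler_peMl //.
apply: le_trans (ler_wpM2l al2 b2) _.
have W1 : W <= (2 + ln N%:R) * (rankin P X * F ^+ 2) by rewrite /W ler_wpM2r //; lra.
have c0 : 0 <= 976 * al ^+ 2 * (Lb ^+ 3 * (2 + ln N%:R)) * (N%:R * Q).
  apply: mulr_ge0; last by apply: mulr_ge0 => //; exact: ltW.
  by apply: mulr_ge0; [exact: (mulr_ge0 (ler0n _ _) (sqr_ge0 _)) | lra].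
rewrite [leLHS](_ : _ = 976 * al ^+ 2 * (Lb ^+ 3 * (2 + ln N%:R)) * (N%:R * Q) * W); last by ring.
apply: le_trans (ler_wpM2l c0 W1) _.
by rewrite le_eqVlt; apply/orP; left; apply/eqP; ring.
Qed.
End ModelTail.

(** * Variance of the constant sequence 1 *)

Section Integers.
Variable R : realType.

Lemma dvdn_subl_self (q d : nat) : (d <= q)%N -> (q %| q - d)%N = (q %| d)%N.
Proof.
move=> dq; case: (posnP q) => [q0|q0]; first by move: dq; rewrite q0 leqn0 => /eqP->.
by rewrite -[in RHS](subKn dq) [in RHS]dvdn_subr ?leq_subr.
Qed.

Lemma rprog1 (N q c : nat) : (0 < c <= q)%N ->
  rprog (fun=> 1 : R) N q c = ((N + (q - c)) %/ q)%:R.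
Proof.
move=> /andP[c0 cq]; have q0 : (0 < q)%N by apply: leq_trans cq.
rewrite /rprog; elim: N => [|N IH].
  rewrite big_geq // add0n divn_small //; clear - c0 cq; lia.
rewrite big_nat_recr //= IH mulr1 addSn divnS // natrD addrC; congr (_%:R + _).
congr nat_of_bool; rewrite -addSn.
case: (leqP c N.+1) => cN.
  have -> : (N.+1 + (q - c) = N.+1 - c + q)%N by clear - cN cq; lia.
  by rewrite dvdn_addl // eq_sym eqmod_shift.
rewrite eqmod_shift; last exact: ltnW.
have -> : (N.+1 + (q - c) = q - (c - N.+1))%N by clear - cN cq; lia.
by rewrite dvdn_subl_self //; clear - cq; lia.
Qed.

Lemma rprog1_split (N q c : nat) : (0 < c <= q)%N ->
  rprog (fun=> 1 : R) N q c = (N %/ q)%:R + (c <= N %% q)%N%:R.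
Proof.
move=> cq; rewrite rprog1 //; have /andP[c0 cq'] := cq.
have q0 : (0 < q)%N by apply: leq_trans cq'.
have sq : (N %% q < q)%N by rewrite ltn_pmod.
rewrite {1}(divn_eq N q) -addnA divnMDl // natrD; congr (_ + _%:R).
case: leqP => cs.
  have -> : (N %% q + (q - c) = (N %% q - c) + 1 * q)%N by clear - cs cq'; lia.
  rewrite divnDMl // divn_small //; clear - sq; lia.
by rewrite divn_small //; clear - cs cq' sq; lia.
Qed.

(** With s = N mod q, exactly s classes deviate from N/q by 1 - s/q and the other q - s by -s/q. *)
Lemma sum_sqr_rprog1 (N q : nat) : (0 < q)%N ->
  \sum_(1 <= c < q.+1) (rprog (fun=> 1 : R) N q c - N%:R / q%:R) ^+ 2 =
  (N %% q)%:R * (1 - (N %% q)%:R / q%:R).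
Proof.
move=> q0; have q0' : (q%:R : R) != 0 by rewrite pnatr_eq0 -lt0n.
set t := (N %/ q)%N; set s := (N %% q)%N.
have sq : (s <= q)%N by rewrite ltnW // ltn_pmod.
have NE : (N%:R : R) = t%:R * q%:R + s%:R by rewrite {1}(divn_eq N q) natrD natrM.
pose f : R := s%:R / q%:R.
transitivity (\sum_(1 <= c < q.+1) ((c <= s)%N%:R * (1 - 2 * f) + f ^+ 2)).
  apply: eq_big_nat => c hc; rewrite rprog1_split // NE -/t -/s.
  have -> : t%:R + (c <= s)%N%:R - (t%:R * q%:R + s%:R) / q%:R = (c <= s)%N%:R - f :> R.
    by rewrite /f; field.
  by case: (c <= s)%N => /=; ring.
rewrite big_split /= sum_cut // !big_const_nat !iter_addr_0 !subn1 /= -mulr_natl -[_ *+ q]mulr_natl.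
by rewrite /f; field.
Qed.

Lemma rprog1_near (N q c : nat) : (0 < c <= q)%N ->
  `|rprog (fun=> 1 : R) N q c - N%:R / q%:R| <= 1.
Proof.
move=> cq; rewrite rprog1_split //; have /andP[c0 cq'] := cq.
have q0 : (0 < q)%N by apply: leq_trans cq'.
have q0' : 0 < (q%:R : R) by rewrite ltr0n.
set s := (N %% q)%N.
have NE : (N%:R : R) = (N %/ q)%:R * q%:R + s%:R by rewrite {1}(divn_eq N q) natrD natrM.
have -> : (N %/ q)%:R + (c <= s)%N%:R - N%:R / q%:R = (c <= s)%N%:R - s%:R / q%:R :> R.
  by rewrite NE; field; rewrite gt_eqF.
have f0 : 0 <= (s%:R / q%:R : R) by rewrite divr_ge0.
have f1 : s%:R / q%:R <= 1 :> R by rewrite ler_pdivrMr // mul1r ler_nat ltnW // ltn_pmod.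
by rewrite ler_norml; apply/andP; split; case: (c <= s)%N => /=; lra.
Qed.

Lemma raver1_near (N q h : nat) : (0 < q)%N -> (h %| q)%N ->
  `|raver (fun=> 1 : R) N q h - N%:R / q%:R| <= 1.
Proof.
move=> q0 hq; rewrite /raver sum_indic.
have phi0 : 0 < ((totient (q %/ h))%:R : R).
  by rewrite ltr0n totient_gt0 divn_gt0 ?(dvdn_gt0 q0 hq) // dvdn_leq.
have cnt := count_gcd R q0 hq.
have -> : N%:R / q%:R = invphi R (q %/ h) * \sum_(1 <= c < q.+1) (gcdn c q == h)%:R * (N%:R / q%:R).
  by rewrite -mulr_suml cnt [RHS]mulrA /invphi mulVf ?mul1r // gt_eqF.
rewrite -mulrBr -sumrB normrM (ger0_norm (invphi_ge0 _ _)) /invphi.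
rewrite mulrC ler_pdivrMr // mul1r -cnt.
apply: norm_sum_le_nat => c hc; rewrite -mulrBr normrM ger0_norm //.
by rewrite ler_piMr // rprog1_near.
Qed.

Lemma count_avoids (ps : seq nat) (N : nat) (y : R) : uniq ps -> all prime ps -> 0 <= y -> y < N.+1%:R ->
  `|\sum_(1 <= i < N.+1) ((i%:R <= y)%R && avoids ps i)%:R - y * \prod_(p <- ps) (1 - p%:R^-1)| <= 2 ^+ size ps.
Proof.
elim: ps y => [|p ps IH] y.
  move=> _ _ y0 yN; rewrite big_nil mulr1 expr0.
  rewrite (eq_bigr (fun i => (i <= Num.truncn y)%N%:R * (1 : R))); last first.
    by move=> i _; rewrite /avoids /= andbT mulr1 truncn_ge_nat.
  rewrite sum_cut; last by rewrite -ltnS truncn_lt_nat.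
  rewrite big_const_nat iter_addr_0 subn1 /=.
  have /andP[a1 a2] := truncn_itv y0; rewrite -natr1 in a2.
  by rewrite ler_norml; apply/andP; split; lra.
move=> /= /andP[pps ups] /andP[pp aps] y0 yN.
have p0 := prime_gt0 pp; have p0' : 0 < (p%:R : R) by rewrite ltr0n.
have p1' : 1 <= (p%:R : R) by rewrite ler1n.
have yp : y / p%:R <= y by rewrite ler_pdivrMr // ler_peMr.
have h1 := IH y ups aps y0 yN.
have h2 := IH (y / p%:R) ups aps (divr_ge0 y0 (ltW p0')) (le_lt_trans yp yN).
have -> : \sum_(1 <= i < N.+1) ((i%:R <= y)%R && avoids (p :: ps) i)%:R =
   \sum_(1 <= i < N.+1) ((i%:R <= y)%R && avoids ps i)%:R -
   \sum_(1 <= i < N.+1) ((i%:R <= y / p%:R)%R && avoids ps i)%:R :> R.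
  apply/eqP; rewrite eq_sym subr_eq; apply/eqP.
  transitivity (\sum_(1 <= i < N.+1) ((i%:R <= y)%R && avoids (p :: ps) i)%:R +
    \sum_(1 <= i < N.+1) (p %| i)%N%:R * (((i%:R <= y)%R && avoids ps i)%:R : R)).
    rewrite -big_split /=; apply: eq_bigr => i _.
    by rewrite /avoids /=; case: (p %| i)%N; case: (_ <= y);
       case: (all _ _); rewrite /= ?mul0r ?mul1r ?addr0 ?add0r.
  congr (_ + _); rewrite sum_multiples //.
  apply: eq_bigr => i _; rewrite avoids_mulp // ler_pdivlMr // -[i%:R * p%:R]natrM [(i * p)%N]mulnC.
  case: (leP (p * i)%:R y) => /= iy; last by rewrite mulr0.
  rewrite (_ : (p * i <= N)%N = true) ?mul1r //.
  by rewrite -ltnS -(ltr_nat R); apply: le_lt_trans yN.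
rewrite big_cons; set c := \prod_(_ <- _) _ in h1 h2 *.
set a1 := \sum_(1 <= i < N.+1) _ in h1 *; set a2 := \sum_(1 <= i < N.+1) _ in h2 *.
have -> : a1 - a2 - y * ((1 - p%:R^-1) * c) = (a1 - y * c) - (a2 - y / p%:R * c) by ring.
apply: le_trans (ler_normB _ _) _; apply: le_trans (lerD h1 h2) _.
by rewrite exprS; lra.
Qed.

Lemma totient_prod (k : nat) : (0 < k)%N ->
  (totient k)%:R = k%:R * \prod_(p <- primes k) (1 - p%:R^-1) :> R.
Proof.
elim/ltn_ind: k => k IH k0; case: (ltnP 1 k) => k1; last first.
  have -> : k = 1%N by apply/eqP; rewrite eqn_leq k1.
  by rewrite big_nil mulr1.
have pp := pdiv_prime k1; set p := pdiv k in pp; have p0 := prime_gt0 pp.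
have kE : k = (p * (k %/ p))%N by rewrite mulnC divnK // pdiv_dvd.
set j := (k %/ p)%N in kE.
have j0 : (0 < j)%N by move: k0; rewrite kE muln_gt0 => /andP[].
have jk : (j < k)%N by rewrite kE ltn_Pmull // prime_gt1.
have p0' : (p%:R : R) != 0 by rewrite pnatr_eq0 -lt0n.
rewrite {1}kE totient_mulp //; case: (boolP (p %| j)%N) => pj.
  have perm : perm_eq (primes k) (primes j).
    apply: uniq_perm; rewrite ?primes_uniq // => q; rewrite kE primesM // primes_prime // inE.
    by case: eqP => //= ->; rewrite mem_primes pp j0 pj.
  by rewrite (perm_big _ perm) /= kE !natrM IH // mulrA.
have perm : perm_eq (primes k) (p :: primes j).
  apply: uniq_perm; rewrite /= ?primes_uniq ?mem_primes ?(negbTE pj) ?andbF // => q.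
  by rewrite kE primesM // (primes_prime pp) mem_seq1 in_cons.
rewrite (perm_big _ perm) big_cons /= kE !natrM IH //.
have -> : (p.-1%:R : R) = p%:R - 1 by rewrite -subn1 natrB.
by field.
Qed.

(** After division by h this is inclusion-exclusion over the primes of q/h; its 2^omega error is at
    most tau. *)
Lemma count_gcd_near (N q h : nat) : (0 < q)%N -> (h %| q)%N ->
  `|\sum_(1 <= n < N.+1) (gcdn n q == h)%:R - (totient (q %/ h))%:R * (N%:R / q%:R)| <= (tau (q %/ h))%:R :> R.
Proof.
move=> q0 hq; have h0 := dvdn_gt0 q0 hq; set k := (q %/ h)%N.
have qE : q = (h * k)%N by rewrite mulnC divnK.
have k0 : (0 < k)%N by move: q0; rewrite qE muln_gt0 => /andP[].
have h0' : 0 < (h%:R : R) by rewrite ltr0n.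
have k0' : 0 < (k%:R : R) by rewrite ltr0n.
have -> : \sum_(1 <= n < N.+1) (gcdn n q == h)%:R =
   \sum_(1 <= i < N.+1) ((i%:R <= N%:R / h%:R :> R)%R && avoids (primes k) i)%:R :> R.
  transitivity (\sum_(1 <= n < N.+1) (h %| n)%N%:R * ((gcdn n q == h)%:R : R)).
    apply: eq_bigr => n _; case: eqP => [gE|_]; last by rewrite mulr0.
    by rewrite -gE dvdn_gcdl mulr1.
  rewrite sum_multiples //; apply: eq_big_nat => i /andP[i0 _].
  rewrite qE -muln_gcdr -{3}[h]muln1 eqn_pmul2l // -natrM mulnb; congr (_%:R).
  congr nat_of_bool; congr (_ && _).
    by rewrite ler_pdivlMr // -natrM ler_nat mulnC.
  apply/idP/allP => [cop p|av].
    rewrite mem_primes => /and3P[pp _ pk]; apply/negP => pi.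
    by have := prime_coprime k pp; rewrite pk (coprime_dvdl pi cop).
  apply/negPn/negP => g1.
  have g0 : (0 < gcdn i k)%N by rewrite gcdn_gt0 k0 orbT.
  have g2 : (1 < gcdn i k)%N by rewrite ltn_neqAle eq_sym g1.
  have pp := pdiv_prime g2.
  have := av (pdiv (gcdn i k)); rewrite mem_primes pp k0 (dvdn_trans (pdiv_dvd _) (dvdn_gcdr _ _)).
  by rewrite (dvdn_trans (pdiv_dvd _) (dvdn_gcdl _ _)) => /(_ isT).
have aps : all prime (primes k) by apply/allP => p; rewrite mem_primes => /andP[].
have yN : N%:R / h%:R < N.+1%:R :> R.
  rewrite ltr_pdivrMr //; apply: (@lt_le_trans _ _ (N.+1%:R)); first by rewrite ltr_nat.
  by rewrite ler_peMr ?ler1n.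
have y0 : 0 <= N%:R / h%:R :> R by rewrite divr_ge0.
have := count_avoids (primes_uniq k) aps y0 yN.
rewrite totient_prod // qE natrM.
have -> : k%:R * \prod_(p <- primes k) (1 - p%:R^-1) * (N%:R / (h%:R * k%:R)) =
   N%:R / h%:R * \prod_(p <- primes k) (1 - p%:R^-1) :> R.
  by field; rewrite !gt_eqF.
move=> H; apply: le_trans H _.
have -> : primes k = small_primes k k.
  rewrite /small_primes; apply/esym/all_filterP/allP => p.
  by rewrite mem_primes => /and3P[_ _ /(dvdn_leq k0)].
by have := wt_le_tau R k k0; rewrite /wt -(ler_nat R) natrX.
Qed.

(** Pythagoras: the averages V are a projection of the counts, so the difference is the sum of (V -
    N/q)^2. As |V - N/q| <= 1, a square is at most |V - N/q|; the phi(q/h) classes of gcd h then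
    cancel the factor 1/phi(q/h) in the average and leave tau(q/h). *)
Lemma raver1_dev (N q : nat) : (0 < q)%N ->
  0 <= \sum_(1 <= c < q.+1) (rprog (fun=> 1 : R) N q c - N%:R / q%:R) ^+ 2 -
       \sum_(1 <= c < q.+1) (rprog (fun=> 1 : R) N q c - raver (fun=> 1) N q (gcdn c q)) ^+ 2
    <= \sum_(1 <= h < q.+1) (h %| q)%N%:R * (tau (q %/ h))%:R.
Proof.
move=> q0; pose b : nat -> R := fun=> 1.
pose mu : R := N%:R / q%:R; pose V c := raver b N q (gcdn c q).
have cross : \sum_(1 <= c < q.+1) (rprog b N q c - V c) * (V c - mu) = 0.
  rewrite (eq_bigr (fun c => \sum_(1 <= n < N.+1) devker R q c n * (V c - mu))); last first.
    by move=> c _; rewrite /V rprog_dev // mulr_suml; apply: eq_bigr => n _; rewrite mulr1.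
  rewrite exchange_big_nat /= big1 // => n _.
  transitivity (\sum_(1 <= c < q.+1) (c == n %[mod q])%:R * (V c - mu) -
     \sum_(1 <= c < q.+1) rho R q c n * (V c - mu)).
    by rewrite -sumrB; apply: eq_bigr => c _; rewrite /devker mulrBl.
  have Vmod c c' : c = c' %[mod q] -> V c - mu = V c' - mu by move=> h; rewrite /V (gcdn_mod_eq h).
  rewrite (sum_residue _ q0 Vmod).
  rewrite [X in _ - X](eq_bigr (fun c => (gcdn c q == gcdn n q)%:R * (invphi R (q %/ gcdn n q) * (V n - mu)))); last first.
    by move=> c _; rewrite /rho /V; case: eqP => [->|_]; rewrite ?mul0r // !mul1r.
  rewrite -mulr_suml count_gcd ?dvdn_gcdr // mulrA /invphi mulfV ?mul1r ?subrr //.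
  rewrite pnatr_eq0 -lt0n totient_gt0 divn_gt0 ?gcdn_gt0 ?q0 ?orbT //.
  by apply: dvdn_leq => //; apply: dvdn_gcdr.
have -> : \sum_(1 <= c < q.+1) (rprog b N q c - N%:R / q%:R) ^+ 2 -
       \sum_(1 <= c < q.+1) (rprog b N q c - raver b N q (gcdn c q)) ^+ 2 =
   \sum_(1 <= c < q.+1) (V c - mu) ^+ 2.
  have E : \sum_(1 <= c < q.+1) (rprog b N q c - mu) ^+ 2 =
     \sum_(1 <= c < q.+1) (rprog b N q c - V c) ^+ 2 + 2 * \sum_(1 <= c < q.+1) (rprog b N q c - V c) * (V c - mu)
     + \sum_(1 <= c < q.+1) (V c - mu) ^+ 2.
    by rewrite mulr_sumr -!big_split /=; apply: eq_bigr => c _; ring.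
  by rewrite -/mu E cross -/V; ring.
rewrite sumr_nat_ge0 => [|c _]; last exact: sqr_ge0.
apply: (@le_trans _ _ (\sum_(1 <= c < q.+1) \sum_(1 <= h < q.+1)
   (h == gcdn c q)%:R * `|raver b N q h - mu|)).
  apply: ler_sum_nat => c /andP[c0 _]; rewrite sum_pick.
  have -> : (1 <= gcdn c q <= q)%N.
    by rewrite gcdn_gt0 q0 orbT (dvdn_leq q0 (dvdn_gcdr _ _)).
  rewrite mul1r -real_normK ?num_real // expr2 ler_piMr //.
  by apply: raver1_near => //; apply: dvdn_gcdr.
rewrite exchange_big_nat /=; apply: ler_sum_nat => h /andP[h0 _].
case: (boolP (h %| q)%N) => hq; last first.
  rewrite mul0r big1 // => c _; case: eqP => [E|_]; last by rewrite mul0r.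
  by rewrite E dvdn_gcdr in hq.
rewrite mul1r -mulr_suml.
rewrite (eq_bigr (fun c => (gcdn c q == h)%:R)); last by move=> c _; rewrite eq_sym.
rewrite count_gcd //; set f := totient _.
have f0 : 0 < (f%:R : R).
  by rewrite ltr0n totient_gt0 divn_gt0 // dvdn_leq.
have -> : raver b N q h = f%:R^-1 * \sum_(1 <= n < N.+1) (gcdn n q == h)%:R.
  rewrite -{1}[h](_ : gcdn h q = h); last by apply/gcdn_idPl.
  rewrite raver_rho // mulr_sumr; apply: eq_bigr => n _.
  by rewrite /rho (gcdn_idPl hq) eq_sym mulr1 mulrC.
have -> : mu = f%:R^-1 * (f%:R * (N%:R / q%:R)) by rewrite mulKf // gt_eqF.
rewrite -mulrBr normrM normfV (gtr0_norm f0) mulVKf ?gt_eqF //.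
exact: count_gcd_near.
Qed.

Lemma sum_conv_tau (M : nat) :
  \sum_(1 <= q < M.+1) \sum_(1 <= h < q.+1) (h %| q)%N%:R * (tau (q %/ h))%:R <=
  M%:R * (1 + ln M%:R) ^+ 2 :> R.
Proof.
apply: (@le_trans _ _ (\sum_(1 <= q < M.+1) \sum_(1 <= h < M.+1) (h %| q)%N%:R * ((tau (q %/ h))%:R : R))).
  apply: ler_sum_nat => q /andP[_ qM]; rewrite [leRHS](@big_cat_nat _ _ _ q.+1) //=.
  by rewrite lerDl; apply: sumr_nat_ge0 => h _; rewrite mulr_ge0.
rewrite (sum_divisor_pairs M (fun _ k => (tau k)%:R : R)).
case: (posnP M) => [->|M0]; first by rewrite big_geq // mul0r.
have l0 : 0 <= 1 + ln (M%:R : R) by rewrite addr_ge0 // ln_ge0 // ler1n.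
apply: (@le_trans _ _ (\sum_(1 <= h < M.+1) (M%:R * (1 + ln M%:R)) * h%:R^-1)); last first.
  rewrite -mulr_sumr expr2 mulrA ler_wpM2l ?mulr_ge0 //; exact: harmonic_le.
apply: ler_sum_nat => h /andP[h0 _].
rewrite (eq_bigr (fun i => (i <= M %/ h)%N%:R * ((tau i)%:R : R))); last first.
  by move=> i _; rewrite leq_divRL // mulnC.
rewrite sum_cut ?leq_div //; apply: le_trans (sum_tau_le R _) _; rewrite mulrAC.
case: (posnP (M %/ h)) => [->|q0]; first by rewrite mul0r !mulr_ge0 ?invr_ge0.
apply: ler_pM => //; first by rewrite addr_ge0 // ln_ge0 // ler1n.
  by rewrite ler_pdivlMr ?ltr0n // -natrM ler_nat leq_divM.
by rewrite lerD2l ler_ln ?posrE ?ltr0n // ler_nat leq_div.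
Qed.

Lemma rV_one (N : nat) (Q : R) :
  `|rV (fun=> 1 : R) N Q - \sum_(1 <= q < (Num.truncn Q).+1 | Q / 2 < q%:R)
      (N %% q)%:R * (1 - (N %% q)%:R / q%:R)| <=
  (Num.truncn Q)%:R * (1 + ln (Num.truncn Q)%:R) ^+ 2.
Proof.
apply: le_trans (sum_conv_tau _); rewrite /rV [X in X - _]sum_indic [X in _ - X]sum_indic -sumrB.
apply: norm_sum_le_nat => q /andP[q0 _]; rewrite -mulrBr normrM ger0_norm //.
apply: le_trans (ler_piMl _ (indic_le1 _ _)) _ => //.
have := raver1_dev N q0; rewrite sum_sqr_rprog1 // => /andP[d1 d2].
by rewrite distrC ger0_norm.
Qed.
End Integers.

(** * The Riemann sum and the integral of {v} (1 - {v}) / v^3 *)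

Section Integral.
Variable R : realType.

Definition saw (v : R) : R := fracpart v * (1 - fracpart v).

Lemma fracpart_itv (v : R) : 0 <= fracpart v < 1.
Proof.
rewrite /fracpart subr_ge0 floor_le_tmp /= ltrBlDl.
by have := floorD1_gt v; rewrite intrD.
Qed.

Lemma saw_itv (v : R) : 0 <= saw v <= 1.
Proof.
have /andP[f0 f1] := fracpart_itv v; rewrite /saw.
by apply/andP; split; [apply: mulr_ge0; lra | nra].
Qed.

(** Within a unit interval the difference quotient is {u} + {v} - 1 up to sign. Across an integer,
    saw u <= 1 - {u} and saw v <= {v}, and 1 - {u} + {v} <= v - u. *)
Lemma saw_lip (u v : R) : u <= v -> `|saw u - saw v| <= v - u.
Proof.
move=> uv; have /andP[fu0 fu1] := fracpart_itv u; have /andP[fv0 fv1] := fracpart_itv v.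
have uE : u = (Num.floor u)%:~R + fracpart u by rewrite /fracpart; ring.
have vE : v = (Num.floor v)%:~R + fracpart v by rewrite /fracpart; ring.
have := le_floor uv; rewrite le_eqVlt => /orP[/eqP fE|].
  have d : v - u = fracpart v - fracpart u by rewrite {1}vE {1}uE fE; ring.
  have -> : saw u - saw v = (v - u) * (fracpart u + fracpart v - 1) by rewrite d /saw; ring.
  rewrite normrM ger0_norm ?subr_ge0 // ler_piMr ?subr_ge0 //.
  by rewrite ler_norml; apply/andP; split; lra.
rewrite -lezD1 -(ler_int R) intrD => fl.
have d : (1 - fracpart u) + fracpart v <= v - u by rewrite [X in _ <= X - _]vE [X in _ <= _ - X]uE; lra.
apply: le_trans d; rewrite /saw ler_norml; apply/andP; split; nra.
Qed.

Lemma saw_dist (u v : R) : `|saw u - saw v| <= `|u - v|.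
Proof.
case: (leP u v) => uv.
  by rewrite [X in _ <= X]distrC [X in _ <= X]ger0_norm ?subr_ge0 // saw_lip.
by rewrite distrC [X in _ <= X]ger0_norm ?subr_ge0; [apply: saw_lip; exact: ltW | exact: ltW].
Qed.

Lemma saw_ratio (N q : nat) : (0 < q)%N ->
  q%:R * saw (N%:R / q%:R) = (N %% q)%:R * (1 - (N %% q)%:R / q%:R).
Proof.
move=> q0; have q0' : 0 < (q%:R : R) by rewrite ltr0n.
have NE : (N%:R : R) / q%:R = (N %/ q)%:R + (N %% q)%:R / q%:R.
  by rewrite {1}(divn_eq N q) natrD natrM; field; rewrite gt_eqF.
have s0 : 0 <= ((N %% q)%:R / q%:R : R) by rewrite divr_ge0.
have s1 : (N %% q)%:R / q%:R < 1 :> R by rewrite ltr_pdivrMr // mul1r ltr_nat ltn_pmod.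
have fl : Num.floor (N%:R / q%:R : R) = (N %/ q)%N :> int.
  apply: floor_def; rewrite intrD !pmulrn NE lerDl s0 /=; lra.
have fE : fracpart (N%:R / q%:R : R) = (N %% q)%:R / q%:R.
  by rewrite /fracpart fl NE -pmulrn; ring.
by rewrite /saw fE; field; rewrite gt_eqF.
Qed.

Local Open Scope classical_set_scope.

Definition sawint (v : R) : R := saw v / v ^+ 3.

Lemma saw_continuous : continuous (saw : R -> R).
Proof.
move=> x; apply/cvgrPdist_lt => e e0; near=> t.
apply: le_lt_trans (saw_dist _ _) _; near: t.
exact: (@cvgr_dist_lt _ R^o _ _ _ id x).
Unshelve. all: by end_near. Qed.

Lemma sawint_integrable (a b : R) : 0 < a ->
  (@lebesgue_measure R).-integrable `[a, b] (EFin \o sawint).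
Proof.
move=> a0; apply: continuous_compact_integrable; first exact: segment_compact.
apply: continuous_in_subspaceT => v; rewrite inE /= in_itv /= => /andP[av _].
apply: continuousM; first exact: saw_continuous.
apply: continuousV; first by rewrite expf_neq0 // gt_eqF // (lt_le_trans a0).
exact: exprn_continuous.
Qed.

Definition sawI (a b : R) : R := \int[lebesgue_measure]_(v in `[a, b]) sawint v.

Lemma sawI_split (a b c : R) : 0 < a -> a <= b -> b <= c -> sawI a c = sawI a b + sawI b c.
Proof.
move=> a0 ab bc; have I := sawint_integrable c a0.
have := @Rintegral_itvB R sawint (BLeft a) (BRight c) b I.
rewrite !bnd_simp => /(_ ab bc); rewrite Rintegral_itv_obnd_cbnd => [E|].
  by rewrite /sawI -E; ring.
apply: integrableS I => //; apply: subset_itvr; by rewrite bnd_simp.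
Qed.

Lemma sawI_near (a b c e : R) : 0 < a -> a <= b ->
  (forall v, a <= v <= b -> `|sawint v - c| <= e) -> `|sawI a b - c * (b - a)| <= e * (b - a).
Proof.
move=> a0 ab h; have I := sawint_integrable b a0.
have mu : fine (@lebesgue_measure R `[a, b]) = b - a.
  rewrite lebesgue_measure_itv /= lte_fin; case: ltP => [//|ba] /=.
  by apply/eqP; rewrite eq_sym subr_eq0 eq_le ba ab.
have cI k : (@lebesgue_measure R).-integrable `[a, b] (EFin \o (fun=> k : R)).
  apply: continuous_compact_integrable; first exact: segment_compact.
  by apply: continuous_subspaceT => v; exact: cvg_cst.
have cE k : \int[@lebesgue_measure R]_(_ in `[a, b]) k = k * (b - a) by rewrite Rintegral_cst // mu.
have up : sawI a b <= (c + e) * (b - a).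
  rewrite -cE; apply: le_Rintegral => // v; rewrite /= in_itv /= => /h; rewrite ler_norml; lra.
have lo : (c - e) * (b - a) <= sawI a b.
  rewrite -cE; apply: le_Rintegral => // v; rewrite /= in_itv /= => /h; rewrite ler_norml; lra.
by rewrite ler_norml; apply/andP; split; lra.
Qed.

Lemma sawI_small (a b : R) : 0 < a -> a <= b -> `|sawI a b| <= (b - a) / a ^+ 3.
Proof.
move=> a0 ab; rewrite -[sawI a b]subr0 -[X in _ - X](mul0r (b - a)) [leRHS]mulrC.
apply: sawI_near => // v /andP[av _]; have /andP[s0 s1] := saw_itv v.
have v0 : 0 < v := lt_le_trans a0 av.
rewrite subr0 /sawint ger0_norm; last by rewrite divr_ge0 // exprn_ge0 // ltW.
apply: (@le_trans _ _ (v ^+ 3)^-1); first by rewrite ler_piMl // invr_ge0 exprn_ge0 // ltW.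
by rewrite lef_pV2 ?posrE ?exprn_gt0 // lerXn2r // nnegrE ltW.
Qed.

(** Under v = x/t this compares the integral of t saw(x/t) over [q, q + 1] with its value at t = q.
    Instead of a change of variables, the integrand is compared with the constant k^2 (k + 1) g /
    x^3, whose product with the length x/(k (k + 1)) is exactly k g / x^2. *)
Lemma sawI_piece (x : R) (q : nat) : 0 < x -> (0 < q)%N ->
  `|x ^+ 2 * sawI (x / q.+1%:R) (x / q%:R) - q%:R * saw (x / q%:R)| <= 4 * (x / q%:R) + 7.
Proof.
move=> x0 q0; rewrite -natr1; set k : R := q%:R.
have k1 : 1 <= k by rewrite /k ler1n.
have k0 : 0 < k by lra.
have kp : 0 < k + 1 by lra.
have ab : x / (k + 1) <= x / k by rewrite ler_pM2l // lef_pV2 ?posrE // lerDl.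
have a0 : 0 < x / (k + 1) by rewrite divr_gt0.
set g := saw (x / k); have /andP[g0 g1] := saw_itv (x / k).
have dE : x / k - x / (k + 1) = x / (k * (k + 1)) by field; rewrite !gt_eqF.
have D0 : 0 < x / (k * (k + 1)) by rewrite divr_gt0 // mulr_gt0.
have x3 : 0 < x ^+ 3 by rewrite exprn_gt0.
have := @sawI_near (x / (k + 1)) (x / k) (k ^+ 2 * (k + 1) * g / x ^+ 3)
   ((x * (k + 1) ^+ 2 / k + (3 * k ^+ 2 + 3 * k + 1)) / x ^+ 3) a0 ab.
rewrite dE => H.
have {H} : `|sawI (x / (k + 1)) (x / k) - k ^+ 2 * (k + 1) * g / x ^+ 3 * (x / (k * (k + 1)))|
   <= (x * (k + 1) ^+ 2 / k + (3 * k ^+ 2 + 3 * k + 1)) / x ^+ 3 * (x / (k * (k + 1))).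
  apply: H => v /andP[av vb]; have v0 : 0 < v := lt_le_trans a0 av.
  pose w := x ^+ 3 / v ^+ 3.
  have -> : sawint v - k ^+ 2 * (k + 1) * g / x ^+ 3 =
     ((saw v - g) * w + g * (w - k ^+ 2 * (k + 1))) / x ^+ 3.
    by rewrite /w /sawint; field; rewrite !gt_eqF.
  have xv0 : 0 < x / v by rewrite divr_gt0.
  have w1 : k ^+ 3 <= w.
    rewrite /w -expr_div_n; apply: lerXn2r; rewrite ?nnegrE ?(ltW k0) ?(ltW xv0) //.
    by rewrite ler_pdivlMr // mulrC -ler_pdivlMr.
  have w2 : w <= (k + 1) ^+ 3.
    rewrite /w -expr_div_n; apply: lerXn2r; rewrite ?nnegrE ?(ltW kp) ?(ltW xv0) //.
    by rewrite ler_pdivrMr // mulrC -ler_pdivrMr.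
  rewrite normrM [X in _ * X]ger0_norm ?invr_ge0 ?(ltW x3) // ler_pM2r ?invr_gt0 //.
  apply: le_trans (ler_normD _ _) _; rewrite [X in X + _]normrM [X in _ + X]normrM.
  have w0 : 0 <= w by apply: le_trans w1; rewrite exprn_ge0 // ltW.
  apply: lerD.
    have -> : x * (k + 1) ^+ 2 / k = x / (k * (k + 1)) * (k + 1) ^+ 3.
      by field; rewrite !gt_eqF.
    apply: ler_pM => //; last by rewrite ger0_norm.
    rewrite -dE; apply: le_trans (saw_lip vb) _; lra.
  rewrite (ger0_norm g0) -[leRHS]mul1r; apply: ler_pM => //.
  have e1 : (k + 1) ^+ 3 = k ^+ 3 + 3 * k ^+ 2 + 3 * k + 1 by ring.
  have e2 : k ^+ 2 * (k + 1) = k ^+ 3 + k ^+ 2 by ring.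
  have k20 := sqr_ge0 k.
  by rewrite ler_norml e2; apply/andP; split; lra.
set Jv := sawI _ _; move=> H.
have -> : x ^+ 2 * Jv - k * g =
   x ^+ 2 * (Jv - k ^+ 2 * (k + 1) * g / x ^+ 3 * (x / (k * (k + 1)))).
  by field; rewrite !gt_eqF.
rewrite normrM ger0_norm ?sqr_ge0 //; apply: le_trans (ler_wpM2l (sqr_ge0 x) H) _.
have -> : x ^+ 2 * ((x * (k + 1) ^+ 2 / k + (3 * k ^+ 2 + 3 * k + 1)) / x ^+ 3 * (x / (k * (k + 1)))) =
   x / k * (1 + k^-1) + (3 + (k * (k + 1))^-1).
  by field; rewrite !gt_eqF.
have kv : k^-1 <= 1 by rewrite invf_le1.
have xk : 0 < x / k by rewrite divr_gt0.
have kk : (k * (k + 1))^-1 <= 1 by rewrite invf_le1 ?mulr_gt0 //; nra.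
nra.
Qed.

Lemma sawI_sum (x : R) (h M : nat) : 0 < x -> (0 < h)%N -> (h <= M)%N ->
  `|x ^+ 2 * sawI (x / M%:R) (x / h%:R) - \sum_(h <= q < M) q%:R * saw (x / q%:R)| <=
  \sum_(h <= q < M) (4 * (x / h%:R) + 7).
Proof.
move=> x0 h0; have h0' : 0 < (h%:R : R) by rewrite ltr0n.
elim: M => [|M IH]; first by rewrite leqn0 => /eqP E; rewrite E in h0.
rewrite leq_eqVlt => /orP[/eqP <-|]; last rewrite ltnS => hM.
  rewrite !big_geq // subr0 normrM ger0_norm ?sqr_ge0 //.
  apply: le_trans (ler_wpM2l (sqr_ge0 x) (sawI_small _ (lexx _))) _; first exact: divr_gt0.
  by rewrite subrr mul0r mulr0.
have M0 : (0 < M)%N by apply: leq_trans hM.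
have M0' : 0 < (M%:R : R) by rewrite ltr0n.
rewrite big_nat_recr //= [leRHS]big_nat_recr //=.
have p0 : 0 < x / M.+1%:R by rewrite divr_gt0 ?ltr0n.
have p1 : x / M.+1%:R <= x / M%:R by rewrite ler_pM2l // lef_pV2 ?posrE ?ltr0n // ler_nat.
have p2 : x / M%:R <= x / h%:R by rewrite ler_pM2l // lef_pV2 ?posrE // ler_nat.
rewrite (sawI_split p0 p1 p2).
set s := \sum_(_ <= _ < _) _ in IH *; set j1 := sawI _ (x / M%:R); set j2 := sawI _ _ in IH *.
have -> : x ^+ 2 * (j1 + j2) - (s + M%:R * saw (x / M%:R)) =
  (x ^+ 2 * j2 - s) + (x ^+ 2 * j1 - M%:R * saw (x / M%:R)) by ring.
apply: le_trans (ler_normD _ _) _; apply: lerD; first exact: IH.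
apply: le_trans (sawI_piece x0 M0) _; lra.
Qed.

(** The complete pieces are those with h < q < M. The two incomplete end intervals cost 2 Q each and
    the term q = M costs Q, which with 15 x for the pieces gives 20 x. *)
Lemma sawI_main (x Q : R) : 2 <= Q -> Q <= x ->
  `|x ^+ 2 * sawI (x / Q) (2 * x / Q) - \sum_(1 <= q < (Num.truncn Q).+1 | Q / 2 < q%:R) q%:R * saw (x / q%:R)|
  <= 20 * x.
Proof.
move=> Q2 Qx; have Q0 : 0 < Q by lra.
have x0 : 0 < x by lra.
set M := Num.truncn Q; set h := Num.truncn (Q / 2).
have /andP[M1 M2] : M%:R <= Q < M.+1%:R by rewrite truncn_itv // ltW.
have Qh0 : 0 <= Q / 2 by lra.
have /andP[h1 h2] : h%:R <= Q / 2 < h.+1%:R by rewrite truncn_itv.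
have M1' : (1 <= M)%N by rewrite /M truncn_ge_nat; lra.
have hM : (h.+1 <= M)%N.
  by rewrite /M truncn_ge_nat ?(ltW Q0) // -natr1; lra.
have -> : \sum_(1 <= q < M.+1 | Q / 2 < q%:R) q%:R * saw (x / q%:R) =
   \sum_(h.+1 <= q < M) q%:R * saw (x / q%:R) + M%:R * saw (x / M%:R).
  rewrite -big_nat_recr //= (@big_cat_nat _ _ _ h.+1) //=; last by rewrite ltnW.
  rewrite big_nat_cond big1 ?add0r => [|q /andP[/andP[_ qh] hq]]; last first.
    exfalso; move: qh; rewrite ltnS -(ler_nat R) => qh; lra.
  rewrite big_nat_cond [RHS]big_nat_cond; apply: eq_bigl => q.
  rewrite andbT; case: (boolP (h < q < M.+1)%N) => //= /andP[hq _].
  by apply: lt_le_trans h2 _; rewrite ler_nat.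
have M0' : 0 < (M%:R : R) by rewrite ltr0n.
have H0' : 0 < (h.+1%:R : R) by rewrite ltr0n.
have p0 : 0 < x / Q by rewrite divr_gt0.
have p1 : x / Q <= x / M%:R by rewrite ler_pM2l // lef_pV2 ?posrE.
have p2 : x / M%:R <= x / h.+1%:R by rewrite ler_pM2l // lef_pV2 ?posrE // ler_nat.
have p3 : x / h.+1%:R <= 2 * x / Q.
  by rewrite -mulrA mulrCA ler_pM2l // -[2]invrK -invfM lef_pV2 ?posrE ?mulr_gt0 ?invr_gt0 // mulrC ltW.
rewrite (sawI_split p0 (le_trans p1 p2) p3) (sawI_split p0 p1 p2).
have b0 := sawI_sum x0 (ltn0Sn h) hM.
have b1 := sawI_small p0 p1; have b2 := sawI_small (lt_le_trans p0 (le_trans p1 p2)) p3.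
have /andP[s0 s1] := saw_itv (x / M%:R).
set S := \sum_(_ <= _ < _) _ in b0 *.
set j1 := sawI _ _ in b1 *; set j2 := sawI _ _ in b0 *; set j3 := sawI _ _ in b2 *.
have -> : x ^+ 2 * (j1 + j2 + j3) - (S + M%:R * saw (x / M%:R)) =
   (x ^+ 2 * j2 - S) + x ^+ 2 * j1 + x ^+ 2 * j3 - M%:R * saw (x / M%:R) by ring.
have c0 : `|x ^+ 2 * j2 - S| <= 15 * x.
  apply: le_trans b0 _; rewrite big_const_nat iter_addr_0 -[leLHS]mulr_natr.
  have hk : x / h.+1%:R <= x / (Q / 2) by rewrite ler_pM2l // lef_pV2 ?posrE //; clear - Q0 h2; lra.
  have Md : (M - h.+1)%:R <= Q by apply: le_trans M1; rewrite ler_nat leq_subr.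
  apply: (@le_trans _ _ ((4 * (x / (Q / 2)) + 7) * Q)).
    have t0 : 0 < x / h.+1%:R by rewrite divr_gt0.
    move: (x / h.+1%:R) (x / (Q / 2)) hk t0 => u w uw u0.
    by apply: ler_pM => //; clear - uw u0; lra.
  have -> : (4 * (x / (Q / 2)) + 7) * Q = 8 * x + 7 * Q by field; rewrite gt_eqF.
  by clear - Qx; lra.
have MQ : Q <= 2 * M%:R by move: M2 M1'; rewrite -natr1 -(ler_nat R); lra.
have c1 : `|x ^+ 2 * j1| <= 2 * Q.
  rewrite normrM ger0_norm ?sqr_ge0 //; apply: le_trans (ler_wpM2l (sqr_ge0 x) b1) _.
  have -> : x ^+ 2 * ((x / M%:R - x / Q) / (x / Q) ^+ 3) = (Q - M%:R) * (Q / M%:R) * Q.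
    by field; rewrite !gt_eqF.
  have q1 : Q / M%:R <= 2 by rewrite ler_pdivrMr.
  have q0 : 0 < Q / M%:R by rewrite divr_gt0.
  rewrite ler_pM2r //; apply: le_trans q1; rewrite ler_piMl ?ltW //.
  by move: M2; rewrite -natr1; clear; lra.
have c2 : `|x ^+ 2 * j3| <= 2 * Q.
  rewrite normrM ger0_norm ?sqr_ge0 //; apply: le_trans (ler_wpM2l (sqr_ge0 x) b2) _.
  set H : R := h.+1%:R in H0' *.
  have -> : x ^+ 2 * ((2 * x / Q - x / H) / (x / H) ^+ 3) = (2 * H - Q) * (H ^+ 2 / Q).
    by field; rewrite !gt_eqF.
  have HE : H = h%:R + 1 by rewrite /H natr1.
  have HQ : H <= Q by clear - HE h1 Q2; lra.
  have q1 : H ^+ 2 / Q <= Q by rewrite ler_pdivrMr // -expr2 lerXn2r // nnegrE ltW.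
  have q0 : 0 <= H ^+ 2 / Q by rewrite divr_ge0 ?sqr_ge0 // ltW.
  have d0 : 0 <= 2 * H - Q by move: h2; rewrite -/H; clear; lra.
  by apply: ler_pM => //; clear - HE h1; lra.
have c3 : `|M%:R * saw (x / M%:R)| <= Q.
  by rewrite (ger0_norm (mulr_ge0 (ltW M0') s0)); apply: le_trans M1; exact: (ler_piMr (ltW M0') s1).
apply: le_trans (ler_normB _ _) _; apply: le_trans (lerD (ler_normD _ _) c3) _.
apply: (@le_trans _ _ (15 * x + 2 * Q + 2 * Q + Q)); last by clear - Qx; lra.
by rewrite !lerD // (le_trans (ler_normD _ _)) // lerD.
Qed.

(** Passing from the integer part of x to x changes each term by at most 1, by the Lipschitz bound,
    and there are at most Q <= x terms. *)
Lemma mod_sum_integral (x Q : R) : 2 <= Q -> Q <= x ->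
  `|\sum_(1 <= q < (Num.truncn Q).+1 | Q / 2 < q%:R)
      (Num.truncn x %% q)%:R * (1 - (Num.truncn x %% q)%:R / q%:R) -
    x ^+ 2 * \int[lebesgue_measure]_(v in [set` `[x / Q, 2 * x / Q]%R])
              (fracpart v * (1 - fracpart v) / v ^+ 3)| <= 21 * x.
Proof.
move=> Q2 Qx; have x0 : 0 < x by lra.
have := sawI_main Q2 Qx.
set I := x ^+ 2 * _; set S := \sum_(_ <= _ < _ | _) _ => H.
set N := Num.truncn x; set S' := \sum_(_ <= _ < _ | _) _.
change (`|S' - I| <= 21 * x).
have -> : S' - I = (S' - S) - (I - S) by ring.
apply: le_trans (ler_normB _ _) _.
apply: (@le_trans _ _ (x + 20 * x)); last lra.
apply: lerD => //.
have /andP[N1 N2] : N%:R <= x < N.+1%:R by rewrite truncn_itv // ltW.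
apply: (@le_trans _ _ (Num.truncn Q)%:R); last first.
  have Q0 : 0 <= Q by lra.
  by apply: le_trans Qx; have /andP[] := truncn_itv Q0.
rewrite /S /S' [X in X - _]sum_indic [X in _ - X]sum_indic -sumrB.
apply: (@le_trans _ _ (\sum_(1 <= q < (Num.truncn Q).+1) 1)); last first.
  by rewrite big_const_nat iter_addr_0 subn1.
apply: norm_sum_le_nat => q /andP[q0 _]; rewrite -mulrBr normrM ger0_norm //.
apply: le_trans (ler_piMl _ (indic_le1 _ _)) _ => //.
have q0' : 0 < (q%:R : R) by rewrite ltr0n.
rewrite -saw_ratio // -mulrBr normrM ger0_norm ?ler0n //.
apply: le_trans (ler_wpM2l (ltW q0') (saw_dist _ _)) _.
rewrite -mulrBl normrM [X in _ * (_ * X)]ger0_norm ?invr_ge0 ?ler0n // mulrCA mulfV ?gt_eqF // mulr1.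
by move: N2; rewrite -natr1 ler_norml => N2; apply/andP; split; lra.
Qed.
End Integral.

(** * Collecting the error terms for a real sequence *)

Lemma cauchy_schwarz_nat (R : realType) (M : nat) (u v : nat -> R) :
  (\sum_(1 <= i < M) u i * v i) ^+ 2 <=
  (\sum_(1 <= i < M) u i ^+ 2) * (\sum_(1 <= i < M) v i ^+ 2).
Proof.
have h : 0 <= \sum_(1 <= i < M) \sum_(1 <= j < M) (u i * v j - u j * v i) ^+ 2.
  by apply: sumr_nat_ge0 => i _; apply: sumr_nat_ge0 => j _; exact: sqr_ge0.
have E : \sum_(1 <= i < M) \sum_(1 <= j < M) (u i * v j - u j * v i) ^+ 2 =
  \sum_(1 <= i < M) \sum_(1 <= j < M) (u i ^+ 2 * v j ^+ 2) +
  \sum_(1 <= i < M) \sum_(1 <= j < M) (v i ^+ 2 * u j ^+ 2) -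
  2 * \sum_(1 <= i < M) \sum_(1 <= j < M) ((u i * v i) * (u j * v j)).
  rewrite mulr_sumr -big_split -sumrB /=; apply: eq_bigr => i _.
  by rewrite mulr_sumr -big_split -sumrB /=; apply: eq_bigr => j _; ring.
move: h; rewrite E -!big_distrlr /= -expr2.
by rewrite [X in _ + X - _]mulrC; lra.
Qed.

Section RealSequence.
Variable R : realType.
Variables (x Q P X K1 K2 K3 KY c : R) (b s : nat -> R).
Let N := Num.truncn x.
Let z := Num.truncn P.
Let Yn := Num.truncn (2 * x / Q).
Let M := Num.truncn Q.
Let L := ln x.
Let l := ln (P * x / Q).
Let S := \sum_(1 <= n < N.+1) s n.
Let A := \sum_(1 <= n < N.+1) b n.
Let T := \sum_(1 <= n < N.+1) s n * (tau3 n)%:R.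
Let Tt := \sum_(1 <= n < N.+1) s n * (tau3_trunc (P * x / Q) n)%:R.
Let r := rankin P X.
Let al := A / x.
Let k1 := S / (x * K1).
Let k2 := S / K2.
Let k3 := K3 * S / x.
Hypotheses (Q2 : 2 <= Q) (Qx : Q <= x) (xQ : 2 * x < Q ^+ 2).
Hypotheses (P3 : 3 <= P) (PX : P <= X) (Xx : X * P <= x).
Hypotheses (K1_gt0 : 0 < K1) (K2_gt0 : 0 < K2) (K3_ge1 : 1 <= K3) (KY_gt0 : 0 < KY).
Hypothesis c1 : 1 <= c.
Hypothesis hc : \sum_(1 <= d < N.+1) sf (1 / ln P) z d <= c * ln P.
Hypotheses (bs : forall n, `|b n| <= s n) (s_supp : forall n, (N < n)%N -> s n = 0).
Hypothesis conc : \sum_(1 <= h < M.+1) (2 * x / Q <= h%:R)%R%:R * (\sum_(1 <= n < N.+1) (h %| n)%N%:R * s n) ^+ 2 <= S ^+ 2 / KY.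
Hypothesis resembles1 : forall h c d : nat, (0 < h)%N -> (0 < c <= d)%N -> (h * d <= N)%N ->
  `|\sum_(1 <= n < N.+1) ((c <= n <= d)%N && roughn z n)%:R * (b (h * n)%N - al)| <=
  (d%:R - c%:R) * k1 + k2.
Hypothesis resembles2 : forall h c d : nat, (0 < h)%N -> (0 < c <= d)%N -> (h * d <= N)%N ->
  \sum_(1 <= n < N.+1) (c <= n <= d)%N%:R * (s (h * n)%N * (tau n)%:R) <=
  (d%:R - c%:R) * k3 + k2.

Let Q0 : 0 < Q. Proof. by have := Q2; lra. Qed.
Let P0 : 0 < P. Proof. by have := P3; lra. Qed.
Let x2 : 2 <= x. Proof. by have := Q2; have := Qx; lra. Qed.
Let x0 : 0 < x. Proof. by have := x2; lra. Qed.
Let x3 : 3 <= x.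
Proof.
apply: le_trans Xx; apply: le_trans P3 _; rewrite ler_peMl ?(ltW P0) //.
by have := P3; have := PX; lra.
Qed.
Let Nx : N%:R <= x. Proof. by have /andP[] := truncn_itv (ltW x0). Qed.
Let xN : x < N.+1%:R. Proof. by have /andP[] := truncn_itv (ltW x0). Qed.
Let N0 : (0 < N)%N. Proof. by rewrite /N truncn_ge_nat; have := x2; lra. Qed.
Let N0' : 0 < (N%:R : R). Proof. by rewrite ltr0n. Qed.
Let Y0 : 0 <= 2 * x / Q. Proof. by rewrite divr_ge0 ?mulr_ge0 ?(ltW Q0) ?(ltW x0). Qed.
Let Yx : Yn%:R <= 2 * x / Q. Proof. by have /andP[] := truncn_itv Y0. Qed.
Let xY : 2 * x / Q < Yn.+1%:R. Proof. by have /andP[] := truncn_itv Y0. Qed.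
Let hY : 2 * N%:R / Q < Yn.+1%:R.
Proof.
by apply: le_lt_trans xY; rewrite ler_pM2r ?invr_gt0 // ler_pM2l.
Qed.
Let zP : z%:R <= P. Proof. by have /andP[] := truncn_itv (ltW P0). Qed.
Let MQ : M%:R <= Q. Proof. by have /andP[] := truncn_itv (ltW Q0). Qed.
Let MN : (M <= N)%N.
Proof. by rewrite /N truncn_ge_nat ?(ltW x0) //; apply: le_trans MQ Qx. Qed.
Let YM : (Yn <= M)%N.
Proof.
rewrite /M truncn_ge_nat ?(ltW Q0) //; apply: le_trans Yx _.
by rewrite ler_pdivrMr // -expr2 ltW.
Qed.
Let NQ : N%:R <= Q ^+ 2. Proof. by have := Nx; have := xQ; have := x2; lra. Qed.
Let X1 : 1 <= X. Proof. by have := P3; have := PX; lra. Qed.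
Let u1 : 1 <= x / Q. Proof. by rewrite ler_pdivlMr // mul1r. Qed.
Let PxQ3 : 3 <= P * x / Q. Proof. by rewrite -mulrA; have := u1; have := P3; nra. Qed.
Let ln31 := ln3_gt1 R.
Let l1 : 1 <= l.
Proof.
apply: le_trans (ltW ln31) _; rewrite ler_ln ?posrE //; have := PxQ3; lra.
Qed.
Let L1 : 1 <= L.
Proof. by apply: le_trans (ltW ln31) _; rewrite ler_ln ?posrE. Qed.
Let lnP1 : 1 <= ln P.
Proof. by apply: le_trans (ltW ln31) _; rewrite ler_ln ?posrE. Qed.
Let lnPl : ln P <= l.
Proof.
rewrite ler_ln ?posrE //; last by have := PxQ3; lra.
by rewrite -mulrA ler_peMr // ltW.
Qed.
Let lnN : ln (N%:R : R) <= L. Proof. by rewrite ler_ln ?posrE. Qed.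
Let lnN0 : 0 <= ln (N%:R : R). Proof. by rewrite ln_ge0 // ler1n. Qed.
(** With u = x/Q >= 1 and P >= 3 one has Yn + 2 <= 2 u + 2 <= (P u)^2, so every logarithm of Yn is
    expressed by l. *)
Let hLb : 1 + ln (Yn.+2)%:R <= 3 * l.
Proof.
have e : (Yn.+2%:R : R) <= (P * x / Q) ^+ 2.
  have -> : (Yn.+2%:R : R) = Yn%:R + 2 by rewrite -addn2 natrD.
  have h1 := Yx; have h2 := u1; have h3 := P3; rewrite -!mulrA in h1 *.
  set u := x / Q in h1 h2 *.
  have h4 : 3 * u <= P * u by apply: ler_wpM2r => //; lra.
  rewrite expr2; nra.
have : ln (Yn.+2%:R : R) <= 2 * l.
  rewrite mulr_natl -lnXn; last by have := PxQ3; lra.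
  by rewrite ler_ln ?posrE ?ltr0n // exprn_gt0 //; have := PxQ3; lra.
by have := l1; lra.
Qed.
Let s0 n : 0 <= s n. Proof. exact: le_trans (bs n). Qed.
Let S0 : 0 <= S. Proof. by apply: sumr_nat_ge0 => n _. Qed.
Let ST : S <= T.
Proof.
apply: ler_sum_nat => n /andP[n0 _]; rewrite ler_peMr // ler1n; exact: tau3_gt0.
Qed.
Let STt : S <= Tt.
Proof.
apply: ler_sum_nat => n /andP[n0 _]; rewrite ler_peMr // ler1n; exact: tau3_trunc_gt0.
Qed.
Let T0 : 0 <= T. Proof. exact: le_trans ST. Qed.
Let Tt0 : 0 <= Tt. Proof. exact: le_trans STt. Qed.
Let r0 : 0 <= r. Proof. exact: rankin_ge0. Qed.
Let k1_ge0 : 0 <= k1. Proof. by rewrite divr_ge0 // mulr_ge0 // ltW. Qed.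
Let k2_ge0 : 0 <= k2. Proof. by rewrite divr_ge0 // ltW. Qed.
Let K30 : 0 <= K3. Proof. by have := K3_ge1; lra. Qed.
Let k3_ge0 : 0 <= k3. Proof. by rewrite divr_ge0 ?mulr_ge0 // ltW. Qed.
Let c0 : 0 <= c. Proof. by have := c1; lra. Qed.
Let l0 : 0 <= l. Proof. by have := l1; lra. Qed.
Let L0 : 0 <= L. Proof. by have := L1; lra. Qed.
Let F := c * ln P.
Let F0 : 0 <= F. Proof. by rewrite mulr_ge0 //; have := lnP1; lra. Qed.
Let Fl : F <= c * l. Proof. by rewrite ler_wpM2l. Qed.
Let F2 : F ^+ 2 <= c ^+ 2 * l ^+ 2.
Proof. by rewrite -exprMn lerXn2r // nnegrE // mulr_ge0. Qed.

Let al_le : `|al| * x <= S.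
Proof.
rewrite /al normrM [`|x^-1|]ger0_norm ?invr_ge0 ?(ltW x0) // mulfVK ?gt_eqF //.
exact: norm_sum_le_nat.
Qed.
Let al_leN (h : R) : 0 < h -> `|al| * (N%:R / h) <= S / h.
Proof.
move=> h0; rewrite mulrA ler_pM2r ?invr_gt0 //; apply: le_trans al_le.
by rewrite ler_wpM2l.
Qed.

Let X0 : 0 < X. Proof. by have := X1; lra. Qed.
Let xplL : xpl P X <= 2 * (X * P) * L.
Proof.
have XP0 : 0 < X * P by rewrite mulr_gt0.
have lX : ln (X * P) <= L by rewrite ler_ln ?posrE.
rewrite /xpl [leRHS](_ : _ = X * P * (2 * L)); last by ring.
by rewrite ler_pM2l //; have := L1; lra.
Qed.
Let xpl0 : 0 <= xpl P X. Proof. exact: xpl_ge0. Qed.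

Let Sh (h : nat) : R := \sum_(1 <= n < N.+1) (h %| n)%N%:R * s n.
Let Sh_scaled (h : nat) : (0 < h)%N -> \sum_(1 <= m < N.+1) s (h * m)%N = Sh h.
Proof.
move=> h0; rewrite /Sh; have := sum_multiples_supp (fun=> 1 : R) h0 s_supp.
under eq_bigr do rewrite mulr1; move=> ->.
by apply: eq_bigr => m _; rewrite mulr1.
Qed.
Let Sh0 h : 0 <= Sh h. Proof. by apply: sumr_nat_ge0 => n _; rewrite mulr_ge0. Qed.

Let sum_Sh : \sum_(1 <= h < M.+1) Sh h <= T.
Proof.
apply: (@le_trans _ _ (\sum_(1 <= h < N.+1) Sh h)).
  rewrite [leRHS](@big_cat_nat _ _ _ M.+1) //=.
  by rewrite lerDl; apply: sumr_nat_ge0 => h _.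
rewrite /Sh exchange_big_nat /=; apply: ler_sum_nat => n /andP[n0 nN].
rewrite -mulr_suml mulrC ler_wpM2l // -tau_sum ?n0 // ler_nat; exact: tau_le_tau3.
Qed.

(** As a convolution over n this is dominated both by T and by Tt; the truncated version is used in
    the K_int^(1) term and the full one in the terms carrying log^3 x. *)
Let T3 : R := \sum_(1 <= h < Yn.+1) \sum_(1 <= m < N.+1) s (h * m)%N * (wt z m)%:R.

Let T3E : T3 = \sum_(1 <= n < N.+1) s n * \sum_(1 <= h < Yn.+1) (h %| n)%N%:R * (wt z (n %/ h))%:R.
Proof.
rewrite /T3 (eq_big_nat _ _ (F2 := fun h => \sum_(1 <= m < N.+1) (h %| m)%N%:R * (s m * (wt z (m %/ h))%:R))); last first.
  by move=> h /andP[h0 _]; rewrite (sum_multiples_supp (fun m => (wt z m)%:R) h0 s_supp).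
rewrite exchange_big_nat /=; apply: eq_bigr => n _; rewrite mulr_sumr.
by apply: eq_bigr => h _; ring.
Qed.

Let T3T : T3 <= T.
Proof.
rewrite T3E; apply: ler_sum_nat => n /andP[n0 nN]; rewrite ler_wpM2l //.
have hn : (0 < n <= N)%N by rewrite n0.
apply: (@le_trans _ _ (\sum_(h <- divisors n) (wt z (n %/ h))%:R)); last first.
  by rewrite -natr_sum ler_nat; exact: wt_conv_le_tau3.
rewrite (sum_divisors _ hn) [leRHS](@big_cat_nat _ _ _ Yn.+1) //=; last by rewrite ltnS (leq_trans YM).
by rewrite lerDl; apply: sumr_nat_ge0 => h _; rewrite mulr_ge0.
Qed.

(** Both h <= 2x/Q and the primes counted by [wt] stay below P x / Q, since P >= 3 and Q <= x; this
    is the origin of the truncation level in tau3. *)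
Let T3Tt : T3 <= Tt.
Proof.
rewrite T3E; apply: ler_sum_nat => n /andP[n0 nN]; rewrite ler_wpM2l //.
have hn : (0 < n <= N)%N by rewrite n0.
have y0 : 0 <= P * x / Q by have := PxQ3; lra.
set B := Num.truncn (P * x / Q).
have zB : (z <= B)%N.
  rewrite /B truncn_ge_nat //; apply: le_trans zP _.
  by rewrite -mulrA ler_peMr // ltW.
have YB : (Yn <= B)%N.
  rewrite /B truncn_ge_nat //; apply: le_trans Yx _; rewrite -!mulrA ler_wpM2r //.
    by have := u1; lra.
  by have := P3; lra.
rewrite tau3_trunc_nat // -/B.
apply: (@le_trans _ _ (\sum_(h <- divisors n | smooth B h) (wt B (n %/ h))%:R)); last first.
  by rewrite -natr_sum ler_nat; exact: wt_conv_le_trunc.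
rewrite [leRHS]sum_indic (sum_divisors _ hn) [leRHS](@big_cat_nat _ _ _ Yn.+1) //=; last by rewrite ltnS (leq_trans YM).
apply: ler_wpDr; first by apply: sumr_nat_ge0 => h _; rewrite !mulr_ge0.
apply: ler_sum_nat => h /andP[h0 hYn]; rewrite ler_wpM2l //.
have -> : smooth B h.
  apply/allP => p; rewrite mem_primes => /and3P[_ _ /(dvdn_leq h0) ph].
  by apply: leq_trans ph (leq_trans _ YB).
by rewrite mul1r ler_nat wt_mono.
Qed.

Let W : R := \sum_(1 <= h < Yn.+1) \sum_(1 <= m < N.+1)
  (s (h * m)%N + `|al| * (h * m <= N)%N%:R) * (wt z m)%:R.

(** The model part contributes two logarithms, c l from the sum of [wt] over m and 3 l from the sum
    of 1/h. *)
Let W_le (U : R) : T3 <= U -> S <= U -> W <= 4 * c * l ^+ 2 * U.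
Proof.
move=> TU SU; have U0 : 0 <= U by apply: le_trans SU.
have WE : W = T3 + \sum_(1 <= h < Yn.+1) `|al| * \sum_(1 <= m < N.+1) (h * m <= N)%N%:R * (wt z m)%:R.
  rewrite /W /T3 -big_split /=; apply: eq_bigr => h _; rewrite mulr_sumr -big_split /=.
  by apply: eq_bigr => m _; ring.
have c2 : \sum_(1 <= h < Yn.+1) `|al| * \sum_(1 <= m < N.+1) (h * m <= N)%N%:R * (wt z m)%:R <= S * (c * l) * (3 * l).
  apply: (@le_trans _ _ (\sum_(1 <= h < Yn.+1) (S * (c * l)) * h%:R^-1)).
    apply: ler_sum_nat => h /andP[h0 _]; have h0' : 0 < (h%:R : R) by rewrite ltr0n.
    apply: le_trans (ler_wpM2l _ (sum_wt_scaled P3 hc h0)) _ => //.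
    rewrite [leLHS]mulrA [leRHS]mulrAC; apply: ler_pM => //; first [exact: al_leN | by apply: mulr_ge0 => //; apply: divr_ge0].
  rewrite -mulr_sumr; apply: ler_wpM2l; first by rewrite mulr_ge0 // mulr_ge0.
  apply: le_trans (harmonic_le R Yn) _; apply: le_trans hLb; rewrite lerD2l.
  case: (posnP Yn) => [->|Y1]; first by rewrite ln0 // ln_ge0 // ler1n.
  by rewrite ler_ln ?posrE ?ltr0n // ler_nat; clear; lia.
have c3 : S * (c * l) * (3 * l) <= 3 * c * l ^+ 2 * U.
  rewrite [leLHS](_ : _ = 3 * c * l ^+ 2 * S); last by ring.
  by apply: ler_wpM2l => //; apply: mulr_ge0; [apply: mulr_ge0 | exact: sqr_ge0].
have c4 : U <= c * l ^+ 2 * U.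
  by rewrite ler_peMl // -[leLHS]mulr1 ler_pM // exprn_ege1.
by rewrite WE; lra.
Qed.

Let W0 : 0 <= W.
Proof.
apply: sumr_nat_ge0 => h _; apply: sumr_nat_ge0 => m _.
by apply: mulr_ge0 => //; apply: addr_ge0 => //; apply: mulr_ge0.
Qed.

(** The three shapes of the last error term of the theorem: [Ua] for K_int^(1), [Ub] for the Rankin
    tail with K_int^(3), [Uc] for K_int^(2). *)
Let Ua := S * (Q / (x * K1) * Tt).
Let Ub := S * (Q * K3 * r / x) * T.
Let Uc := S * (X * P / K2) * T.
Let Ua0 : 0 <= Ua.
Proof. by apply: mulr_ge0 => //; apply: mulr_ge0 => //; apply: divr_ge0; [exact: ltW|apply: mulr_ge0; exact: ltW]. Qed.
Let Ub0 : 0 <= Ub.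
Proof.
apply: mulr_ge0 => //; apply: mulr_ge0 => //; apply: divr_ge0; last exact: ltW.
by apply: mulr_ge0 => //; apply: mulr_ge0 => //; exact: ltW.
Qed.
Let Uc0 : 0 <= Uc.
Proof.
apply: mulr_ge0 => //; apply: mulr_ge0 => //; apply: divr_ge0; last exact: ltW.
by apply: mulr_ge0; exact: ltW.
Qed.

Let pow_le (i j : nat) (U : R) : 0 <= U -> (i <= 6)%N -> (j <= 3)%N -> l ^+ i * L ^+ j * U <= l ^+ 6 * L ^+ 3 * U.
Proof.
move=> U0 i6 j3; apply: ler_wpM2r => //; apply: ler_pM; rewrite ?exprn_ge0 //.
  exact: ler_weXn2l.
exact: ler_weXn2l.
Qed.
Let c_le (i : nat) (U : R) : 0 <= U -> (i <= 3)%N -> c ^+ i * U <= c ^+ 3 * U.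
Proof. by move=> U0 i3; apply: ler_wpM2r => //; exact: ler_weXn2l. Qed.

(** The power l^6 is l^2 from [Lb], l^2 from F^2 and l^2 from W. The largest constant is 240 * 9 *
    16 = 34560, attached to [Uc]. *)
Let partA : \sum_(1 <= h < Yn.+1) 240 * (3 * l) ^+ 2 * omega1 Q P X F k1 k2 k3 *
     \sum_(1 <= m < N.+1) (s (h * m)%N + `|al| * (h * m <= N)%N%:R) * (wt z m)%:R <=
  (346 * 100) * c ^+ 3 * (l ^+ 6 * Ua + l ^+ 6 * L ^+ 3 * (Ub + Uc)).
Proof.
rewrite -mulr_sumr -/W /omega1 -/r.
have Wa := W_le T3Tt STt; have Wb := W_le T3T ST.
have q0 : 0 <= Q / 2 by have := Q0; lra.
have F20 := sqr_ge0 F.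
have p1 : Q / 2 * k1 * (F ^+ 2 * W) <= 2 * c ^+ 3 * l ^+ 4 * Ua.
  apply: (@le_trans _ _ (Q / 2 * k1 * ((c ^+ 2 * l ^+ 2) * (4 * c * l ^+ 2 * Tt)))).
    by apply: ler_wpM2l; [exact: mulr_ge0 | apply: ler_pM].
  by rewrite le_eqVlt; apply/orP; left; apply/eqP; rewrite /Ua /k1; field; rewrite !gt_eqF.
have p2 : Q / 2 * (k3 * r) * (F ^+ 2 * W) <= 2 * c ^+ 3 * l ^+ 4 * Ub.
  apply: (@le_trans _ _ (Q / 2 * (k3 * r) * ((c ^+ 2 * l ^+ 2) * (4 * c * l ^+ 2 * T)))).
    by apply: ler_wpM2l; [apply: mulr_ge0 => //; exact: mulr_ge0 | apply: ler_pM].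
  by rewrite le_eqVlt; apply/orP; left; apply/eqP; rewrite /Ub /k3; field; rewrite !gt_eqF.
have p3 : 2 * k2 * (xpl P X * W) <= 16 * c * l ^+ 2 * L * Uc.
  apply: (@le_trans _ _ (2 * k2 * ((2 * (X * P) * L) * (4 * c * l ^+ 2 * T)))).
    by apply: ler_wpM2l; [exact: mulr_ge0 | apply: ler_pM].
  by rewrite le_eqVlt; apply/orP; left; apply/eqP; rewrite /Uc /k2; field; rewrite !gt_eqF.
have l20 := sqr_ge0 l.
rewrite [leLHS](_ : _ = (216 * 10) * l ^+ 2 * (Q / 2 * k1 * (F ^+ 2 * W) + Q / 2 * (k3 * r) * (F ^+ 2 * W) +
    2 * k2 * (xpl P X * W))); last by ring.
apply: (@le_trans _ _ ((216 * 10) * l ^+ 2 * (2 * c ^+ 3 * l ^+ 4 * Ua + 2 * c ^+ 3 * l ^+ 4 * Ub + 16 * c * l ^+ 2 * L * Uc))).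
  apply: ler_wpM2l; [exact: (mulr_ge0 (mulr_ge0 (ler0n _ _) (ler0n _ _)) l20) | exact: (lerD (lerD p1 p2) p3)].
rewrite [leLHS](_ : _ = (432 * 10) * (c ^+ 3 * (l ^+ 6 * Ua)) + (432 * 10) * (c ^+ 3 * (l ^+ 6 * L ^+ 0 * Ub)) +
   (3456 * 10) * (c ^+ 1 * (l ^+ 4 * L ^+ 1 * Uc))); last by ring.
have l60 : 0 <= l ^+ 6 by apply: exprn_ge0.
have L30 : 0 <= L ^+ 3 by apply: exprn_ge0.
have c30 : 0 <= c ^+ 3 by apply: exprn_ge0.
have v1 := @pow_le 6 0 Ub Ub0 isT isT; have v2 := @pow_le 4 1 Uc Uc0 isT isT.
have v2' : c ^+ 1 * (l ^+ 4 * L ^+ 1 * Uc) <= c ^+ 3 * (l ^+ 6 * L ^+ 3 * Uc).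
  apply: (le_trans (ler_wpM2l (exprn_ge0 1 c0) v2)); apply: c_le => //.
  by apply: mulr_ge0 => //; apply: mulr_ge0.
have v1' := ler_wpM2l c30 v1.
have w1 : 0 <= c ^+ 3 * (l ^+ 6 * Ua) by apply: mulr_ge0 => //; apply: mulr_ge0.
have w2 : 0 <= c ^+ 3 * (l ^+ 6 * L ^+ 3 * Ub) by apply: mulr_ge0 => //; apply: mulr_ge0 => //; apply: mulr_ge0.
have w3 : 0 <= c ^+ 3 * (l ^+ 6 * L ^+ 3 * Uc) by apply: mulr_ge0 => //; apply: mulr_ge0 => //; apply: mulr_ge0.
rewrite [leRHS](_ : _ = (346 * 100) * (c ^+ 3 * (l ^+ 6 * Ua)) + (346 * 100) * (c ^+ 3 * (l ^+ 6 * L ^+ 3 * Ub)) +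
   (346 * 100) * (c ^+ 3 * (l ^+ 6 * L ^+ 3 * Uc))); last by ring.
lra.
Qed.

Let E3 := S ^+ 2 * (ln P / K1 * Num.sqrt (Q / (x * KY))).

Let tail_invsq : \sum_(1 <= h < M.+1) (Yn < h)%N%:R / (h%:R ^+ 2 : R) <= Q / x.
Proof.
have y0 : 0 < 2 * x / Q by rewrite divr_gt0 // mulr_gt0.
have := sum_invsq_tail M y0.
have -> : 2 / (2 * x / Q) = Q / x by field; rewrite !gt_eqF.
apply: le_trans; apply: ler_sum_nat => h _; apply: ler_wpM2r; first by rewrite invr_ge0 sqr_ge0.
rewrite ler_nat; case: (leqP h Yn) => // Yh.
by rewrite (le_trans (ltW xY)) // ler_nat.
Qed.

(** Cauchy-Schwarz separates [Sh] from 1/h: non-concentration at 2x/Q bounds one factor and the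
    inverse-square tail Q/x the other. *)
Let tail_cs : \sum_(1 <= h < M.+1) (Yn < h)%N%:R * (Sh h / h%:R) <= S * Num.sqrt (Q / (x * KY)).
Proof.
have qx0 : 0 <= Q / (x * KY) by rewrite divr_ge0 ?(ltW Q0) // mulr_ge0 ?ltW.
set Z := \sum_(_ <= _ < _) _.
have Z0 : 0 <= Z by apply: sumr_nat_ge0 => h _; apply: mulr_ge0 => //; apply: divr_ge0.
rewrite -(@ler_pXn2r _ 2) ?nnegrE //; last by apply: mulr_ge0 => //; exact: sqrtr_ge0.
rewrite exprMn sqr_sqrtr //.
have -> : Z = \sum_(1 <= h < M.+1) ((Yn < h)%N%:R * Sh h) * ((Yn < h)%N%:R / h%:R).
  apply: eq_bigr => h _; case: (Yn < h)%N => /=; ring.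
apply: le_trans (cauchy_schwarz_nat _ _ _) _.
have -> : S ^+ 2 * (Q / (x * KY)) = (S ^+ 2 / KY) * (Q / x) by field; rewrite !gt_eqF.
apply: ler_pM; try by apply: sumr_nat_ge0 => h _; exact: sqr_ge0.
  apply: le_trans conc; apply: ler_sum_nat => h _; rewrite exprMn; apply: ler_wpM2r; first exact: sqr_ge0.
  case: (leqP h Yn) => /= Yh; first by rewrite expr2 mul0r.
  by rewrite expr1n (le_trans (ltW xY)) // ler_nat.
apply: le_trans tail_invsq; apply: ler_sum_nat => h _; rewrite expr_div_n.
by apply: ler_wpM2r; [rewrite invr_ge0 sqr_ge0 | case: (Yn < h)%N; rewrite /= ?expr1n // expr2 mul0r].
Qed.

(** The factor N/h of [omega2] is kept in the k1 term, where [tail_cs] exploits it, and replaced by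
    Q/2 in the k3 term. The k3 and k2 terms then only need the plain sum of [Sh], which is at most
    T. *)
Let partB : \sum_(1 <= h < M.+1) (Yn < h)%N%:R * (8 * omega2 N P X F k1 k2 k3 h *
     \sum_(1 <= m < N.+1) (s (h * m)%N + `|al| * (h * m <= N)%N%:R)) <=
  8 * c * E3 + 128 * c ^+ 3 * (l ^+ 6 * Ua + l ^+ 6 * L ^+ 3 * (Ub + Uc)).
Proof.
have F20 := sqr_ge0 F.
pose e1 := 8 * (N%:R * k1 * F).
pose e2 := 8 * (Q / 2 * k3 * r * F ^+ 2 + 2 * k2 * xpl P X).
have e10 : 0 <= e1 by apply: mulr_ge0 => //; apply: mulr_ge0 => //; apply: mulr_ge0.
have q0 : 0 <= Q / 2 by have := Q0; lra.
have kr0 : 0 <= k3 * r * F ^+ 2 by apply: mulr_ge0 => //; apply: mulr_ge0.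
have e20 : 0 <= e2.
  apply: mulr_ge0 => //; apply: addr_ge0; last by apply: mulr_ge0 => //; apply: mulr_ge0.
  by apply: mulr_ge0 => //; apply: mulr_ge0 => //; apply: mulr_ge0.
apply: (@le_trans _ _ (\sum_(1 <= h < M.+1)
   (e1 * ((Yn < h)%N%:R * (Sh h / h%:R)) + e1 * S * ((Yn < h)%N%:R / h%:R ^+ 2) +
    e2 * Sh h + e2 * S * h%:R^-1))).
  apply: ler_sum_nat => h /andP[h0 _]; have h0' : 0 < (h%:R : R) by rewrite ltr0n.
  have t0 : 0 <= e2 * Sh h by apply: mulr_ge0.
  have t1 : 0 <= e2 * S * h%:R^-1 by apply: mulr_ge0; [apply: mulr_ge0 | rewrite invr_ge0].
  case: (leqP h Yn) => Yh; first by rewrite !mul0r !mulr0 !add0r; apply: addr_ge0.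
  rewrite !mul1r big_split /= Sh_scaled // -mulr_sumr.
  have v : Sh h + `|al| * \sum_(1 <= i < N.+1) (h * i <= N)%N%:R <= Sh h + S / h%:R.
    rewrite lerD2l; apply: le_trans (al_leN h0'); apply: ler_wpM2l => //; exact: count_scaled.
  have Nh : N%:R / h%:R <= Q / 2.
    rewrite ler_pdivrMr // mulrAC ler_pdivlMr // mulrC.
    have := hY; rewrite ltr_pdivrMr // mulrC => /ltW/le_trans; apply.
    by rewrite mulrC ler_wpM2l ?(ltW Q0) // ler_nat.
  have om : 8 * omega2 N P X F k1 k2 k3 h <= e1 / h%:R + e2.
    rewrite /omega2 -/r /e1 /e2.
    have : N%:R / h%:R * (k3 * r * F ^+ 2) <= Q / 2 * (k3 * r * F ^+ 2) by apply: ler_wpM2r.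
    rewrite mulrDr; have -> : 8 * (N%:R * k1 * F) / h%:R = 8 * (N%:R / h%:R * (k1 * F)) by ring.
    have -> : Q / 2 * k3 * r * F ^+ 2 = Q / 2 * (k3 * r * F ^+ 2) by ring.
    lra.
  have om0 : 0 <= 8 * omega2 N P X F k1 k2 k3 h.
    apply: mulr_ge0 => //; apply: addr_ge0; last by apply: mulr_ge0 => //; apply: mulr_ge0.
    by apply: mulr_ge0; [apply: divr_ge0 | apply: addr_ge0 => //; apply: mulr_ge0].
  apply: le_trans (ler_wpM2l om0 v) _.
  have v0 : 0 <= Sh h + S / h%:R by apply: addr_ge0 => //; apply: divr_ge0.
  apply: le_trans (ler_wpM2r v0 om) _.
  by rewrite le_eqVlt; apply/orP; left; apply/eqP; field; rewrite gt_eqF.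
rewrite !big_split /= -!mulr_sumr.
have hM : \sum_(1 <= h < M.+1) (h%:R : R)^-1 <= 2 * L.
  apply: le_trans (harmonic_le R M) _.
  have M1 : (0 < M)%N by rewrite /M truncn_ge_nat; have := Q2; lra.
  have : ln (M%:R : R) <= L by rewrite ler_ln ?posrE ?ltr0n //; apply: le_trans Qx.
  by have := L1; lra.
have t1 := ler_wpM2l e10 tail_cs.
have t2 := ler_wpM2l (mulr_ge0 e10 S0) tail_invsq.
have t3 := ler_wpM2l e20 sum_Sh.
have t4 := ler_wpM2l (mulr_ge0 e20 S0) hM.
apply: le_trans (lerD (lerD (lerD t1 t2) t3) t4) _.
have e1b : e1 <= 8 * (S / K1 * (c * ln P)).
  rewrite /e1; apply: ler_wpM2l => //; rewrite -/F; apply: ler_wpM2r => //.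
  have -> : S / K1 = x * k1 by rewrite /k1; field; rewrite !gt_eqF.
  exact: ler_wpM2r.
have sq0 : 0 <= Num.sqrt (Q / (x * KY)) by exact: sqrtr_ge0.
have w1 : e1 * (S * Num.sqrt (Q / (x * KY))) <= 8 * c * E3.
  apply: le_trans (ler_wpM2r (mulr_ge0 S0 sq0) e1b) _.
  by rewrite le_eqVlt; apply/orP; left; apply/eqP; rewrite /E3; ring.
have w2 : e1 * S * (Q / x) <= 8 * c ^+ 1 * (l ^+ 6 * Ua).
  have g0 : 0 <= S * (Q / x) by apply: mulr_ge0 => //; apply: divr_ge0; exact: ltW.
  rewrite -mulrA; apply: le_trans (ler_wpM2r g0 e1b) _.
  rewrite [leLHS](_ : _ = 8 * c * (S * (Q / (x * K1))) * (ln P * S)); last by field; rewrite !gt_eqF.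
  rewrite [leRHS](_ : _ = 8 * c * (S * (Q / (x * K1))) * (l ^+ 6 * Tt)); last by rewrite /Ua; ring.
  apply: ler_wpM2l.
    apply: mulr_ge0; first by apply: mulr_ge0.
    by apply: mulr_ge0 => //; apply: divr_ge0; [exact: ltW | apply: mulr_ge0; exact: ltW].
  apply: ler_pM => //; first by have := lnP1; lra.
  by apply: le_trans lnPl _; rewrite -[leLHS]expr1; exact: ler_weXn2l.
have w3 : e2 * T + e2 * S * (2 * L) <= e2 * (3 * L * T).
  have a1 : T <= L * T by apply: ler_peMl.
  have a2 : S * (2 * L) <= T * (2 * L) by apply: ler_wpM2r => //; apply: mulr_ge0.
  by rewrite -mulrA -mulrDr; apply: ler_wpM2l => //; lra.
have w4 : e2 * (3 * L * T) <= 12 * (c ^+ 2 * (l ^+ 2 * L ^+ 1 * Ub)) + 96 * (l ^+ 0 * L ^+ 2 * Uc).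
  have LT0 : 0 <= 3 * L * T by apply: mulr_ge0 => //; apply: mulr_ge0.
  apply: (@le_trans _ _ (8 * (Q / 2 * k3 * r * (c ^+ 2 * l ^+ 2) + 2 * k2 * (2 * (X * P) * L)) * (3 * L * T))).
    apply: ler_wpM2r => //; apply: ler_wpM2l => //; apply: lerD; apply: ler_wpM2l => //.
      by apply: mulr_ge0 => //; apply: mulr_ge0.
    exact: mulr_ge0.
  by rewrite le_eqVlt; apply/orP; left; apply/eqP; rewrite /Ub /Uc /k3 /k2; field; rewrite !gt_eqF.
have l60 : 0 <= l ^+ 6 by apply: exprn_ge0.
have L30 : 0 <= L ^+ 3 by apply: exprn_ge0.
have c30 : 0 <= c ^+ 3 by apply: exprn_ge0.
have lL0 : 0 <= l ^+ 6 * L ^+ 3 by apply: mulr_ge0.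
have v1 := ler_wpM2l (exprn_ge0 2 c0) (@pow_le 2 1 Ub Ub0 isT isT).
have v1' := le_trans v1 (@c_le 2 _ (mulr_ge0 lL0 Ub0) isT).
have v2 := @pow_le 0 2 Uc Uc0 isT isT.
have v2' := le_trans v2 (_ : _ <= c ^+ 3 * (l ^+ 6 * L ^+ 3 * Uc)).
have {}v2' : l ^+ 0 * L ^+ 2 * Uc <= c ^+ 3 * (l ^+ 6 * L ^+ 3 * Uc).
  by apply: v2'; apply: ler_peMl; [exact: mulr_ge0 | exact: exprn_ege1].
have v3 := @c_le 1 _ (mulr_ge0 l60 Ua0) isT.
have y1 : 0 <= c ^+ 3 * (l ^+ 6 * Ua) by apply: mulr_ge0 => //; apply: mulr_ge0.
have y2 : 0 <= c ^+ 3 * (l ^+ 6 * L ^+ 3 * Ub) by apply: mulr_ge0 => //; apply: mulr_ge0.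
have y3 : 0 <= c ^+ 3 * (l ^+ 6 * L ^+ 3 * Uc) by apply: mulr_ge0 => //; apply: mulr_ge0.
rewrite [leRHS](_ : _ = 8 * c * E3 + 128 * (c ^+ 3 * (l ^+ 6 * Ua)) + 128 * (c ^+ 3 * (l ^+ 6 * L ^+ 3 * Ub)) +
   128 * (c ^+ 3 * (l ^+ 6 * L ^+ 3 * Uc))); last by ring.
rewrite -[8 * c ^+ 1 * _]mulrA in w2.
lra.
Qed.

(** Here l^3 from [Lb] and l^2 from F^2 stay within l^6, and (2 + ln N)^2 within log^3 x. No
    K_int^(3) appears in this error, so K3 >= 1 is what lets [Ub] absorb it. *)
Let partC : 976 * (3 * l) ^+ 3 * (2 + ln N%:R) ^+ 2 * (N%:R * Q) * (rankin P X * F ^+ 2) * al ^+ 2 <=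
  (976 * 27 * 9) * c ^+ 3 * (l ^+ 6 * L ^+ 3 * Ub).
Proof.
have F20 := sqr_ge0 F.
have a1 : (2 + ln N%:R) ^+ 2 <= (3 * L) ^+ 2.
  by apply: lerXn2r; rewrite ?nnegrE; have := lnN; have := lnN0; have := L1; lra.
have a2 : (N%:R * Q) * al ^+ 2 <= Q / x * S ^+ 2.
  apply: (@le_trans _ _ (x * Q * al ^+ 2)).
    by apply: ler_wpM2r; [exact: sqr_ge0 | apply: ler_wpM2r => //; exact: ltW].
  have -> : x * Q * al ^+ 2 = Q / x * (`|al| * x) ^+ 2.
    rewrite [(`|al| * x) ^+ 2]exprMn [`|al| ^+ 2]real_normK ?num_real //.
    by move: (al ^+ 2) => a2; field; rewrite gt_eqF.
  apply: ler_wpM2l; first by apply: divr_ge0; exact: ltW.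
  by apply: lerXn2r; rewrite ?nnegrE //; apply: mulr_ge0 => //; exact: ltW.
have a3 : r * F ^+ 2 <= r * (c ^+ 2 * l ^+ 2) by apply: ler_wpM2l.
have l30 : 0 <= l ^+ 3 by apply: exprn_ge0.
rewrite [leLHS](_ : _ = (976 * 27) * l ^+ 3 * ((2 + ln N%:R) ^+ 2 * ((r * F ^+ 2) * ((N%:R * Q) * al ^+ 2)))); last by rewrite -/r; ring.
apply: (@le_trans _ _ ((976 * 27) * l ^+ 3 * ((3 * L) ^+ 2 * ((r * (c ^+ 2 * l ^+ 2)) * (Q / x * S ^+ 2))))).
  have NQ0 : 0 <= N%:R * Q * al ^+ 2 by apply: mulr_ge0; [apply: mulr_ge0 => //; exact: ltW | exact: sqr_ge0].
  have rF0 : 0 <= r * F ^+ 2 by apply: mulr_ge0.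
  apply: ler_wpM2l; first exact: (mulr_ge0 (mulr_ge0 (ler0n _ _) (ler0n _ _)) l30).
  exact: (ler_pM (sqr_ge0 _) (mulr_ge0 rF0 NQ0) a1 (ler_pM rF0 NQ0 a3 a2)).
have sub : r * (Q / x * S ^+ 2) <= Ub.
  have g0 : 0 <= S * (Q * r / x).
    by apply: mulr_ge0 => //; apply: divr_ge0; [apply: mulr_ge0 => //; exact: ltW | exact: ltW].
  rewrite [leLHS](_ : _ = S * (Q * r / x) * S); last by ring.
  rewrite [leRHS](_ : _ = S * (Q * r / x) * (K3 * T)); last by rewrite /Ub; ring.
  apply: ler_wpM2l => //; apply: le_trans ST _; exact: ler_peMl.
have g1 : 0 <= c ^+ 2 * (l ^+ 5 * L ^+ 2).
  by apply: mulr_ge0; [exact: exprn_ge0 | apply: mulr_ge0; exact: exprn_ge0].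
rewrite [leLHS](_ : _ = (976 * 27 * 9) * (c ^+ 2 * (l ^+ 5 * L ^+ 2) * (r * (Q / x * S ^+ 2)))); last by ring.
rewrite -[leRHS]mulrA; apply: ler_wpM2l; first exact: (mulr_ge0 (mulr_ge0 (ler0n _ _) (ler0n _ _)) (ler0n _ _)).
apply: le_trans (ler_wpM2l g1 sub) _; rewrite -[leLHS]mulrA.
apply: le_trans (ler_wpM2l (exprn_ge0 2 c0) (@pow_le 5 2 Ub Ub0 isT isT)) _.
by apply: c_le => //; apply: mulr_ge0 => //; apply: mulr_ge0; exact: exprn_ge0.
Qed.

(** The constant covers 34600 + 128 + 237168, the total for [Ub] over the three parts. *)
Lemma bform_to_constants :
  `|bform N z Q b b - al ^+ 2 * bform N z Q (one R N) (one R N)| <=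
  (300 * 10 ^+ 3) * c ^+ 3 * (E3 + l ^+ 6 * Ua + l ^+ 6 * L ^+ 3 * (Ub + Uc)).
Proof.
have h1 := bform_model Q2 MN hY YM hLb P3 zP X1 hc k1_ge0 k2_ge0 k3_ge0 bs s_supp resembles1 resembles2.
have h2 := model_tail al N0 Q2 MN hY YM hLb P3 zP X1 hc NQ.
set md := \sum_(_ <= _ < _) _ in h1 h2.
have -> : bform N z Q b b - al ^+ 2 * bform N z Q (one R N) (one R N) =
  (bform N z Q b b - md) + (md - al ^+ 2 * bform N z Q (one R N) (one R N)) by ring.
apply: le_trans (ler_normD _ _) _.
apply: le_trans (lerD (le_trans h1 (lerD partA partB)) (le_trans h2 partC)) _.
have E30 : 0 <= E3.
  apply: mulr_ge0; first exact: sqr_ge0.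
  by apply: mulr_ge0; [apply: divr_ge0; [have := lnP1; lra | exact: ltW] | exact: sqrtr_ge0].
have l60 : 0 <= l ^+ 6 by apply: exprn_ge0.
have L30 : 0 <= L ^+ 3 by apply: exprn_ge0.
have c30 : 0 <= c ^+ 3 by apply: exprn_ge0.
have lL0 : 0 <= l ^+ 6 * L ^+ 3 by apply: mulr_ge0.
have v := @c_le 1 _ E30 isT; rewrite expr1 in v.
have y0 : 0 <= c ^+ 3 * E3 by apply: mulr_ge0.
have y1 : 0 <= c ^+ 3 * (l ^+ 6 * Ua) by apply: mulr_ge0 => //; apply: mulr_ge0.
have y2 : 0 <= c ^+ 3 * (l ^+ 6 * L ^+ 3 * Ub) by apply: mulr_ge0 => //; apply: mulr_ge0.
have y3 : 0 <= c ^+ 3 * (l ^+ 6 * L ^+ 3 * Uc) by apply: mulr_ge0 => //; apply: mulr_ge0.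
rewrite [leRHS](_ : _ = (300 * 10 ^+ 3) * (c ^+ 3 * E3) + (300 * 10 ^+ 3) * (c ^+ 3 * (l ^+ 6 * Ua)) +
   (300 * 10 ^+ 3) * (c ^+ 3 * (l ^+ 6 * L ^+ 3 * Ub)) + (300 * 10 ^+ 3) * (c ^+ 3 * (l ^+ 6 * L ^+ 3 * Uc))); last by ring.
rewrite [leLHS](_ : _ = 8 * (c * E3) + (346 * 100 + 128) * (c ^+ 3 * (l ^+ 6 * Ua)) +
   (346 * 100 + 128 + 976 * 27 * 9) * (c ^+ 3 * (l ^+ 6 * L ^+ 3 * Ub)) + (346 * 100 + 128) * (c ^+ 3 * (l ^+ 6 * L ^+ 3 * Uc))); last by ring.
lra.
Qed.
End RealSequence.

(** * The bilinear form at the sequence 1, and the real variance *)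

Section Ones.
Variable R : realType.

Lemma rprog_modn (b : nat -> R) (N q c c' : nat) : c = c' %[mod q] -> rprog b N q c = rprog b N q c'.
Proof. by move=> e; apply: eq_bigr => n _; rewrite e. Qed.

(** Both the count in a class and its average lie within 1 of y/r. For the sequence 1 this trivial
    bound takes the place of the Progressions Condition. *)
Lemma devker1_le (r m y : nat) : (0 < r)%N ->
  `|\sum_(1 <= n < y.+1) devker R r m n * 1| <= 2.
Proof.
move=> r0; rewrite -(rprog_dev (fun=> 1 : R) y m r0).
pose Fd c := `|rprog (fun=> 1 : R) y r c - y%:R / r%:R|.
have h1 : Fd m <= 1.
  (* The count is known only for representatives 1 <= c <= r, so m is moved to its
     representative. *)
  rewrite -(sum_residue m r0 (F := Fd)); last by move=> c c' e; rewrite /Fd (rprog_modn _ _ e).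
  rewrite -[leRHS](sum_residue m r0 (F := fun=> 1 : R)) //.
  apply: ler_sum_nat => c hc; apply: ler_wpM2l => //; exact: rprog1_near.
have h2 := raver1_near R y r0 (dvdn_gcdr m r).
rewrite /Fd in h1; set u := rprog _ _ _ _ in h1 *; set v := raver _ _ _ _ in h2 *.
set w := y%:R / r%:R in h1 h2.
have -> : u - v = (u - w) - (v - w) by ring.
by apply: le_trans (ler_normB _ _) _; lra.
Qed.

Lemma ln_le_id (t : R) : 0 < t -> ln t <= t.
Proof.
by move=> t0; have := @expR_ge1Dx R (ln t); rewrite lnK ?posrE //; lra.
Qed.

(** With t = x^(1/10), Q^2 > 2x gives Y <= 2 t^5, so the left side is at most 160 t^5, while P <= t
    gives ln x >= 10 ln P and makes the right side at least 160 t^10 / P. Of the 23, the integral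
    accounts for 21, and the diagonal and the rounding of x for 1 each. *)
Lemma ones_lower_order (x Q P Y : R) : 0 < Q -> 2 * x < Q ^+ 2 -> 3 <= P -> P <= x `^ (1 / 10) ->
  1 <= x -> 0 <= Y -> Y <= 2 * x / Q ->
  23 + 8 * Y + (1 + ln x) ^+ 2 <= 16 * x * (ln x / (P * ln P)).
Proof.
move=> Q0 xQ P3 Pt x1 Y0 YQ; set t := x `^ (1 / 10) in Pt.
have x0 : 0 < x by lra.
have tE : t ^+ 10 = x.
  rewrite /t -powR_mulrn ?powR_ge0 // -powRrM mul1r mulVf ?pnatr_eq0 // powRr1 //; exact: ltW.
have t3 : 3 <= t := le_trans P3 Pt.
have t0 : 0 < t by lra.
have P0 : 0 < P by lra.
have LE : ln x = 10 * ln t by rewrite -tE lnXn // mulr_natl.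
have lnP1 : 0 < ln P by rewrite ln_gt0 //; lra.
have lnPt : ln P <= ln t by rewrite ler_ln ?posrE.
have lt := ln_le_id t0.
have lt0 : 0 <= ln t by lra.
have Yt : Y <= 2 * t ^+ 5.
  have t50 : 0 <= t ^+ 5 by rewrite exprn_ge0 // ltW.
  rewrite -(@ler_pXn2r _ 2) ?nnegrE //; last by rewrite mulr_ge0.
  apply: (@le_trans _ _ ((2 * x / Q) ^+ 2)).
    by apply: lerXn2r; rewrite ?nnegrE // (le_trans Y0).
  rewrite expr_div_n ler_pdivrMr ?exprn_gt0 //.
  have -> : (2 * t ^+ 5) ^+ 2 = 4 * x by rewrite -tE; ring.
  have : x * (2 * x) <= x * Q ^+ 2 by apply: ler_wpM2l; apply: ltW.
  have -> : (2 * x) ^+ 2 = 2 * (x * (2 * x)) by ring.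
  have -> : 4 * x * Q ^+ 2 = 4 * (x * Q ^+ 2) by ring.
  by have := mulr_ge0 (ltW x0) (sqr_ge0 Q); lra.
have c1 : 10 / P <= ln x / (P * ln P).
  by rewrite LE ler_pdivlMr ?mulr_gt0 // mulrA divfK ?gt_eqF // ler_pM2l //; lra.
have c2 : 23 + 8 * Y + (1 + ln x) ^+ 2 <= 160 * t ^+ 5.
  have g1 : 1 + ln x <= 11 * t by rewrite LE; lra.
  have g2 : (1 + ln x) ^+ 2 <= (11 * t) ^+ 2.
    by apply: lerXn2r; rewrite ?nnegrE //; lra.
  have g3 : t ^+ 2 * 27 <= t ^+ 5.
    have -> : t ^+ 5 = t ^+ 2 * t ^+ 3 by ring.
    apply: ler_wpM2l; first exact: sqr_ge0.
    have -> : 27 = 3 ^+ 3 :> R by ring.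
    by apply: lerXn2r; rewrite ?nnegrE //; lra.
  have g4 : 9 <= t ^+ 2.
    have -> : 9 = 3 ^+ 2 :> R by ring.
    by apply: lerXn2r; rewrite ?nnegrE //; lra.
  have g5 : (11 * t) ^+ 2 = 121 * t ^+ 2 by ring.
  rewrite g5 in g2; lra.
apply: le_trans c2 _.
apply: (@le_trans _ _ (16 * x * (10 / P))); last by apply: ler_wpM2l => //; lra.
rewrite [leRHS]mulrA ler_pdivlMr //.
have -> : 16 * x * 10 = 160 * t ^+ 5 * t ^+ 5 by rewrite -tE; ring.
apply: ler_wpM2l; first exact: (mulr_ge0 (ler0n _ _) (exprn_ge0 5 (ltW t0))).
apply: le_trans Pt _; rewrite -[leLHS]expr1; apply: ler_weXn2l => //; lra.
Qed.

Local Open Scope classical_set_scope.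

(** [variance_bform] read backwards: the variance of 1 is known from [rV_one] and
    [mod_sum_integral], so it determines the form. The constant is 64 times the inverse-square sum
    2, plus 16 from [ones_lower_order]. *)
Lemma ones_bform (x Q P : R) : 2 <= Q -> Q <= x -> 2 * x < Q ^+ 2 -> 3 <= P -> P <= x `^ (1 / 10) ->
  `|bform (Num.truncn x) (Num.truncn P) Q (one R (Num.truncn x)) (one R (Num.truncn x)) + Q / 2 * x -
    x ^+ 2 * \int[lebesgue_measure]_(v in [set` `[x / Q, 2 * x / Q]%R])
              (fracpart v * (1 - fracpart v) / v ^+ 3)| <=
  144 * x ^+ 2 * (ln x / (P * ln P)).
Proof.
move=> Q2 Qx xQ P3 Pt; set N := Num.truncn x; set z := Num.truncn P; set I := \int[_]_(_ in _) _.
have Q0 : 0 < Q by lra.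
have x1 : 1 <= x by lra.
have x0 : 0 < x by lra.
have P0 : 0 < P by lra.
have /andP[Nx xN] : N%:R <= x < N.+1%:R by rewrite truncn_itv // ltW.
have N0 : (0 < N)%N by rewrite /N truncn_ge_nat; lra.
have Y0 : 0 <= 2 * x / Q by rewrite divr_ge0 //; lra.
set Yn := Num.truncn (2 * x / Q).
have /andP[Yx xY] : Yn%:R <= 2 * x / Q < Yn.+1%:R by rewrite truncn_itv.
have hY : 2 * N%:R / Q < Yn.+1%:R.
  by apply: le_lt_trans xY; rewrite ler_pM2r ?invr_gt0 // ler_pM2l.
set M := Num.truncn Q.
have MQ : M%:R <= Q by have /andP[] := truncn_itv (ltW Q0).
have MN : (M <= N)%N by rewrite /N truncn_ge_nat ?(ltW x0) //; apply: le_trans MQ Qx.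
have YM : (Yn <= M)%N.
  rewrite /M truncn_ge_nat ?(ltW Q0) //; apply: le_trans Yx _.
  by rewrite ler_pdivrMr // -expr2 ltW.
have Pz : P < z.+1%:R by have /andP[] := truncn_itv (ltW P0).
have lnP0 : 0 < ln P by rewrite ln_gt0 //; lra.
have L0 : 0 <= ln x by apply: ln_ge0; lra.
have M1 : (0 < M)%N by rewrite /M truncn_ge_nat; clear - Q2; lra.
have E3 : M%:R * (1 + ln M%:R) ^+ 2 <= x * (1 + ln x) ^+ 2.
  have Mx : M%:R <= x := le_trans MQ Qx.
  have lM0 : 0 <= ln (M%:R : R) by rewrite ln_ge0 // ler1n.
  have lM : ln (M%:R : R) <= ln x by rewrite ler_ln ?posrE ?ltr0n.
  apply: ler_pM => //; first exact: sqr_ge0.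
  by apply: lerXn2r; rewrite ?nnegrE; clear - lM0 lM L0; lra.
have QN : `|Q / 2 * (x - N%:R)| <= x.
  rewrite normrM !ger0_norm ?subr_ge0 //; last by lra.
  have : Q / 2 * (x - N%:R) <= Q / 2 * 1.
    by apply: ler_wpM2l; [clear - Q0; lra | move: xN; rewrite -natr1; clear; lra].
  by clear - Q0 Qx; lra.
have one_le n : `|one R N n| <= one R N n by rewrite /one ger0_norm.
have one_supp n : (N < n)%N -> one R N n = 0 by move=> h; rewrite /one leqNgt h.
have hG r m y : (0 < r)%N -> (y <= N)%N -> `|\sum_(1 <= n < y.+1) devker R r m n * one R N n| <= 2.
  move=> r0 yN; have := devker1_le m y r0; congr (`|_| <= _).
  by apply: eq_big_nat => n /andP[_ ny]; rewrite /one (@leq_trans y).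
have vb := variance_bform N0 Q2 MN hY YM P3 Pz (G := fun _ _ => 2) one_le one_supp hG.
have rVE : rV (one R N) N Q = rV (fun=> 1 : R) N Q.
  have rE q c : rprog (one R N) N q c = rprog (fun=> 1 : R) N q c.
    by apply: eq_big_nat => n /andP[_ nN]; rewrite /one -ltnS nN.
  apply: eq_bigr => q _; apply: eq_bigr => c _; rewrite rE /raver.
  by congr ((_ - _ * _) ^+ 2); apply: eq_bigr => d _.
have sumone : \sum_(1 <= n < N.+1) one R N n = N%:R.
  rewrite (eq_big_nat _ _ (F2 := fun=> 1)); first by rewrite big_const_nat iter_addr_0 subn1.
  by move=> n /andP[_ nN]; rewrite /one -ltnS nN.
have sumone2 : \sum_(1 <= n < N.+1) one R N n ^+ 2 = N%:R.
  by rewrite -sumone; apply: eq_bigr => n _; rewrite /one; case: (n <= N)%N; rewrite ?expr1n // expr0n.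
rewrite sumone2 rVE in vb.
have dd : 4 * \sum_(1 <= r < Yn.+1) \sum_(1 <= m < N.+1) one R N m * 2 = 8 * Yn%:R * N%:R.
  rewrite -mulr_suml sumone big_const_nat iter_addr_0 subn1 /= -[_ *+ _]mulr_natr; ring.
rewrite dd in vb.
have lnN : ln (N%:R : R) <= ln x by rewrite ler_ln ?posrE ?ltr0n.
have lnN0 : 0 <= ln (N%:R : R) by rewrite ln_ge0 // ler1n.
have Ssq : \sum_(1 <= h < M.+1) (\sum_(1 <= n < N.+1) (h %| n)%N%:R * one R N n) ^+ 2 <= 2 * x ^+ 2.
  apply: (@le_trans _ _ (x ^+ 2 * \sum_(1 <= h < M.+1) ((1 <= h%:R :> R)%R%:R / (h%:R ^+ 2 : R)))).
    rewrite mulr_sumr; apply: ler_sum_nat => h /andP[h0 _].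
    have h0' : 0 < (h%:R : R) by rewrite ltr0n.
    rewrite ler1n h0 mul1r -expr_div_n; apply: lerXn2r; rewrite ?nnegrE.
    - by apply: sumr_nat_ge0 => n _; apply: mulr_ge0.
    - by apply: divr_ge0; apply: ltW.
    apply: (@le_trans _ _ (\sum_(1 <= n < N.+1) (h %| n)%N%:R)).
      by apply: ler_sum_nat => n _; rewrite ler_piMr // indic_le1.
    rewrite count_multiples // ler_pdivlMr //; apply: le_trans Nx.
    by rewrite -natrM ler_nat leq_divM.
  rewrite [leRHS]mulrC; apply: ler_wpM2l; first exact: sqr_ge0.
  by apply: le_trans (sum_invsq_tail M ltr01) _; rewrite divr1.
have E2 : 64 / P * (ln N%:R / ln P) *
    \sum_(1 <= h < M.+1) (\sum_(1 <= n < N.+1) (h %| n)%N%:R * one R N n) ^+ 2 <=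
    128 * x ^+ 2 * (ln x / (P * ln P)).
  have g0 : 0 <= 64 / P by apply: divr_ge0 => //; exact: ltW.
  apply: (@le_trans _ _ (64 / P * (ln x / ln P) * (2 * x ^+ 2))).
    apply: ler_pM => //.
    - by apply: mulr_ge0 => //; apply: divr_ge0 => //; exact: ltW.
    - by apply: sumr_nat_ge0 => h _; exact: sqr_ge0.
    by apply: ler_wpM2l => //; apply: ler_wpM2r => //; rewrite invr_ge0 ltW.
  by rewrite le_eqVlt; apply/orP; left; apply/eqP; field; rewrite !gt_eqF.
have rv1 := rV_one N Q; have mi := mod_sum_integral Q2 Qx.
have low := ones_lower_order Q0 xQ P3 Pt x1 (ler0n _ Yn) Yx.
have {}low : x * (23 + 8 * Yn%:R + (1 + ln x) ^+ 2) <= x * (16 * x * (ln x / (P * ln P))).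
  exact: (ler_wpM2l (ltW x0) low).
have e4 : 8 * Yn%:R * N%:R <= 8 * Yn%:R * x by apply: ler_wpM2l => //; apply: mulr_ge0.
set B := bform _ _ _ _ _ in vb *; set rv := rV _ _ _ in vb rv1.
rewrite -/N -/I in mi; rewrite -/M in rv1.
set md := \sum_(_ <= _ < _ | _) _ in rv1 mi.
have -> : B + Q / 2 * x - x ^+ 2 * I =
   - (rv - Q / 2 * N%:R - B) + (rv - md) + (md - x ^+ 2 * I) + Q / 2 * (x - N%:R) by ring.
apply: le_trans (ler_normD _ _) _.
apply: le_trans (lerD (le_trans (ler_normD _ _) (lerD (ler_normD _ _) mi)) QN) _.
rewrite normrN.
apply: le_trans (lerD (lerD (lerD (le_trans vb (lerD (lerD (lexx _) e4) E2)) (le_trans rv1 E3)) (lexx _)) (lexx _)) _.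
have -> : 144 * x ^+ 2 * (ln x / (P * ln P)) = 128 * x ^+ 2 * (ln x / (P * ln P)) + x * (16 * x * (ln x / (P * ln P))) by ring.
move: low; set w := ln x / (P * ln P); set v := (1 + ln x) ^+ 2.
rewrite !mulrDr => low; clear - low Nx.
move: (x * v) (x ^+ 2 * w) (x * (16 * x * w)) (x * 23) low => t1 t2 t3 t4; lra.
Qed.

Lemma real_variance (x Q P X K1 K2 K3 KY c C1 : R) (b s : nat -> R) (G : nat -> nat -> R) :
  2 <= Q -> Q <= x -> 2 * x < Q ^+ 2 -> 3 <= P -> P <= X -> X * P <= x -> P <= x `^ (1 / 10) ->
  0 < K1 -> 0 < K2 -> 1 <= K3 -> 0 < KY -> 1 <= c ->
  let N := Num.truncn x in let z := Num.truncn P in let Yn := Num.truncn (2 * x / Q) in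
  let M := Num.truncn Q in let l := ln (P * x / Q) in
  let S := \sum_(1 <= n < N.+1) s n in
  let A := \sum_(1 <= n < N.+1) b n in
  let T := \sum_(1 <= n < N.+1) s n * (tau3 n)%:R in
  let Tt := \sum_(1 <= n < N.+1) s n * (tau3_trunc (P * x / Q) n)%:R in
  \sum_(1 <= d < N.+1) sf (1 / ln P) z d <= c * ln P ->
  (forall n, `|b n| <= s n) -> (forall n, (N < n)%N -> s n = 0) ->
  \sum_(1 <= h < M.+1) (2 * x / Q <= h%:R)%R%:R * (\sum_(1 <= n < N.+1) (h %| n)%N%:R * s n) ^+ 2 <= S ^+ 2 / KY ->
  \sum_(1 <= h < M.+1) (\sum_(1 <= n < N.+1) (h %| n)%N%:R * s n) ^+ 2 <= C1 ->
  (forall h c d : nat, (0 < h)%N -> (0 < c <= d)%N -> (h * d <= N)%N ->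
    `|\sum_(1 <= n < N.+1) ((c <= n <= d)%N && roughn z n)%:R * (b (h * n)%N - A / x)| <=
    (d%:R - c%:R) * (S / (x * K1)) + S / K2) ->
  (forall h c d : nat, (0 < h)%N -> (0 < c <= d)%N -> (h * d <= N)%N ->
    \sum_(1 <= n < N.+1) (c <= n <= d)%N%:R * (s (h * n)%N * (tau n)%:R) <=
    (d%:R - c%:R) * (K3 * S / x) + S / K2) ->
  (forall r m y, (0 < r)%N -> (y <= N)%N -> `|\sum_(1 <= n < y.+1) devker R r m n * b n| <= G r m) ->
  `|rV b N Q - (Q / 2 * \sum_(1 <= n < N.+1) b n ^+ 2 - Q / 2 * (A ^+ 2 / x) +
     A ^+ 2 * \int[lebesgue_measure]_(v in [set` `[x / Q, 2 * x / Q]%R])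
              (fracpart v * (1 - fracpart v) / v ^+ 3))| <=
  \sum_(1 <= n < N.+1) s n ^+ 2 +
  4 * \sum_(1 <= r < Yn.+1) \sum_(1 <= m < N.+1) s m * G r m +
  208 * C1 * (ln x / (P * ln P)) +
  300 * 10 ^+ 3 * c ^+ 3 * (S ^+ 2 * (ln P / K1 * Num.sqrt (Q / (x * KY))) +
     l ^+ 6 * (S * (Q / (x * K1) * Tt)) +
     l ^+ 6 * ln x ^+ 3 * (S * (Q * K3 * rankin P X / x) * T + S * (X * P / K2) * T)).
Proof.
move=> Q2 Qx xQ P3 PX XPx Pt K10 K20 K31 KY0 c1 N z Yn M l S A T Tt.
have Q0 : 0 < Q by lra.
have x0 : 0 < x by lra.
have P0 : 0 < P by lra.
have N0 : (0 < N)%N by rewrite /N truncn_ge_nat; lra.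
have Y0 : 0 <= 2 * x / Q by rewrite divr_ge0 //; lra.
have M1 : (0 < M)%N by rewrite /M truncn_ge_nat; lra.
have lnP0 : 0 < ln P by rewrite ln_gt0 //; lra.
have L0 : 0 <= ln x by apply: ln_ge0; lra.
move=> hc bs s_supp concY conc1 re1 re2 hG.
set I := \int[_]_(_ in _) _.
have bc := bform_to_constants Q2 Qx xQ P3 PX XPx K10 K20 K31 KY0 c1 hc bs s_supp concY re1 re2.
have ob := ones_bform Q2 Qx xQ P3 Pt; rewrite -/N -/z -/I in ob.
have /andP[Nx xN] : N%:R <= x < N.+1%:R by rewrite truncn_itv // ltW.
have /andP[Yx xY] : Yn%:R <= 2 * x / Q < Yn.+1%:R by rewrite truncn_itv.
have hY : 2 * N%:R / Q < Yn.+1%:R.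
  by apply: le_lt_trans xY; rewrite ler_pM2r ?invr_gt0 // ler_pM2l.
have MQ : M%:R <= Q by have /andP[] := truncn_itv (ltW Q0).
have MN : (M <= N)%N by rewrite /N truncn_ge_nat ?(ltW x0) //; apply: le_trans MQ Qx.
have YM : (Yn <= M)%N.
  rewrite /M truncn_ge_nat ?(ltW Q0) //; apply: le_trans Yx _.
  by rewrite ler_pdivrMr // -expr2 ltW.
have Pz : P < z.+1%:R by have /andP[] := truncn_itv (ltW P0).
have b_supp n : (N < n)%N -> b n = 0.
  by move=> nN; apply/eqP; rewrite -normr_le0 (le_trans (bs n)) // s_supp.
have vb := variance_bform N0 Q2 MN hY YM P3 Pz bs b_supp hG.
(* The term h = 1 of the concentration sum is S^2; hence the error of the sequence 1 can be charged
   to the K_conc[1] term, and 64 + 144 = 208. *)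
have SC : S ^+ 2 <= C1.
  apply: le_trans conc1; rewrite big_ltn //; apply: ler_wpDr.
    by apply: sumr_nat_ge0 => h _; exact: sqr_ge0.
  rewrite le_eqVlt; apply/orP; left; apply/eqP; congr (_ ^+ 2).
  by apply: eq_bigr => n _; rewrite dvd1n mul1r.
have w0 : 0 <= ln x / (P * ln P) by apply: divr_ge0 => //; apply: mulr_ge0; exact: ltW.
have lnN : ln (N%:R : R) <= ln x by rewrite ler_ln ?posrE ?ltr0n.
have lnN0 : 0 <= ln (N%:R : R) by rewrite ln_ge0 // ler1n.
have e2 : 64 / P * (ln N%:R / ln P) *
    \sum_(1 <= h < M.+1) (\sum_(1 <= n < N.+1) (h %| n)%N%:R * s n) ^+ 2 <=
    64 * C1 * (ln x / (P * ln P)).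
  have g0 : 0 <= 64 / P by apply: divr_ge0 => //; exact: ltW.
  apply: (@le_trans _ _ (64 / P * (ln x / ln P) * C1)).
    apply: ler_pM => //.
    - by apply: mulr_ge0 => //; apply: divr_ge0 => //; exact: ltW.
    - by apply: sumr_nat_ge0 => h _; exact: sqr_ge0.
    by apply: ler_wpM2l => //; apply: ler_wpM2r => //; rewrite invr_ge0 ltW.
  by rewrite le_eqVlt; apply/orP; left; apply/eqP; field; rewrite !gt_eqF.
have AS : A ^+ 2 <= S ^+ 2.
  rewrite -[A ^+ 2]real_normK ?num_real //; apply: lerXn2r; rewrite ?nnegrE //.
    by apply: sumr_nat_ge0 => n _; exact: le_trans (bs n).
  exact: norm_sum_le_nat.
set B := bform _ _ _ _ _ in vb bc; set B1 := bform _ _ _ _ _ in ob bc.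
have e3 : `|(A / x) ^+ 2 * (B1 + Q / 2 * x - x ^+ 2 * I)| <= 144 * C1 * (ln x / (P * ln P)).
  rewrite normrM ger0_norm ?sqr_ge0 //.
  apply: le_trans (ler_wpM2l (sqr_ge0 _) ob) _.
  have -> : (A / x) ^+ 2 * (144 * x ^+ 2 * (ln x / (P * ln P))) = 144 * A ^+ 2 * (ln x / (P * ln P)).
    by field; rewrite !gt_eqF.
  apply: ler_wpM2r => //; apply: ler_wpM2l => //; exact: le_trans SC.
set B2 := \sum_(1 <= n < N.+1) b n ^+ 2 in vb *.
have -> : rV b N Q - (Q / 2 * B2 - Q / 2 * (A ^+ 2 / x) + A ^+ 2 * I) =
   (rV b N Q - Q / 2 * B2 - B) + (B - (A / x) ^+ 2 * B1) + (A / x) ^+ 2 * (B1 + Q / 2 * x - x ^+ 2 * I).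
  by field; rewrite gt_eqF.
apply: le_trans (ler_normD _ _) _.
apply: le_trans (lerD (le_trans (ler_normD _ _) (lerD (le_trans vb (lerD (lexx _) e2)) bc)) e3) _.
set D := 300 * _ * _ * _; set w := ln x / _.
by rewrite le_eqVlt; apply/orP; left; apply/eqP; ring.
Qed.
End Ones.

Local Open Scope classical_set_scope.

(** * Complex sequences through their real and imaginary parts *)

Lemma sum_restrict (V : pzRingType) (m N : nat) (F : nat -> V) : (m <= N)%N ->
  (forall n, (m < n)%N -> F n = 0) -> \sum_(1 <= n < N.+1) F n = \sum_(1 <= n < m.+1) F n.
Proof.
move=> mN F0; rewrite -(sum_cut _ mN); apply: eq_bigr => n _.
by case: leqP => h; rewrite ?mul1r // mul0r F0.
Qed.

Section Modulus.
Variable R : realType.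

Lemma cabs_ge0 (u : R[i]) : 0 <= cabs u.
Proof. by case: u => u v /=; exact: sqrtr_ge0. Qed.

Lemma sqr_cabs (u : R[i]) : cabs u ^+ 2 = complex.Re u ^+ 2 + complex.Im u ^+ 2.
Proof. by case: u => u v /=; rewrite sqr_sqrtr // addr_ge0 // sqr_ge0. Qed.

Lemma Re_le_cabs (u : R[i]) : `|complex.Re u| <= cabs u.
Proof.
by case: u => u v /=; rewrite -sqrtr_sqr ler_wsqrtr // lerDl sqr_ge0.
Qed.

Lemma Im_le_cabs (u : R[i]) : `|complex.Im u| <= cabs u.
Proof.
by case: u => u v /=; rewrite -sqrtr_sqr ler_wsqrtr // lerDr sqr_ge0.
Qed.

Lemma truncn_nat (n : nat) : Num.truncn (n%:R : R) = n.
Proof. by apply/eqP; rewrite -(eqr_nat R) truncnK ?natr_nat. Qed.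

Lemma progdev_mod (a : nat -> R[i]) (y : R) (q c c' : nat) : c = c' %[mod q] ->
  progdev a y q c = progdev a y q c'.
Proof.
move=> e; rewrite /progdev (gcdn_mod_eq e); congr (cabs (_ - _)).
by apply: eq_bigl => n; rewrite e.
Qed.

Lemma progdev_trunc (a : nat -> R[i]) (y : R) (q c : nat) :
  progdev a y q c = progdev a (Num.truncn y)%:R q c.
Proof. by rewrite /progdev /aver /progsum truncn_nat. Qed.

Lemma progdev_le_sup (a : nat -> R[i]) (x : R) (y q c : nat) : y%:R <= x ->
  progdev a y%:R q c <= sup [set progdev a z q c | z in [set z : R | z <= x]].
Proof.
move=> yx; apply: ub_le_sup; last by exists y%:R.
(* [progdev] takes only its values at integers k <= x, so their sum bounds the whole set; the sum
   starts at 0 because z < 1, negative z included, truncates to 0. *)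
exists (\sum_(0 <= k < (Num.truncn x).+1) progdev a k%:R q c) => _ [z /= zx <-].
rewrite progdev_trunc.
have zk : (Num.truncn z < (Num.truncn x).+1)%N by rewrite ltnS; exact: le_truncn.
rewrite (@big_cat_nat _ _ _ (Num.truncn z)) //=; last exact: ltnW.
rewrite [X in _ + X]big_ltn // addrCA lerDl addr_ge0 //; apply: sumr_ge0 => k _; exact: cabs_ge0.
Qed.
End Modulus.

Section Part.
Variables (R : realType) (p : R[i] -> R).
Hypothesis pD : forall u v, p (u + v) = p u + p v.
Hypothesis pZ : forall (r : R) u, p (real_complex R r * u) = r * p u.
Hypothesis pn : forall u, `|p u| <= cabs u.

Lemma part0 : p 0 = 0.
Proof. by have := pZ 0 0; rewrite mulr0 mul0r. Qed.

Lemma part_sub u v : p (u - v) = p u - p v.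
Proof. by rewrite pD -mulN1r -(rmorphN1 (real_complex R)) pZ mulN1r. Qed.

Lemma part_sum (I : Type) (r : seq I) (P : pred I) (F : I -> R[i]) :
  p (\sum_(i <- r | P i) F i) = \sum_(i <- r | P i) p (F i).
Proof. exact: (big_morph p pD part0). Qed.

Lemma part_progsum (a : nat -> R[i]) (y : R) (q c : nat) :
  p (progsum a y q c) = rprog (p \o a) (Num.truncn y) q c.
Proof. by rewrite /progsum part_sum sum_indic. Qed.

Lemma part_aver (a : nat -> R[i]) (y : R) (q h : nat) :
  p (aver a y q h) = raver (p \o a) (Num.truncn y) q h.
Proof.
rewrite /aver -(rmorph_nat (real_complex R)) -fmorphV pZ part_sum /raver /invphi; congr (_ * _).
by apply: eq_bigr => c _; exact: part_progsum.
Qed.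

Lemma part_progdev (a : nat -> R[i]) (y : R) (q c : nat) :
  p (progsum a y q c - aver a y q (gcdn c q)) =
  rprog (p \o a) (Num.truncn y) q c - raver (p \o a) (Num.truncn y) q (gcdn c q).
Proof. by rewrite part_sub part_progsum part_aver. Qed.

Lemma devker_le_progdev (a : nat -> R[i]) (y q c : nat) : (0 < q)%N ->
  `|\sum_(1 <= n < y.+1) devker R q c n * p (a n)| <= progdev a y%:R q c.
Proof.
by move=> q0; rewrite -(rprog_dev (p \o a) y c q0) -{1 2}(truncn_nat R y) -part_progdev.
Qed.

Section Hyp.
Variables (a : nat -> R[i]) (x : R).
Let N := Num.truncn x.
Hypothesis x1 : 1 <= x.
Let x0 : 0 < x. Proof. by have := x1; lra. Qed.
Let Nx : N%:R <= x. Proof. by have /andP[] := truncn_itv (ltW x0). Qed.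

Let sub_itv (h c d : nat) : (0 < h)%N -> (0 < c)%N -> (h * d <= N)%N ->
  [set` `[c%:R, d%:R]%R] `<=` [set` `[1, x / h%:R]%R : interval R].
Proof.
move=> h0 c0 hd v /=; rewrite !in_itv /= => /andP[cv vd]; apply/andP; split.
  by apply: le_trans cv; rewrite ler1n.
apply: le_trans vd _; rewrite ler_pdivlMr ?ltr0n // -natrM mulnC.
by apply: le_trans Nx; rewrite ler_nat.
Qed.

Let len_itv (c d : nat) : (c <= d)%N -> itv_length (`[c%:R, d%:R]%R : interval R) = d%:R - c%:R.
Proof.
move=> cd; rewrite /itv_length lebesgue_measure_itv /= lte_fin ltr_nat.
case: ltnP => [//|dc] /=; have -> : c = d by apply/eqP; rewrite eqn_leq cd.
by rewrite subrr.
Qed.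

Let trunc_div (h d : nat) : (0 < h)%N -> (h * d <= N)%N ->
  (d <= Num.truncn (x / h%:R))%N /\ (Num.truncn (x / h%:R) <= N)%N.
Proof.
move=> h0 hd; have h0' : 0 < (h%:R : R) by rewrite ltr0n.
have xh : 0 <= x / h%:R by rewrite divr_ge0 // ltW.
split.
  rewrite truncn_ge_nat // ler_pdivlMr // -natrM mulnC.
  by apply: le_trans Nx; rewrite ler_nat.
apply: le_truncn; rewrite ler_pdivrMr // ler_peMr ?ler1n //; exact: ltW.
Qed.

(** Closed intervals with integer endpoints suffice. The counting sum is real, so the real-linear p
    passes through the difference and is then bounded by the modulus. *)
Lemma part_resembles1 (P K1 K2 : R) : 0 <= P -> resembles_integers_I a x P K1 K2 ->
  forall h c d : nat, (0 < h)%N -> (0 < c <= d)%N -> (h * d <= N)%N ->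
    `|\sum_(1 <= n < N.+1) ((c <= n <= d)%N && roughn (Num.truncn P) n)%:R *
        (p (a (h * n)%N) - (\sum_(1 <= n < N.+1) p (a n)) / x)| <=
    (d%:R - c%:R) * (absum a x / (x * K1)) + absum a x / K2.
Proof.
move=> P0 H h c d h0 /andP[c0 cd] hd.
have := H h `[c%:R, d%:R]%R h0 (sub_itv h0 c0 hd); rewrite len_itv //.
have [dN' N'N] := trunc_div h0 hd; set N' := Num.truncn (x / h%:R) in dN' N'N *.
move=> {}H; apply: le_trans (le_trans _ H) _; last first.
  by rewrite le_eqVlt; apply/orP; left; apply/eqP; rewrite invfM; ring.
apply: le_trans (pn _).
set cnt := \sum_(_ <= _ < _ | _) (1 : R[i]).
have cntE : cnt = real_complex R (\sum_(1 <= n < N'.+1 | (n%:R \in `[c%:R : R, d%:R]%R) && rough P n) 1).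
  by rewrite rmorph_sum /= /cnt; apply: eq_bigr => n _; rewrite rmorph1.
rewrite cntE mulrAC -fmorphV -[asum a x * _ * _]mulrA [asum a x * _]mulrC -rmorphM part_sub pZ part_sum.
rewrite (sum_restrict N'N); last first.
  by move=> n nN'; rewrite [(n <= d)%N]leqNgt (leq_ltn_trans dN' nN') andbF mul0r.
rewrite le_eqVlt; apply/orP; left; apply/eqP; congr (`|_|).
have cE n : ((n%:R \in `[c%:R : R, d%:R]%R) && rough P n) = ((c <= n <= d)%N && roughn (Num.truncn P) n).
  rewrite in_itv /= !ler_nat; congr (_ && _); rewrite /rough /roughn; apply: eq_all => q.
  by rewrite truncn_lt_nat.
rewrite [in RHS](eq_bigl _ _ cE) [X in _ = X - _]sum_indic.
under [X in _ = _ - X * _ * _]eq_bigl do rewrite cE.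
rewrite [X in _ = _ - X / x * _]sum_indic /asum part_sum -/N.
move: (\sum_(1 <= n < N.+1) p (a n)) => A.
rewrite -[X in _ = _ - X]mulrA mulr_suml -sumrB; apply: eq_bigr => n _; rewrite mulnC; ring.
Qed.

Lemma resembles2_nat (K2 K3 : R) : resembles_integers_II a x K2 K3 ->
  forall h c d : nat, (0 < h)%N -> (0 < c <= d)%N -> (h * d <= N)%N ->
    \sum_(1 <= n < N.+1) (c <= n <= d)%N%:R * (cabs (a (h * n)%N) * (tau n)%:R) <=
    (d%:R - c%:R) * (K3 * absum a x / x) + absum a x / K2.
Proof.
move=> H h c d h0 /andP[c0 cd] hd.
have := H h `[c%:R, d%:R]%R h0 (sub_itv h0 c0 hd); rewrite len_itv //.
have [dN' N'N] := trunc_div h0 hd; set N' := Num.truncn (x / h%:R) in dN' N'N *.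
move=> {}H; apply: le_trans (le_trans _ H) _; last first.
  by rewrite le_eqVlt; apply/orP; left; apply/eqP; ring.
rewrite (sum_restrict N'N); last first.
  by move=> n nN'; rewrite [(n <= d)%N]leqNgt (leq_ltn_trans dN' nN') andbF mul0r.
rewrite [leRHS]sum_indic le_eqVlt; apply/orP; left; apply/eqP; apply: eq_bigr => n _.
by rewrite in_itv /= !ler_nat mulnC.
Qed.

(** The supremum depends only on the class of m modulo r, so the weights of the classes unfold into
    a sum over single m. *)
Lemma progressions_nat (Q Kprog : R) : progressions_condition a x Q Kprog ->
  \sum_(1 <= r < (Num.truncn (2 * x / Q)).+1) \sum_(1 <= m < N.+1)
    cabs (a m) * sup [set progdev a z r m | z in [set z : R | z <= x]] <= absum a x ^+ 2 / Kprog.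
Proof.
move=> H; apply: le_trans H; rewrite le_eqVlt; apply/orP; left; apply/eqP.
apply: eq_big_nat => r /andP[r0 _]; pose G c := sup [set progdev a z r c | z in [set z : R | z <= x]].
have Gper c c' : c = c' %[mod r] -> G c = G c'.
  move=> e; rewrite /G; congr sup; apply/seteqP; split=> _ [z zx <-]; exists z => //;
  exact: progdev_mod.
transitivity (\sum_(1 <= m < N.+1) \sum_(1 <= c < r.+1) (c == m %[mod r])%:R * (cabs (a m) * G c)).
  apply: eq_bigr => m _; rewrite -/(G m) -(sum_residue m r0 Gper) mulr_sumr.
  by apply: eq_bigr => c _; ring.
rewrite exchange_big_nat /=; apply: eq_bigr => c _; rewrite -/(G c) [X in _ = X * _]sum_indic mulr_suml.
by apply: eq_bigr => m _; rewrite eq_sym mulrA.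
Qed.

Lemma concentration_nat (Q H : R) (B : R) :
  \sum_(1 <= h < (Num.truncn Q).+1 | H <= h%:R)
      (\sum_(1 <= n < N.+1 | (h %| n)%N) cabs (a n)) ^+ 2 <= B ->
  \sum_(1 <= h < (Num.truncn Q).+1) (H <= h%:R)%R%:R *
      (\sum_(1 <= n < N.+1) (h %| n)%N%:R * cabs (a n)) ^+ 2 <= B.
Proof.
rewrite sum_indic; congr (_ <= _); apply: eq_bigr => h _; congr (_ * _ ^+ 2).
by rewrite sum_indic.
Qed.
End Hyp.

Lemma part_variance (c : R) (x Q : R) (a : nat -> R[i]) (Kprog : R) (Kconc : R -> R) (P X K1 K2 K3 : R) :
  1 <= c -> (forall (P : R) (z N : nat), 3 <= P -> z%:R <= P ->
    \sum_(1 <= d < N.+1) sf (1 / ln P) z d <= c * ln P) ->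
  2 <= x -> 2 <= Q -> Num.sqrt (2 * x) < Q -> Q <= x ->
  (forall n : nat, x < n%:R -> a n = 0) ->
  0 < Kprog -> progressions_condition a x Q Kprog ->
  nonconcentration a x Q Kconc ->
  3 <= P -> P <= X -> X <= x `^ (1 / 10) ->
  0 < K1 -> 0 < K2 -> 1 <= K3 ->
  resembles_integers_I a x P K1 K2 ->
  resembles_integers_II a x K2 K3 ->
  `|rV (p \o a) (Num.truncn x) Q - (Q / 2 * \sum_(1 <= n < (Num.truncn x).+1) p (a n) ^+ 2
      - Q / 2 * (p (asum a x) ^+ 2 / x) +
     p (asum a x) ^+ 2 * \int[lebesgue_measure]_(v in [set` `[x / Q, 2 * x / Q]%R])
              (fracpart v * (1 - fracpart v) / v ^+ 3))| <=
  \sum_(1 <= n < (Num.truncn x).+1) cabs (a n) ^+ 2 +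
  4 * (absum a x ^+ 2 / Kprog) + 208 * (absum a x ^+ 2 / Kconc 1) * (ln x / (P * ln P)) +
  300 * 10 ^+ 3 * c ^+ 3 * (absum a x ^+ 2 * (ln P / K1 * Num.sqrt (Q / (x * Kconc (2 * x / Q)))) +
     ln (P * x / Q) ^+ 6 * (absum a x * (Q / (x * K1) *
       \sum_(1 <= n < (Num.truncn x).+1) cabs (a n) * (tau3_trunc (P * x / Q) n)%:R)) +
     ln (P * x / Q) ^+ 6 * ln x ^+ 3 * (absum a x * (Q * K3 * rankin P X / x) *
        (\sum_(1 <= n < (Num.truncn x).+1) cabs (a n) * (tau3 n)%:R) + absum a x * (X * P / K2) *
        (\sum_(1 <= n < (Num.truncn x).+1) cabs (a n) * (tau3 n)%:R))).
Proof.
move=> c1 hc x2 Q2 sqQ Qx a_supp Kp0 prog conc P3 PX Xt K10 K20 K31 re1 re2.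
set N := Num.truncn x; pose s n := cabs (a n).
have Q0 : 0 < Q by lra.
have x0 : 0 < x by lra.
have x1 : 1 <= x by lra.
have P0 : 0 <= P by lra.
have xQ : 2 * x < Q ^+ 2.
  have x20 : 0 <= 2 * x by lra.
  by rewrite -[ltLHS](sqr_sqrtr x20) ltrXn2r // ?nnegrE ?sqrtr_ge0 // ltW.
have tE : (x `^ (1 / 10)) ^+ 10 = x.
  rewrite -powR_mulrn ?powR_ge0 // -powRrM mul1r mulVf ?pnatr_eq0 // powRr1 //; exact: ltW.
(* With t = x^(1/10) both factors are at most t, and t^2 <= t^10 = x. *)
have XPx : X * P <= x.
  move: (x `^ (1 / 10)) Xt tE => t Xt tE.
  apply: (@le_trans _ _ (t ^+ 2)); first by rewrite expr2; apply: ler_pM; lra.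
  by rewrite -tE; apply: ler_weXn2l => //; lra.
(* Admissibility of H = 2x/Q in the non-concentration condition, again from Q^2 > 2x. *)
have YQ : 2 * x / Q <= Q by rewrite ler_pdivrMr // -expr2 ltW.
have Q1 : 1 <= Q by lra.
have [KY0 concY] := conc _ YQ; have [Kc0 conc1] := conc 1 Q1.
have zP : (Num.truncn P)%:R <= P by have /andP[] := truncn_itv P0.
have xN : x < N.+1%:R by have /andP[] := truncn_itv (ltW x0).
have Nx : N%:R <= x by have /andP[] := truncn_itv (ltW x0).
have s_supp n : (N < n)%N -> s n = 0.
  move=> nN; rewrite /s a_supp ?Normc.normc0 //; apply: lt_le_trans xN _; by rewrite ler_nat.
pose G r m := sup [set progdev a z r m | z in [set z : R | z <= x]].
have hG r m y : (0 < r)%N -> (y <= N)%N -> `|\sum_(1 <= n < y.+1) devker R r m n * (p \o a) n| <= G r m.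
  move=> r0 yN; apply: le_trans (devker_le_progdev _ _ _ r0) _; apply: progdev_le_sup.
  by apply: le_trans Nx; rewrite ler_nat.
have := @real_variance R x Q P X K1 K2 K3 (Kconc (2 * x / Q)) c (absum a x ^+ 2 / Kconc 1) (p \o a) s G
  Q2 Qx xQ P3 PX XPx (le_trans PX Xt) K10 K20 K31 KY0 c1 (hc P _ N P3 zP) (fun n => pn (a n)) s_supp
  (concentration_nat concY) _ (part_resembles1 x1 P0 re1) (resembles2_nat x1 re2) hG.
move=> H; have {}H := H _.
rewrite /asum part_sum -/N; apply: le_trans (H _) _.
  have := concentration_nat conc1; congr (_ <= _); apply: eq_big_nat => h /andP[h0 _].
  by rewrite ler1n h0 mul1r.
apply: lerD => //; apply: lerD => //; apply: lerD => //.
by apply: ler_wpM2l => //; exact: progressions_nat.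
Qed.
End Part.

Theorem theorem2 (R : realType) :
  exists C x0 : R,
  forall (x Q : R) (a : nat -> R[i]) (Kprog : R) (Kconc : R -> R)
    (P R' K1 K2 K3 : R),
    x0 <= x -> x0 <= Q -> Num.sqrt (2 * x) < Q -> Q <= x ->
    (forall n : nat, x < n%:R -> a n = 0) ->
    0 < Kprog -> progressions_condition a x Q Kprog ->
    nonconcentration a x Q Kconc ->
    3 <= P -> P <= R' -> R' <= x `^ (1 / 10) ->
    0 < K1 -> 0 < K2 -> 1 <= K3 ->
    resembles_integers_I a x P K1 K2 ->
    resembles_integers_II a x K2 K3 ->
    `| Vvar a x Q
       - (Q / 2 * (\sum_(1 <= n < (Num.truncn x).+1) cabs (a n) ^+ 2)
          - Q / 2 * (cabs (asum a x) ^+ 2 / x)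
          + cabs (asum a x) ^+ 2 *
            \int[lebesgue_measure]_(v in [set` `[x / Q, 2 * x / Q]%R])
              (fracpart v * (1 - fracpart v) / v ^+ 3)) |
    <= C * (\sum_(1 <= n < (Num.truncn x).+1) cabs (a n) ^+ 2 * (tau n)%:R)
     + C * (absum a x ^+ 2 *
         (1 / Kprog
          + ln x / (P * ln P * Kconc 1)
          + ln P / K1 * Num.sqrt (Q / (x * Kconc (2 * x / Q)))))
     + C * (absum a x * ln (P * x / Q) ^+ 6 *
         (Q / (x * K1) *
            (\sum_(1 <= n < (Num.truncn x).+1)
               cabs (a n) * (tau3_trunc (P * x / Q) n)%:R)
          + ln x ^+ 3 *
            (R' * P / K2 + Q * K3 / (x * R' `^ (1 / ln P))) *
            (\sum_(1 <= n < (Num.truncn x).+1) cabs (a n) * (tau3 n)%:R))).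
Proof.
have [c0 c0_ge0 hc0] := sum_smooth_le R.
(* Raised by 1 so that c >= 1 and lower powers of c are bounded by c^3. *)
pose c := c0 + 1; have c1 : 1 <= c by rewrite /c; lra.
have hc (P : R) (z N : nat) : 3 <= P -> z%:R <= P ->
    \sum_(1 <= d < N.+1) sf (1 / ln P) z d <= c * ln P.
  move=> P3 zP; apply: le_trans (hc0 P z N P3 zP) _; rewrite /c mulrDl mul1r lerDl.
  by apply: ln_ge0; lra.
pose D := 300 * 10 ^+ 3 * c ^+ 3.
have D1 : 208 <= D.
  have c31 : 1 <= c ^+ 3 by apply: exprn_ege1.
  have d0 : 208 <= 300 * 10 ^+ 3 :> R by lra.
  by apply: le_trans d0 _; rewrite /D; apply: (ler_peMr _ c31); lra.
have D0 : 0 <= D by lra.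
have D4 : 4 <= D by lra.
have D2 : 1 <= D by lra.
(* The real and imaginary parts obey the same bound in terms of |a n|, which doubles D; D >= 208
   also covers the constants 1, 4 and 208 of the other error terms. *)
exists (2 * D), 2.
move=> x Q a Kprog Kconc P X K1 K2 K3 x2 Q2 sqQ Qx a_supp Kp0 prog conc P3 PX Xt K10 K20 K31 re1 re2.
have Q1 : 1 <= Q by lra.
have P0 : 0 < P by lra.
have x0 : 0 < x by lra.
have lnP0 : 0 < ln P by rewrite ln_gt0 //; lra.
have L0 : 0 <= ln x by apply: ln_ge0; lra.
have ReD (u v : R[i]) : complex.Re (u + v) = complex.Re u + complex.Re v by case: u v => [? ?] [? ?].
have ImD (u v : R[i]) : complex.Im (u + v) = complex.Im u + complex.Im v by case: u v => [? ?] [? ?].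
have ReZ (r : R) (u : R[i]) : complex.Re (real_complex R r * u) = r * complex.Re u.
  by case: u => u v /=; rewrite mul0r subr0.
have ImZ (r : R) (u : R[i]) : complex.Im (real_complex R r * u) = r * complex.Im u.
  by case: u => u v /=; rewrite mul0r addr0.
have hRe := part_variance ReD ReZ (@Re_le_cabs R) c1 hc x2 Q2 sqQ Qx a_supp Kp0 prog conc P3 PX Xt K10 K20 K31 re1 re2.
have hIm := part_variance ImD ImZ (@Im_le_cabs R) c1 hc x2 Q2 sqQ Qx a_supp Kp0 prog conc P3 PX Xt K10 K20 K31 re1 re2.
have [Kc0 _] := conc 1 Q1.
have VE : Vvar a x Q = rV (@complex.Re R \o a) (Num.truncn x) Q + rV (@complex.Im R \o a) (Num.truncn x) Q.
  rewrite /Vvar /rV -big_split /=; apply: eq_bigr => q _; rewrite -big_split /=; apply: eq_bigr => b _.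
  by rewrite /progdev sqr_cabs (part_progdev ReD ReZ) (part_progdev ImD ImZ).
have sumE : \sum_(1 <= n < (Num.truncn x).+1) cabs (a n) ^+ 2 =
   \sum_(1 <= n < (Num.truncn x).+1) complex.Re (a n) ^+ 2 + \sum_(1 <= n < (Num.truncn x).+1) complex.Im (a n) ^+ 2.
  by rewrite -big_split /=; apply: eq_bigr => n _; rewrite sqr_cabs.
rewrite VE [in leLHS]sumE sqr_cabs; move: hRe hIm; rewrite -/D.
set I := \int[_]_(_ in _) _.
set s2 := \sum_(_ <= _ < _) cabs (a _) ^+ 2.
set E0 := \sum_(_ <= _ < _) cabs (a _) ^+ 2 * (tau _)%:R.
set Tt := \sum_(_ <= _ < _) cabs (a _) * (tau3_trunc _ _)%:R.
set T := \sum_(_ <= _ < _) cabs (a _) * (tau3 _)%:R.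
set V1 := rV _ _ _; set V2 := rV _ _ _; set s1 := \sum_(_ <= _ < _) _ ^+ 2; set s3 := \sum_(_ <= _ < _) _ ^+ 2.
set A1 := complex.Re _; set A2 := complex.Im _; set S := absum a x.
have s2E0 : s2 <= E0.
  apply: ler_sum_nat => n /andP[n0 _]; rewrite ler_peMr ?sqr_ge0 // ler1n; exact: tau_gt0.
have s20 : 0 <= s2 by apply: sumr_ge0 => n _; exact: sqr_ge0.
pose y1 := S ^+ 2 / Kprog; pose y2 := S ^+ 2 / Kconc 1 * (ln x / (P * ln P)).
have y10 : 0 <= y1 by apply: divr_ge0; [exact: sqr_ge0 | exact: ltW].
have y20 : 0 <= y2.
  apply: mulr_ge0; first by apply: divr_ge0; [exact: sqr_ge0 | exact: ltW].
  by apply: divr_ge0 => //; apply: mulr_ge0; exact: ltW.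
have rE : rankin P X = (X `^ (1 / ln P))^-1.
  rewrite /rankin /powR gt_eqF; last by apply: lt_le_trans PX.
  by rewrite -expRN; congr expR; ring.
have r0 : 0 < X `^ (1 / ln P) by apply: powR_gt0; apply: lt_le_trans PX.
rewrite -[208 * (S ^+ 2 / _) * _]mulrA -/y1 -/y2 rE.
set E := (X in D * X) => hRe hIm.
rewrite [leLHS](_ : _ = `|(V1 - (Q / 2 * s1 - Q / 2 * (A1 ^+ 2 / x) + A1 ^+ 2 * I)) +
   (V2 - (Q / 2 * s3 - Q / 2 * (A2 ^+ 2 / x) + A2 ^+ 2 * I))|); last by congr (`|_|); ring.
apply: le_trans (ler_normD _ _) _; apply: le_trans (lerD hRe hIm) _.
rewrite [leRHS](_ : _ = 2 * (D * E0) + 2 * (D * y1) + 2 * (D * y2) + 2 * (D * E)); last first.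
  by rewrite /y1 /y2 /E; field; rewrite !gt_eqF.
have h1 : s2 <= D * E0 by apply: (le_trans s2E0); apply: (ler_peMl _ D2); exact: (le_trans s20 s2E0).
have h2 : 4 * y1 <= D * y1 by apply: ler_wpM2r.
have h3 : 208 * y2 <= D * y2 by apply: ler_wpM2r.
move: (D * E0) (D * y1) (D * y2) (D * E) h1 h2 h3 => z1 z2 z3 z4; clear; lra.
Qed.
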